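(* If $\Omega$ is a rectangular box in $\mathbb{R}^n$, then $\kappa_1=\mu_2$ and their eigenspaces are the same, with respect to the boundary mean zero Laplacian with constant Neumann data (for $\kappa_1$) and the Neumann Laplacian (for $\mu_2$).
   Context: A rectangular box in $\mathbb{R}^n$ is a Cartesian product of $n$ bounded open intervals. $\mu_2$ is the second Neumann Laplacian eigenvalue of $\Omega$ (the eigenvalues being enumerated as $0=\mu_1<\mu_2\le\mu_3\le\cdots$ with multiplicity), and $$\kappa_1=\inf\Big\{\frac{\int_\Omega|\nabla u|^2\,dx}{\int_\Omega u^2\,dx}:\ u\in H^1(\Omega)\setminus\{0\},\ \int_{\partial\Omega}u\,d\sigma=0\Big\}.$$ The eigenspace of $\kappa_1$ with respect to the boundary mean zero Laplacian with constant Neumann data consists of $0$ and the functions attaining this infimum, i.e. the weak solutions $w\in H^1(\Omega)$ of $-\Delta w=\kappa_1 w$ in $\Omega$, $\frac{\partial w}{\partial\nu}=-\frac{\kappa_1}{P(\Omega)}\int_\Omega w\,dx$ on $\partial\Omega$, $\int_{\partial\Omega}w\,d\sigma=0$, where $P(\Omega)$ is the perimeter of $\Omega$, $\nu$ the outer unit normal and $d\sigma$ surface measure. The eigenspace of $\mu_2$ is the space of weak solutions $v\in H^1(\Omega)$ of $-\Delta v=\mu_2 v$ in $\Omega$, $\frac{\partial v}{\partial\nu}=0$ on $\partial\Omega$.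
   Formalization: The dimension is assumed to be n ≥ 2; for n = 1 the eigenspaces differ, since on (0,L) the function sin(πx/L) lies in the eigenspace of κ₁ but not in that of μ₂. *)

(* Defs.v *)
From HB Require Import structures.
From mathcomp Require Import all_boot all_order all_algebra.
From mathcomp Require Import all_classical all_reals all_analysis.

Set Implicit Arguments.
Unset Strict Implicit.
Unset Printing Implicit Defensive.

Import Order.TTheory GRing.Theory Num.Theory.
Import numFieldNormedType.Exports.

Local Open Scope classical_set_scope.
Local Open Scope ring_scope.

(* Row vectors carry the sigma-algebra generated by the coordinates, that is,
   the Borel sigma-algebra of R^n. *)

Section measurable_rV.
Context (R : realType) (n : nat).

Let coors : 'I_n -> 'rV[R]_n -> measurableTypeR R := fun i x => x ord0 i.

Let rV_set0 : g_sigma_preimage coors set0.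
Proof. exact: sigma_algebra0. Qed.

Let rV_setC A : g_sigma_preimage coors A -> g_sigma_preimage coors (~` A).
Proof. exact: sigma_algebraC. Qed.

Let rV_bigcup (F : _^nat) : (forall i, g_sigma_preimage coors (F i)) ->
  g_sigma_preimage coors (\bigcup_i (F i)).
Proof. exact: sigma_algebra_bigcup. Qed.

HB.instance Definition _ := @isMeasurable.Build
  (measure_tuple_display default_measure_display)
  'rV[R]_n (g_sigma_preimage coors) rV_set0 rV_setC rV_bigcup.

Lemma measurable_coord (i : 'I_n) :
  measurable_fun setT (fun x : 'rV[R]_n => x ord0 i : measurableTypeR R).
Proof.
move=> _ Y mY; rewrite setTI; apply: sub_sigma_algebra => /=.
rewrite -bigcup_seq/=; exists i => /=; first by rewrite mem_index_enum.
by exists Y => //; rewrite setTI.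
Qed.

Lemma measurable_fun_rVP d (T : measurableType d) (f : T -> 'rV[R]_n) :
  measurable_fun setT f <->
  forall i, measurable_fun setT (fun t => f t ord0 i : measurableTypeR R).
Proof.
split=> [mf i|mf].
  by apply: (measurableT_comp (measurable_coord i) mf).
pose G := [set A | measurable (f @^-1` A)].
suff : g_sigma_preimage coors `<=` G.
  by move=> h _ Y mY; rewrite setTI; exact: h.
apply: smallest_sub.
  split.
  - by rewrite /G /= preimage_set0.
  - move=> A GA; rewrite /G /= setTD preimage_setC.
    exact: (measurableC GA).
  - move=> F GF; rewrite /G /= preimage_bigcup.
    by apply: bigcup_measurable => k _; exact: GF.
rewrite -bigcup_seq => A [i _ [Y mY <-]].
rewrite /G /= setTI -comp_preimage.
by have := mf i measurableT _ mY; rewrite setTI.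
Qed.

End measurable_rV.

Section lebesgue_rV.
Context (R : realType).

Definition cons_rV n (p : measurableTypeR R * 'rV[R]_n) : 'rV[R]_n.+1 :=
  row_mx (p.1 : R)%:M p.2.

Definition uncons_rV n (x : 'rV[R]_n.+1) : measurableTypeR R * 'rV[R]_n :=
  (x ord0 ord0, \row_j x ord0 (lift ord0 j)).

Lemma cons_rV0 n p : @cons_rV n p ord0 ord0 = p.1.
Proof.
rewrite /cons_rV (_ : ord0 = lshift n (@ord0 0)); last exact: val_inj.
by rewrite (row_mxEl (n1 := 1)) !mxE eqxx mulr1n.
Qed.

Lemma cons_rVS n p j : @cons_rV n p ord0 (lift ord0 j) = p.2 ord0 j.
Proof.
rewrite /cons_rV (_ : lift ord0 j = rshift 1 j); last exact: val_inj.
by rewrite (row_mxEr (n1 := 1)).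
Qed.

Lemma cons_rVK n : cancel (@cons_rV n) (@uncons_rV n).
Proof.
move=> [t x]; rewrite /uncons_rV cons_rV0; congr pair.
by apply/rowP => j; rewrite mxE cons_rVS.
Qed.

Lemma uncons_rVK n : cancel (@uncons_rV n) (@cons_rV n).
Proof.
move=> x; apply/rowP => i; case: (unliftP ord0 i) => [j|] ->.
- by rewrite cons_rVS mxE.
- by rewrite cons_rV0.
Qed.

Lemma measurable_cons_rV n : measurable_fun setT (@cons_rV n).
Proof.
apply/measurable_fun_rVP => i; case: (unliftP ord0 i) => [j|] ->.
- under eq_fun do rewrite cons_rVS.
  exact: (measurableT_comp (measurable_coord j) measurable_snd).
- under eq_fun do rewrite cons_rV0.
  exact: measurable_fst.
Qed.

Lemma measurable_uncons_rV n : measurable_fun setT (@uncons_rV n).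
Proof.
apply: measurable_fun_pair; first exact: measurable_coord.
apply/measurable_fun_rVP => j; under eq_fun do rewrite mxE.
exact: measurable_coord.
Qed.

Section step.
Context (n : nat) (mu : {sigma_finite_measure set 'rV[R]_n -> \bar R}).

Definition cons_measure : set 'rV[R]_n.+1 -> \bar R :=
  pushforward (lebesgue_measure \x mu)%E (@cons_rV n).

Let nu : {measure set _ -> \bar R} := (lebesgue_measure \x mu)%E.

Let mpre A : measurable A -> measurable (@cons_rV n @^-1` A).
Proof. by move=> mA; rewrite -[X in measurable X]setTI; exact: measurable_cons_rV. Qed.

Let cons_measure0 : cons_measure set0 = 0%E.
Proof. by rewrite /cons_measure /pushforward preimage_set0 measure0. Qed.

Let cons_measure_ge0 A : (0 <= cons_measure A)%E.
Proof. exact: (measure_ge0 nu). Qed.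

Let cons_measure_sigma_additive : semi_sigma_additive cons_measure.
Proof.
move=> F mF tF mUF; rewrite /cons_measure /pushforward preimage_bigcup.
apply: (measure_semi_sigma_additive (s := nu)).
- by move=> k; exact: mpre.
- apply/trivIsetP => /= i j _ _ ij; rewrite -preimage_setI.
  by move/trivIsetP : tF => /(_ _ _ _ _ ij) ->//; rewrite preimage_set0.
- by rewrite -preimage_bigcup; exact: mpre.
Qed.

HB.instance Definition _ := isMeasure.Build _ _ _ cons_measure
  cons_measure0 cons_measure_ge0 cons_measure_sigma_additive.

Let cons_measure_sigma_finite : sigma_finite setT cons_measure.
Proof.
have /sigma_finiteP[F [TF ndF Foo]] :=
  sigma_finiteT (@lebesgue_measure R : {sigma_finite_measure set _ -> \bar R}).
have /sigma_finiteP[G [TG ndG Goo]] := sigma_finiteT mu.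
exists (fun k => @uncons_rV n @^-1` (F k `*` G k)).
  rewrite -preimage_bigcup; apply/seteqP; split => // x _ /=.
  have [i _ Fi] : (\bigcup_i F i) (uncons_rV x).1 by rewrite -TF.
  have [j _ Gj] : (\bigcup_i G i) (uncons_rV x).2 by rewrite -TG.
  exists (maxn i j) => //; split.
  - by move: Fi; apply/subsetPset/ndF; rewrite leq_maxl.
  - by move: Gj; apply/subsetPset/ndG; rewrite leq_maxr.
move=> k; have [mF Fk] := Foo k; have [mG Gk] := Goo k; split.
  rewrite -[X in measurable X]setTI; apply: measurable_uncons_rV => //.
  exact: measurableX.
rewrite /cons_measure /pushforward -comp_preimage.
rewrite (_ : _ \o _ = id); last by apply/funext => p; exact: cons_rVK.
by rewrite preimage_id product_measure1E// lte_mul_pinfty// ge0_fin_numE.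
Qed.

HB.instance Definition _ := Measure_isSigmaFinite.Build _ _ _ cons_measure
  cons_measure_sigma_finite.

End step.

Fixpoint lebesgue_rV n : {sigma_finite_measure set 'rV[R]_n -> \bar R} :=
  match n with
  | 0 => dirac (0 : 'rV[R]_0)
  | m.+1 => cons_measure (lebesgue_rV m)
  end.

End lebesgue_rV.

Arguments lebesgue_rV {R} n.

Section box.
Context (R : realType) (n : nat).
Implicit Types (a b : 'rV[R]_n) (i : 'I_n) (c : R).

Definition box a b : set 'rV[R]_n :=
  [set x | forall i, a ord0 i < x ord0 i < b ord0 i].

(* The point of the hyperplane [x_i = c] whose remaining coordinates, in
   order, are those of [y]. *)
Definition hyperplane_point i c (y : 'rV[R]_n.-1) : 'rV[R]_n :=
  \row_j oapp (y ord0) c (unlift i j).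

Definition face_box a b i : set 'rV[R]_n.-1 :=
  [set y | forall k, a ord0 (lift i k) < y ord0 k < b ord0 (lift i k)].

Definition face_measure a b i c : set 'rV[R]_n -> \bar R := fun A =>
  lebesgue_rV n.-1 (hyperplane_point i c @^-1` A `&` face_box a b i).

(* The boundary of [box a b] is the union of the 2n faces [x_i = a_i] and
   [x_i = b_i], up to the edges, which are negligible. *)
Definition surface_measure a b : set 'rV[R]_n -> \bar R := fun A =>
  (\sum_(i < n)
    (face_measure a b i (a ord0 i) A + face_measure a b i (b ord0 i) A))%E.

Lemma measurable_hyperplane_point i c :
  measurable_fun setT (hyperplane_point i c).
Proof.
apply/measurable_fun_rVP => j; under eq_fun do rewrite mxE.
case: (unlift i j) => [k|] /=; last exact: measurable_cst.
exact: measurable_coord.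
Qed.

Lemma measurable_face_box a b i : measurable (face_box a b i).
Proof.
have -> : face_box a b i = \bigcap_(k in [set: 'I_n.-1])
    ((fun y : 'rV[R]_n.-1 => y ord0 k : measurableTypeR R) @^-1`
      `]a ord0 (lift i k), b ord0 (lift i k)[%classic).
  apply/seteqP; split => y /= h k; last by have := h k I; rewrite /= in_itv.
  by move=> _ /=; rewrite in_itv; exact: h.
apply: fin_bigcap_measurable => // k _.
by rewrite -[X in measurable X]setTI; exact: measurable_coord.
Qed.

Section face_measure.
Context a b i c.

Let pre A : measurable A ->
  measurable (hyperplane_point i c @^-1` A `&` face_box a b i).
Proof.
move=> mA; apply: measurableI; last exact: measurable_face_box.
by rewrite -[X in measurable X]setTI; exact: measurable_hyperplane_point.
Qed.

Let face_measure0 : face_measure a b i c set0 = 0%E.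
Proof. by rewrite /face_measure preimage_set0 set0I measure0. Qed.

Let face_measure_ge0 A : (0 <= face_measure a b i c A)%E.
Proof. exact: measure_ge0. Qed.

Let face_measure_sigma_additive : semi_sigma_additive (face_measure a b i c).
Proof.
move=> F mF tF mUF; rewrite /face_measure preimage_bigcup setI_bigcupl.
apply: measure_semi_sigma_additive.
- by move=> k; exact: pre.
- apply/trivIsetP => /= k l _ _ kl; rewrite setIACA -preimage_setI.
  by move/trivIsetP : tF => /(_ _ _ _ _ kl) ->//; rewrite preimage_set0 set0I.
- by rewrite -setI_bigcupl -preimage_bigcup; exact: pre.
Qed.

HB.instance Definition _ := isMeasure.Build _ _ _ (face_measure a b i c)
  face_measure0 face_measure_ge0 face_measure_sigma_additive.

End face_measure.

Section surface_measure.
Context a b.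

Let m (k : nat) : {measure set 'rV[R]_n -> \bar R} :=
  if insub k is Some i
  then measure_add (face_measure a b i (a ord0 i))
                   (face_measure a b i (b ord0 i))
  else mzero.

Let surface_measureE : surface_measure a b = msum m n.
Proof.
apply/funext => A; rewrite /surface_measure /msum; apply: eq_bigr => i _.
by rewrite /m (valK i); exact/esym/measure_addE.
Qed.

Let surface_measure0 : surface_measure a b set0 = 0%E.
Proof. by rewrite surface_measureE measure0. Qed.

Let surface_measure_ge0 A : (0 <= surface_measure a b A)%E.
Proof. by rewrite surface_measureE; exact: measure_ge0. Qed.

Let surface_measure_sigma_additive : semi_sigma_additive (surface_measure a b).
Proof. by rewrite surface_measureE; exact: measure_semi_sigma_additive. Qed.

HB.instance Definition _ := isMeasure.Build _ _ _ (surface_measure a b)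
  surface_measure0 surface_measure_ge0 surface_measure_sigma_additive.

End surface_measure.

Definition perimeter a b : R := fine (surface_measure a b setT).

End box.

Definition square_integrable d (T : measurableType d) (R : realType)
    (mu : {measure set T -> \bar R}) (D : set T) (f : T -> R) :=
  measurable_fun D f /\ mu.-integrable D (fun x => (f x ^+ 2)%:E).

Section smooth.
Context (R : realType) (n : nat).
Implicit Types (f phi : 'rV[R]_n -> R) (i : 'I_n).

Definition partial i f : 'rV[R]_n -> R := fun x => 'D_(delta_mx ord0 i) f x.

Fixpoint is_Ck (k : nat) f : Prop :=
  match k with
  | 0 => continuous f
  | k'.+1 => continuous f /\
      forall i, (forall x, derivable f x (delta_mx ord0 i)) /\
                is_Ck k' (partial i f)
  end.

Definition smooth f := forall k, is_Ck k f.

Definition test_function (Omega : set 'rV[R]_n) phi :=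
  smooth phi /\
  exists K, [/\ compact K, K `<=` Omega & forall x, ~ K x -> phi x = 0].

End smooth.

Section H1.
Context (R : realType) (n : nat) (Omega : set 'rV[R]_n).
Local Notation lambda := (@lebesgue_rV R n).

(* A representative of an element of H^1(Omega), bundled with a representative
   of its weak gradient; the latter is unique up to a null set. *)
Record H1 := MkH1 {
  H1_fun :> 'rV[R]_n -> R ;
  grad : 'I_n -> 'rV[R]_n -> R ;
  H1_funL2 : square_integrable lambda Omega H1_fun ;
  gradL2 : forall i, square_integrable lambda Omega (grad i) ;
  grad_weak : forall i phi, test_function Omega phi ->
    \int[lambda]_(x in Omega) (H1_fun x * partial i phi x) =
    - \int[lambda]_(x in Omega) (grad i x * phi x)
}.

Definition dirichlet (u v : H1) : R :=
  \sum_(i < n) \int[lambda]_(x in Omega) (grad u i x * grad v i x).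

Definition dot (u v : H1) : R := \int[lambda]_(x in Omega) (u x * v x).

Definition ae_zero (u : 'rV[R]_n -> R) :=
  \forall x \ae lambda, Omega x -> u x = 0.

Definition neumann_eigenspace (mu : R) : set H1 :=
  [set v | forall phi : H1, dirichlet v phi = mu * dot v phi].

Definition independent k (v : 'I_k -> H1) :=
  forall c : 'I_k -> R,
    ae_zero (fun x => \sum_(j < k) c j * v j x) -> forall j, c j = 0.

(* The k-th Neumann eigenvalue (k >= 1) in nondecreasing order and with
   multiplicity: the least t such that the eigenvalues <= t have total
   multiplicity at least k. *)
Definition neumann_eigenvalue (k : nat) : R :=
  inf [set t | exists (mu : 'I_k -> R) (v : 'I_k -> H1),
    independent v /\
    forall j, mu j <= t /\ neumann_eigenspace (mu j) (v j)].

End H1.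

Section boundary_mean_zero.
Context (R : realType) (n : nat) (a b : 'rV[R]_n).
Local Notation Omega := (box a b).
Local Notation lambda := (@lebesgue_rV R n).
Local Notation sigma := (surface_measure a b).

(* [T] is the trace of [u] on the boundary: the trace operator is the
   continuous extension to H^1(Omega) -> L^2(boundary) of the restriction of
   C^infty(R^n) functions. Only the values of [T] on the
   faces of the box matter, since [sigma] is carried by them. *)
Definition is_trace (u : H1 Omega) (T : 'rV[R]_n -> R) :=
  square_integrable sigma setT T /\
  exists f : nat -> 'rV[R]_n -> R,
  [/\ forall k, smooth (f k),
      \int[lambda]_(x in Omega) (f k x - u x) ^+ 2 @[k --> \oo] --> (0 : R),
      forall i, \int[lambda]_(x in Omega) (partial i (f k) x - grad u i x) ^+ 2
        @[k --> \oo] --> (0 : R) &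
      \int[sigma]_x (f k x - T x) ^+ 2 @[k --> \oo] --> (0 : R)].

Definition boundary_mean_zero (u : H1 Omega) :=
  exists2 T, is_trace u T & \int[sigma]_x T x = 0.

Definition kappa1 : R :=
  inf [set q | exists u : H1 Omega,
    [/\ ~ ae_zero Omega u, boundary_mean_zero u
      & q = dirichlet u u / dot u u]].

(* Weak solutions of [- Delta w = kappa w] in [Omega] with
   [dw/dnu = - kappa / P * \int w] on the boundary and boundary mean zero. *)
Definition boundary_mean_zero_eigenspace (kappa : R) : set (H1 Omega) :=
  [set w | boundary_mean_zero w /\
    forall (phi : H1 Omega) T, is_trace phi T ->
      dirichlet w phi =
      kappa * dot w phi +
      (- (kappa / perimeter a b) * \int[lambda]_(x in Omega) w x) *
        \int[sigma]_x T x].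

End boundary_mean_zero.

Arguments neumann_eigenspace {R n} Omega mu.
Arguments neumann_eigenvalue {R n} Omega k.
Arguments kappa1 {R n} a b.
Arguments boundary_mean_zero_eigenspace {R n} a b kappa.

(* Main.v *)
Require Import Defs.
From mathcomp Require Import all_boot all_order all_algebra.
From mathcomp Require Import all_classical all_reals all_analysis.
From mathcomp Require Import measurable_realfun.
From mathcomp Require Import ring lra.

(* The products e_k of the cosines cos (pi k_i (x_i - a_i) / L_i) satisfy
   D(u, e_k) = lambda_k <u, e_k> for every u in H^1 of the box, by testing the
   weak gradient against cut-offs of the sine factors. They are orthogonal and
   their span is dense in L^2, which gives mu_2 = (pi / L)^2 with L the longest
   side, the Poincare inequality D(z) >= mu_2 |z|^2 for z of mean zero, and the
   fact that a mu_2-eigenfunction is a combination of the cosines of the longest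
   sides; in particular it has a trace.

   With w = pi / L and c_i the midpoint of the i-th side, the function
   psi(x) = - sum_i cos (w (x_i - c_i)) / (w sin (w L_i / 2)) solves
   - Delta psi = mu_2 psi with normal derivative 1 on every face. Hence
   Q(u, psi) = int_boundary u, where Q(u, v) = D(u, v) - mu_2 <u, v>. So Neumann
   eigenfunctions for mu_2 have boundary mean zero. Conversely, if u has boundary
   mean zero, pick t such that u + t psi has mean zero: then
   0 <= Q(u + t psi) = Q(u) + t^2 int_boundary psi. As psi < 0 on the faces in
   dimension at least 2, Q(u) >= 0, and Q(u) = 0 forces t = 0, that is
   int u = 0, so that u minimizes the Rayleigh quotient on functions of mean
   zero. *)

Set Implicit Arguments.
Unset Strict Implicit.
Unset Printing Implicit Defensive.

Import Order.TTheory GRing.Theory Num.Theory.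
Import numFieldNormedType.Exports.

Local Open Scope classical_set_scope.
Local Open Scope ring_scope.

(** * Square-integrable functions *)

(** Membership in [H1] is tested only against compactly supported functions, and a trace is given
    together with a smooth approximation; the argument runs without density of smooth functions in
    H^1 and without existence of traces. So the relation between D and the modes has to be reached
    from the interior: a cut-off of width 1/N has a derivative of size N, while u is merely in L^2,
    and the products stay bounded only because the sine factors vanish linearly on the faces.
    Green's formula for psi is applied only to functions that come with a trace, for which it is the
    limit of the smooth case. The function psi is a sum of one-variable solutions of - f'' = w^2 f
    with outward derivative 1 at both ends. Taking the longest side for L gives w L_i / 2 <= pi / 2
    for every i, which makes the sines positive and the cosines nonnegative on the closed box. In
    dimension 1 the equality of the eigenspaces itself fails: psi then vanishes at both end points,
    so it has boundary mean zero and Q(psi, psi) = 0. It solves the boundary mean zero problem, but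
    its mean is not 0, so it is no Neumann eigenfunction. *)

Section square_integrable_theory.
Context d (T : measurableType d) (R : realType).
Context (mu : {measure set T -> \bar R}) (D : set T).
Hypothesis mD : measurable D.
Local Notation sqint := (square_integrable mu D).
Local Notation RI f := (\int[mu]_(x in D) f x).

Lemma sqint_integrableM (f g : T -> R) : sqint f -> sqint g ->
  mu.-integrable D (EFin \o (fun x => f x * g x)).
Proof.
move=> [mf if2] [mg ig2].
apply: (le_integrable mD _ _ (integrableD mD if2 ig2)).
  by apply/measurable_EFinP; exact: measurable_funM.
move=> x Dx /=; rewrite lee_fin normrM [leRHS]ger0_norm ?addr_ge0 ?sqr_ge0//.
rewrite -(real_normK (num_real (f x))) -(real_normK (num_real (g x))).
have := sqr_ge0 (`|f x| - `|g x|); have := normr_ge0 (f x).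
have := normr_ge0 (g x); nra.
Qed.

Lemma sqintD (f g : T -> R) : sqint f -> sqint g -> sqint (fun x => f x + g x).
Proof.
move=> sf sg; split; first exact: measurable_funD sf.1 sg.1.
apply: (eq_integrable mD (fun x => ((f x ^+ 2)%:E + ((f x * g x)%:E +
    (f x * g x)%:E) + (g x ^+ 2)%:E)%E)) => //.
  by move=> x _; rewrite -!EFinD; congr EFin; ring.
apply: integrableD => //; last exact: sg.2.
apply: integrableD => //; first exact: sf.2.
by apply: integrableD => //; exact: sqint_integrableM.
Qed.

Lemma sqintZ (c : R) (f : T -> R) : sqint f -> sqint (fun x => c * f x).
Proof.
move=> [mf if2]; split; first exact: measurable_funM.
apply: (eq_integrable mD (fun x => ((c ^+ 2)%:E * (f x ^+ 2)%:E)%E)) => //.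
  by move=> x _; rewrite -!EFinM exprMn.
exact: integrableZl.
Qed.

Lemma eq_sqint (f g : T -> R) : f =1 g -> sqint f -> sqint g.
Proof. by move=> /funext ->. Qed.

Lemma sqintB (f g : T -> R) : sqint f -> sqint g -> sqint (fun x => f x - g x).
Proof.
move=> sf /(sqintZ (-1)) sg; apply: (eq_sqint _ (sqintD sf sg)) => x.
by rewrite mulN1r.
Qed.

Lemma RintegralDM (f g h : T -> R) : sqint f -> sqint g -> sqint h ->
  RI (fun x => (f x + g x) * h x) = RI (fun x => f x * h x) + RI (fun x => g x * h x).
Proof.
move=> sf sg sh.
rewrite -RintegralD//; [|exact: sqint_integrableM|exact: sqint_integrableM].
by apply: eq_Rintegral => x _; rewrite mulrDl.
Qed.

Lemma RintegralZM c (f h : T -> R) : sqint f -> sqint h ->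
  RI (fun x => (c * f x) * h x) = c * RI (fun x => f x * h x).
Proof.
move=> sf sh; rewrite -RintegralZl//; last exact: sqint_integrableM.
by apply: eq_Rintegral => x _; rewrite mulrA.
Qed.

Lemma RintegralBM (f g h : T -> R) : sqint f -> sqint g -> sqint h ->
  RI (fun x => (f x - g x) * h x) = RI (fun x => f x * h x) - RI (fun x => g x * h x).
Proof.
move=> sf sg sh.
rewrite -RintegralB//; [|exact: sqint_integrableM|exact: sqint_integrableM].
by apply: eq_Rintegral => x _; rewrite mulrBl.
Qed.

Lemma RintegralC (f g : T -> R) : RI (fun x => f x * g x) = RI (fun x => g x * f x).
Proof. by apply: eq_Rintegral => x _; rewrite mulrC. Qed.

Lemma quadratic_discriminant (A B C : R) :
  (forall t, 0 <= A + 2 * t * B + t ^+ 2 * C) -> B ^+ 2 <= A * C.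
Proof.
move=> h; have A0 : 0 <= A by have := h 0; lra.
have [C0|C0|C0] := ltgtP C 0.
(* A negative [C] is absurd: for this [t], which is at least 1, the quadratic term outweighs the
   other two. *)
- have := h ((2 * `|B| + A + 1) / (- C) + 1).
  set t := _ + 1 => ht.
  have tC : t ^+ 2 * C = - t * (2 * `|B| + A + 1 - C) by rewrite /t; field; lra.
  have t1 : 1 <= t.
    by rewrite /t lerDr divr_ge0//; [have := normr_ge0 B; lra|lra].
  have tB : 0 <= t * (`|B| - B) by rewrite mulr_ge0 ?subr_ge0 ?ler_norm//; lra.
  have : 0 <= t * (A + 1 - C) by apply: mulr_ge0; lra.
  have : 0 <= (t - 1) * (A + 1) by apply: mulr_ge0; lra.
  have : t * C <= 0 by rewrite pmulr_rle0; lra.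
  by move: ht; rewrite tC; lra.
- by have := h (- B / C); rewrite (_ : _ + _ = (A * C - B ^+ 2) / C);
    [rewrite pmulr_lge0 ?invr_gt0// subr_ge0|field; lra].
- rewrite C0 mulr0; have [->|B0] := eqVneq B 0; first by rewrite expr0n.
  (* At this point the affine function [A + 2 * t * B] takes the value -1. *)
  have := h (- (A + 1) / (2 * B)); rewrite C0 mulr0 addr0.
  by rewrite (_ : 2 * _ * _ = - (A + 1)); [lra|field].
Qed.

Lemma sqint_quad (f g : T -> R) t : sqint f -> sqint g ->
  RI (fun x => (f x + t * g x) ^+ 2) =
  RI (fun x => f x ^+ 2) + 2 * t * RI (fun x => f x * g x)
  + t ^+ 2 * RI (fun x => g x ^+ 2).
Proof.
move=> sf sg; have stg := sqintZ t sg.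
rewrite RintegralDM//; last exact: sqintD.
rewrite RintegralZM//; last exact: sqintD.
rewrite [X in X + _]RintegralC [X in _ + t * X]RintegralC.
rewrite !RintegralDM// !RintegralZM// (RintegralC g f).
by rewrite expr2; ring.
Qed.

Lemma Rintegral_cauchy_schwarz (f g : T -> R) : sqint f -> sqint g ->
  RI (fun x => f x * g x) ^+ 2 <= RI (fun x => f x ^+ 2) * RI (fun x => g x ^+ 2).
Proof.
move=> sf sg; apply: quadratic_discriminant => t; rewrite -sqint_quad//.
by apply: Rintegral_ge0 => x _; exact: sqr_ge0.
Qed.

Lemma sqint_norm_le (f g : T -> R) : sqint f -> sqint g ->
  RI (fun x => (f x + g x) ^+ 2) <=
  2 * RI (fun x => f x ^+ 2) + 2 * RI (fun x => g x ^+ 2).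
Proof.
move=> sf sg; have := sqint_quad (-1) sf sg; have := sqint_quad 1 sf sg.
have -> : RI (fun x => (f x + 1 * g x) ^+ 2) = RI (fun x => (f x + g x) ^+ 2).
  by apply: eq_Rintegral => x _; rewrite mul1r.
have : 0 <= RI (fun x => (f x + -1 * g x) ^+ 2).
  by apply: Rintegral_ge0 => x _; exact: sqr_ge0.
by move=> h -> h2; move: h; rewrite h2; lra.
Qed.

Lemma Rintegral_sqr_eq0 (f : T -> R) : sqint f ->
  RI (fun x => f x ^+ 2) = 0 -> {ae mu, forall x, D x -> f x = 0}.
Proof.
move=> [mf if2] I0.
have mf2 : measurable_fun D (fun x => (f x ^+ 2)%:E).
  by have /integrableP[] := if2.
have : (\int[mu]_(x in D) `|(f x ^+ 2)%:E| = 0)%E.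
  under eq_integral do rewrite gee0_abs ?lee_fin ?sqr_ge0//.
  by rewrite -[LHS]fineK ?integrable_fin_num// -[X in X%:E]/(RI (fun x => f x ^+ 2)) I0.
move=> /(ae_eq_integral_abs mu mD mf2).1; apply: filterS => x h Dx.
by have [/eqP] := h Dx; rewrite sqrf_eq0 => /eqP.
Qed.

Lemma Rintegral_ae_eq0 (f : T -> R) : {ae mu, forall x, D x -> f x = 0} ->
  measurable_fun D f -> RI f = 0.
Proof.
move=> f0 mf; rewrite /Rintegral (ae_eq_integral (cst 0%E)) ?integral0//.
- exact/measurable_EFinP.
- by apply: filterS f0 => x h Dx; rewrite h.
Qed.

Lemma Rintegral_dominated (f_ : nat -> T -> R) (f g : T -> R) :
  (forall n, measurable_fun D (f_ n)) -> measurable_fun D f ->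
  (forall x, D x -> f_ ^~ x @ \oo --> f x) ->
  mu.-integrable D (EFin \o g) -> (forall n x, D x -> `|f_ n x| <= g x) ->
  RI (f_ n) @[n --> \oo] --> RI f.
Proof.
move=> mf_ mf ff ig fg.
have [|||||i1 _ h] := @dominated_convergence _ _ _ mu D mD
  (fun n x => (f_ n x)%:E) (EFin \o f) (EFin \o g).
- by move=> n; apply/measurable_EFinP.
- exact/measurable_EFinP.
- by apply: aeW => x Dx; apply: cvg_EFin; [exact: nearW|exact: ff].
- exact: ig.
- by apply: aeW => x n Dx; rewrite lee_fin; exact: fg.
apply: fine_cvg; rewrite fineK//; exact: integrable_fin_num.
Qed.

Hypothesis fD : (mu D < +oo)%E.

Lemma sqint_bounded (f : T -> R) (C : R) : measurable_fun D f ->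
  (forall x, D x -> `|f x| <= C) -> sqint f.
Proof.
move=> mf fC; split=> //.
apply: (@measurable_bounded_integrable _ _ _ _ (fun x => f x ^+ 2)) => //.
  exact: measurable_funX.
exists (C ^+ 2); split; first exact: num_real.
move=> M CM x Dx /=; apply: le_trans (ltW CM).
rewrite normrX lerXn2r ?nnegrE ?normr_ge0//; last exact: fC.
exact: le_trans (normr_ge0 _) (fC _ Dx).
Qed.

Lemma sqint_cst (c : R) : sqint (fun=> c).
Proof. by apply: (@sqint_bounded _ `|c|) => // x _; rewrite lexx. Qed.

Lemma sqint_integrable (f : T -> R) : sqint f -> mu.-integrable D (EFin \o f).
Proof.
move=> sf; have := sqint_integrableM sf (sqint_cst 1).
by apply: eq_integrable => // x _ /=; rewrite mulr1.
Qed.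

(** As [D] has finite measure, the square-integrable [u] is integrable, and a multiple of its
    absolute value dominates. *)
Lemma sqint_dominated (u : T -> R) (f_ : nat -> T -> R) (f : T -> R) (C : R) :
  sqint u -> (forall n, measurable_fun D (f_ n)) -> measurable_fun D f ->
  (forall n x, D x -> `|f_ n x| <= C) ->
  (forall x, D x -> f_ ^~ x @ \oo --> f x) ->
  RI (fun x => u x * f_ n x) @[n --> \oo] --> RI (fun x => u x * f x).
Proof.
move=> su mf_ mf fC ff.
apply: (@Rintegral_dominated _ _ (fun x => C * `|u x|)).
- by move=> n; apply: measurable_funM => //; exact: su.1.
- by apply: measurable_funM => //; exact: su.1.
- by move=> x Dx; apply: cvgMr; exact: ff.
- apply: (eq_integrable mD (fun x => (C%:E * `|(u x)%:E|)%E)) => //.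
  by apply: integrableZl => //; apply: integrable_abse; exact: sqint_integrable.
- move=> n x Dx; rewrite normrM mulrC ler_wpM2r//; exact: fC.
Qed.

Lemma bounded_cvg_sqr (f_ : nat -> T -> R) (f : T -> R) (C : R) :
  (forall n, measurable_fun D (f_ n)) -> measurable_fun D f ->
  (forall n x, D x -> `|f_ n x| <= C) ->
  (forall x, D x -> f_ ^~ x @ \oo --> f x) ->
  RI (fun x => (f x - f_ n x) ^+ 2) @[n --> \oo] --> (0 : R).
Proof.
move=> mf_ mf fC ff.
have fC' x : D x -> `|f x| <= C.
  move=> Dx; apply: (@cvgr_to_le _ \oo _ _ (fun n => `|f_ n x|)).
    by apply: cvg_norm; exact: ff.
  by apply: nearW => n; exact: fC.
have -> : 0 = RI (fun x => (f x - f x) ^+ 2).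
  rewrite (@eq_Rintegral _ _ _ _ _ (fun=> 0)) ?Rintegral_cst ?mul0r// => x _.
  by rewrite subrr expr0n.
apply: (@Rintegral_dominated _ _ (fun=> (2 * C) ^+ 2)).
- by move=> n; apply: measurable_funX; exact: measurable_funB.
- by apply: measurable_funX; exact: measurable_funB.
- move=> x Dx; apply: (@cvgM _ _ _ _ (fun n => f x - f_ n x) (fun n => f x - f_ n x)).
    by apply: cvgB; [exact: cvg_cst|exact: ff].
  by apply: cvgB; [exact: cvg_cst|exact: ff].
- by apply: sqint_integrable; exact: sqint_cst.
- move=> n x Dx; rewrite normrX lerXn2r ?nnegrE ?normr_ge0//.
    by rewrite mulr_ge0//; apply: le_trans (normr_ge0 _) (fC' _ Dx).
  apply: le_trans (ler_normB _ _) _; have := fC' x Dx; have := fC n x Dx; lra.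
Qed.

End square_integrable_theory.

(** * Density in L^2 from the indicators of a generating pi-system *)

Section square_integrable_density.
Context d (T : measurableType d) (R : realType).
Context (mu : {measure set T -> \bar R}) (D : set T).
Hypothesis mD : measurable D.
Hypothesis fD : (mu D < +oo)%E.
Local Notation sqint := (square_integrable mu D).
Local Notation RI f := (\int[mu]_(x in D) f x).
Variable V : set (T -> R).
Hypothesis Vsq : forall p, V p -> sqint p.
Hypothesis V1 : V (fun=> 1).
Hypothesis Vlin : forall c p q, V p -> V q -> V (fun x => p x + c * q x).

Definition L2_closure (f : T -> R) :=
  forall e, 0 < e -> exists2 p, V p & RI (fun x => (f x - p x) ^+ 2) < e.

Lemma L2_closure_sub p : V p -> L2_closure p.
Proof.
move=> Vp e e0; exists p => //; rewrite (@eq_Rintegral _ _ _ _ _ (fun=> 0)).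
  by rewrite Rintegral_cst// mul0r.
by move=> x _; rewrite subrr expr0n.
Qed.

Lemma L2_closure_lin c f g : sqint f -> sqint g -> L2_closure f -> L2_closure g ->
  L2_closure (fun x => f x + c * g x).
Proof.
move=> sf sg cf cg e e0.
have [p Vp pe] := cf (e / 4) ltac:(lra).
have k0 : 0 < 4 * (c ^+ 2 + 1) by have := sqr_ge0 c; lra.
have [q Vq qe] := cg (e / (4 * (c ^+ 2 + 1))) (divr_gt0 e0 k0).
exists (fun x => p x + c * q x); first exact: Vlin.
have sp := Vsq Vp; have sq := Vsq Vq.
have sfp := sqintB mD sf sp; have sgq := sqintB mD sg sq.
have scgq := sqintZ mD c sgq.
have := sqint_norm_le mD sfp scgq.
have -> : RI (fun x => (c * (g x - q x)) ^+ 2) =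
    c ^+ 2 * RI (fun x => (g x - q x) ^+ 2).
  rewrite -RintegralZl//; last exact: sgq.2.
  by apply: eq_Rintegral => x _; rewrite exprMn.
have -> : RI (fun x => (f x - p x + c * (g x - q x)) ^+ 2) =
    RI (fun x => (f x + c * g x - (p x + c * q x)) ^+ 2).
  by apply: eq_Rintegral => x _; congr (_ ^+ 2); ring.
move: qe; rewrite ltr_pdivlMr// => qe h.
have I0 : 0 <= RI (fun x => (g x - q x) ^+ 2).
  by apply: Rintegral_ge0 => x _; exact: sqr_ge0.
have := sqr_ge0 c; nra.
Qed.

Lemma L2_closure_lim (f_ : nat -> T -> R) f :
  sqint f -> (forall n, sqint (f_ n)) -> (forall n, L2_closure (f_ n)) ->
  RI (fun x => (f x - f_ n x) ^+ 2) @[n --> \oo] --> (0 : R) -> L2_closure f.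
Proof.
move=> sf sf_ cf_ f0 e e0.
have /cvgrPdist_lt/(_ (e / 4) ltac:(lra)) [N _ /(_ N (leqnn _))/=] := f0.
rewrite sub0r normrN => hN.
have [p Vp pe] := cf_ N (e / 4) ltac:(lra).
exists p => //.
have := sqint_norm_le mD (sqintB mD sf (sf_ N)) (sqintB mD (sf_ N) (Vsq Vp)).
have -> : RI (fun x => (f x - f_ N x + (f_ N x - p x)) ^+ 2) =
    RI (fun x => (f x - p x) ^+ 2).
  by apply: eq_Rintegral => x _; congr (_ ^+ 2); ring.
by have := ler_norm (RI (fun x => (f x - f_ N x) ^+ 2)); lra.
Qed.

Lemma sqint_indic (A : set T) : measurable A -> sqint (\1_A : T -> R).
Proof.
move=> mA; apply: (@sqint_bounded _ _ _ _ _ mD fD _ 1); first exact: measurable_indic.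
by move=> x _; rewrite indicE; case: (_ \in _); rewrite ?normr1 ?normr0.
Qed.

Lemma L2_closure_zero : L2_closure (fun=> 0).
Proof.
have := L2_closure_sub (Vlin (-1) V1 V1); congr L2_closure.
by apply/funext => x; rewrite mulN1r subrr.
Qed.

Variable G : set (set T).
Hypothesis mG : @measurable _ T = <<s G >>.
Hypothesis GI : setI_closed G.
Hypothesis GV : forall A, G A -> L2_closure (\1_A : T -> R).

(** Dynkin's theorem: the sets whose indicator lies in the closure are stable under complement,
    because [V] contains 1, and under countable disjoint unions, because the finite partial unions
    converge boundedly. *)
Lemma L2_closure_indic (A : set T) : measurable A -> L2_closure (\1_A : T -> R).
Proof.
move=> mA; move: (mA); rewrite mG.
apply: (@dynkin_induction _ _ G (fun A => L2_closure (\1_A : T -> R))) => //.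
- by rewrite indicT; exact: L2_closure_sub.
- move=> S mS cS; have := @L2_closure_lin (-1) (fun=> 1) \1_S (sqint_cst mD fD 1)
    (sqint_indic mS) (L2_closure_sub V1) cS.
  congr L2_closure; apply/funext => x; rewrite !indicE in_setC.
  by case: (x \in S) => /=; lra.
- move=> F mF tF cF.
  have mU n : measurable (\big[setU/set0]_(k < n) F k).
    by apply: bigsetU_measurable => k _.
  have cU n : L2_closure (\1_(\big[setU/set0]_(k < n) F k) : T -> R).
    elim: n => [|n IH].
      by rewrite big_ord0 indic0; exact: L2_closure_zero.
    have := @L2_closure_lin 1 _ _ (sqint_indic (mU n)) (sqint_indic (mF n)) IH (cF n).
    congr L2_closure; apply/funext => x; rewrite big_ord_recr/= !indicE in_setU mul1r.
    have [xU|xU] := boolP (x \in _); have [xF|xF] := boolP (x \in F n);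
      rewrite /= ?addr0 ?add0r//.
    exfalso; move: xU xF; rewrite !inE -bigcup_mkord => -[k /= kn Fk] Fn.
    by move/trivIsetP : tF => /(_ k n I I); rewrite ltn_eqF// => /(_ isT)/seteqP[/(_ x)]/=; tauto.
  apply: (L2_closure_lim _ _ cU).
  + by apply: sqint_indic; exact: bigcupT_measurable.
  + by move=> n; exact: sqint_indic.
  + apply: (@bounded_cvg_sqr _ _ _ _ _ mD fD _ _ 1).
    * by move=> n; exact: measurable_indic.
    * by apply: measurable_indic; exact: bigcupT_measurable.
    * by move=> n x _; rewrite indicE; case: (_ \in _); rewrite ?normr1 ?normr0.
    * move=> x Dx; apply: cvg_near_cst.
      have [[k _ Fk]|nF] := pselect ((\bigcup_n F n) x).
        exists k.+1 => // n /= kn; rewrite !indicE !mem_set//; first by exists k.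
        by rewrite -bigcup_mkord; exists k.
      apply: nearW => n; rewrite !indicE !memNset//.
      by rewrite -bigcup_mkord => -[k _ Fk]; apply: nF; exists k.
Qed.

Lemma L2_closure_sum (J : Type) (r : seq J) (c : J -> R) (h : J -> T -> R) :
  (forall i, sqint (h i)) -> (forall i, L2_closure (h i)) ->
  sqint (fun x => \sum_(i <- r) c i * h i x) /\
  L2_closure (fun x => \sum_(i <- r) c i * h i x).
Proof.
move=> sh ch; elim: r => [|i r [IHs IHc]].
  under eq_fun do rewrite big_nil.
  by split; [exact: sqint_cst|exact: L2_closure_zero].
under eq_fun do rewrite big_cons addrC.
by split; [apply: sqintD => //; exact: sqintZ|exact: L2_closure_lin].
Qed.

Import HBNNSimple.

Lemma L2_closure_ge0 f : sqint f -> (forall x, 0 <= f x) -> L2_closure f.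
Proof.
move=> sf f0.
have mf : measurable_fun D (EFin \o f) by apply/measurable_EFinP; exact: sf.1.
pose g := nnsfun_approx mD mf.
have gf x : D x -> (fun n => g n x) @ \oo --> f x.
  move=> Dx; have := @cvg_nnsfun_approx _ _ _ _ mD _ mf (fun x _ => f0 x) x Dx.
  by move=> /fine_cvg.
have nd := nd_nnsfun_approx mD mf.
have gle n x : D x -> 0 <= g n x <= f x.
  move=> Dx; apply/andP; split => //.
  rewrite -(cvg_lim _ (gf x Dx))//; apply: nondecreasing_cvgn_le; last first.
    by apply/cvg_ex; exists (f x); exact: gf.
  by move=> m k mk; have /lefP := nd _ _ mk; exact.
have h n : sqint (g n) /\ L2_closure (g n).
  have -> : (g n : T -> R) =
    (fun x => \sum_(y <- finmap.enum_fset (fset_set (range (g n)))) y * \1_(g n @^-1` [set y]) x).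
    by apply/funext => x; rewrite {1}(fimfunE (g n)) fsbig_finite.
  apply: L2_closure_sum => y; first exact: sqint_indic.
  exact: L2_closure_indic.
apply: (@L2_closure_lim g) => //; [by move=> n; exact: (h n).1|by move=> n; exact: (h n).2|].
have -> : 0 = RI (fun x => (f x - f x) ^+ 2).
  rewrite (@eq_Rintegral _ _ _ _ _ (fun=> 0)) ?Rintegral_cst ?mul0r// => x _.
  by rewrite subrr expr0n.
apply: (@Rintegral_dominated _ _ _ _ _ mD _ _ (fun x => f x ^+ 2)).
- by move=> n; apply: measurable_funX; apply: measurable_funB; [exact: sf.1|exact: (h n).1.1].
- by apply: measurable_funX; apply: measurable_funB; exact: sf.1.
- move=> x Dx; apply: (@cvgM _ _ _ _ (fun n => f x - g n x) (fun n => f x - g n x)).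
    by apply: cvgB; [exact: cvg_cst|exact: gf].
  by apply: cvgB; [exact: cvg_cst|exact: gf].
- exact: sf.2.
- move=> n x Dx; have /andP[g0 gl] := gle n x Dx.
  by rewrite ger0_norm ?sqr_ge0// lerXn2r ?nnegrE//; lra.
Qed.

(** Half the difference of the nonnegative functions |f| + f and |f| - f is f. *)
Lemma L2_closure_dense f : sqint f -> L2_closure f.
Proof.
move=> sf.
have sa : sqint (fun x => `|f x|).
  split; first by apply: measurableT_comp => //; exact: sf.1.
  by apply: (eq_integrable mD _ _ _ sf.2) => x _; rewrite real_normK ?num_real.
have sp : sqint (fun x => `|f x| + f x) by exact: sqintD.
have sn : sqint (fun x => `|f x| - f x) by exact: sqintB.
have cp : L2_closure (fun x => `|f x| + f x).
  by apply: L2_closure_ge0 => // x; have := ler_norm (- f x); rewrite normrN; lra.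
have cn : L2_closure (fun x => `|f x| - f x).
  by apply: L2_closure_ge0 => // x; have := ler_norm (f x); lra.
have sd : sqint (fun x => `|f x| + f x + -1 * (`|f x| - f x)).
  by apply: sqintD => //; exact: sqintZ.
have := @L2_closure_lin 2^-1 _ _ (sqint_cst mD fD 0) sd L2_closure_zero
  (@L2_closure_lin (-1) _ _ sp sn cp cn).
by congr L2_closure; apply/funext => x; lra.
Qed.

End square_integrable_density.

(** * Lebesgue measure on boxes *)

Section rV_measurable.
Context (R : realType) (n : nat).

Definition rect (Y : 'I_n -> set R) : set 'rV[R]_n :=
  [set x | forall i, Y i (x ord0 i)].

Lemma rectE (Y : 'I_n -> set R) : rect Y = \bigcap_(i in [set: 'I_n])
  ((fun x : 'rV[R]_n => x ord0 i : measurableTypeR R) @^-1` Y i).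
Proof. by apply/seteqP; split=> x h i; [move=> _|]; exact: h. Qed.

Lemma measurable_rect (Y : 'I_n -> set R) :
  (forall i, measurable (Y i)) -> measurable (rect Y).
Proof.
move=> mY; rewrite rectE; apply: fin_bigcap_measurable => // i _.
by rewrite -[X in measurable X]setTI; apply: measurable_coord => //; exact: mY.
Qed.

Lemma box_rect (a b : 'rV[R]_n) :
  box a b = rect (fun i => `]a ord0 i, b ord0 i[%classic).
Proof.
by apply/seteqP; split=> x h i; have := h i; rewrite /= in_itv.
Qed.

Lemma measurable_box (a b : 'rV[R]_n) : measurable (box a b).
Proof. by rewrite box_rect; exact: measurable_rect. Qed.

Lemma rectI (Y Z : 'I_n -> set R) :
  rect Y `&` rect Z = rect (fun i => Y i `&` Z i).
Proof.
apply/seteqP; split=> [x [h1 h2] i|x h]; first by split; [exact: h1|exact: h2].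
by split=> i; have [] := h i.
Qed.

Lemma measurable_rV_sub (G : set (set 'rV[R]_n)) :
  (forall i (Y : set R), measurable Y ->
    <<s G >> [set x : 'rV[R]_n | Y (x ord0 i)]) ->
  @measurable _ 'rV[R]_n `<=` <<s G >>.
Proof.
move=> h; apply: smallest_sub; first exact: smallest_sigma_algebra.
rewrite -bigcup_seq => A [i _ [Y mY <-]]; rewrite setTI; exact: h.
Qed.

Definition rects : set (set 'rV[R]_n) :=
  [set A | exists2 Y, (forall i, measurable (Y i)) & A = rect Y].

Lemma rects_generate : @measurable _ 'rV[R]_n = <<s rects >>.
Proof.
apply/seteqP; split; last first.
  apply: smallest_sub; first exact: sigma_algebra_measurable.
  by move=> _ [Y mY ->]; exact: measurable_rect.
apply: measurable_rV_sub => i Y mY; apply: sub_sigma_algebra.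
exists (fun j => if j == i then Y else setT); first by move=> j; case: ifP.
apply/seteqP; split=> [x Yx j|x /(_ i)]/=; last by rewrite eqxx.
by case: eqP => // ->.
Qed.

(** This pi-system is chosen for the density of cosines: its indicators are products of steps with a
    single jump in each variable, and a monotone function of that variable can produce such a
    step. *)
Definition orthant (c : 'I_n -> R) : set 'rV[R]_n :=
  [set x | forall i, c i < x ord0 i].

Definition orthants : set (set 'rV[R]_n) :=
  [set A | exists c, A = orthant c].

Lemma orthants_setI : setI_closed orthants.
Proof.
move=> _ _ [c ->] [e ->]; exists (fun i => Num.max (c i) (e i)).
apply/seteqP; split=> [x [h1 h2] i|x h]; first by rewrite gt_max h1 h2.
by split=> i; have := h i; rewrite gt_max => /andP[].
Qed.

Lemma orthants_generate : @measurable _ 'rV[R]_n = <<s orthants >>.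
Proof.
apply/seteqP; split; last first.
  apply: smallest_sub; first exact: sigma_algebra_measurable.
  move=> _ [c ->]; rewrite (_ : orthant c = rect (fun i => `]c i, +oo[%classic)).
    exact: measurable_rect.
  by apply/seteqP; split=> x h i; have := h i; rewrite /= in_itv/= andbT.
apply: measurable_rV_sub => i Y mY.
have {mY} : (@RGenOInfty.G R).-sigma.-measurable Y.
  by rewrite -RGenOInfty.measurableE.
pose H := [set Y : set R | <<s orthants >> [set x : 'rV[R]_n | Y (x ord0 i)]].
suff h : <<s @RGenOInfty.G R >> `<=` H by exact: h.
apply: smallest_sub.
  split.
  - rewrite /H /=; rewrite (_ : [set _ | _] = set0); first exact: sigma_algebra0.
    by apply/seteqP; split.
  - by move=> A HA; rewrite setTD; exact: (sigma_algebraC HA).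
  - move=> F HF; rewrite /H/=.
    rewrite (_ : [set _ | _] = \bigcup_k [set x : 'rV[R]_n | F k (x ord0 i)]).
      exact: sigma_algebra_bigcup.
    by apply/seteqP; split=> x [k _ h]; exists k.
move=> _ [c ->]; rewrite /H /=.
(* The half-space is exhausted by orthants whose other coordinates are bounded below by - k. *)
rewrite (_ : [set _ | _] = \bigcup_(k in [set: nat])
    orthant (fun j => if j == i then c else - k%:R)).
  apply: sigma_algebra_bigcup => k; apply: sub_sigma_algebra.
  by exists (fun j => if j == i then c else - k%:R).
apply/seteqP; split=> [x /=|x [k _ /(_ i)]/=]; last first.
  by rewrite eqxx in_itv/= andbT.
rewrite in_itv/= andbT => cx.
exists (Num.bound (\sum_j `|x ord0 j|)) => // j; case: eqP => [->//|_].
rewrite ltrNl; apply: le_lt_trans (archi_boundP _); last first.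
  by apply: sumr_ge0 => k _.
rewrite (bigD1 j)//= -[leLHS]addr0 lerD ?sumr_ge0//.
by rewrite -normrN ler_norm.
Qed.

(** The sigma-algebra is generated by the coordinates, so openness enters through a countable cover:
    [U] is the union of the cubes with rational centre and radius that it contains. *)
Lemma open_measurable_rV (U : set 'rV[R]_n) : open U -> measurable U.
Proof.
move=> oU.
pose c (p : 'rV[rat]_n * rat) : 'rV[R]_n := \row_j ratr (p.1 ord0 j).
pose r (p : 'rV[rat]_n * rat) : R := ratr p.2.
pose B (p : 'rV[rat]_n * rat) : set 'rV[R]_n :=
  rect (fun i => `]c p ord0 i - r p, c p ord0 i + r p[%classic).
pose F p := if `[< B p `<=` U >] then B p else set0.
rewrite (_ : U = \bigcup_(p in [set: _]) F p).
  apply: countable_bigcupT_measurable; first exact: countableP.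
  move=> p; rewrite /F; case: ifP => // _; apply: measurable_rect => i.
  exact: measurable_itv.
apply/seteqP; split=> [x Ux|x [p _]]; last by rewrite /F; case: asboolP => // h /h.
have /nbhs_ballP[e /= e0 eU] := open_nbhs_nbhs (conj oU Ux).
have [q /andP[q0 qe]] : exists q : rat, (0 : R) < ratr q < e / 2.
  by have [q] := @rat_in_itvoo R 0 (e / 2) (divr_gt0 e0 (ltr0Sn _ _)); rewrite in_itv/=; exists q.
have /choice[g hg] : forall j, exists s : rat, x ord0 j - ratr q < ratr s < x ord0 j + ratr q.
  move=> j; have [|s] := @rat_in_itvoo R (x ord0 j - ratr q) (x ord0 j + ratr q); first lra.
  by rewrite in_itv/=; exists s.
exists (\row_j g j, q) => //; rewrite /F; case: asboolP => [_|[]].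
  by move=> j; rewrite /= in_itv/= /c/r/= !mxE; have := hg j; lra.
move=> y By; apply: eU; split=> // i j; rewrite ord1 /ball/=.
have := By j; rewrite /= in_itv/= /c/r/= !mxE => /andP[h1 h2].
have /andP[h3 h4] := hg j; rewrite ltr_norml; apply/andP; split; lra.
Qed.

Lemma continuous_measurable_rV (f : 'rV[R]_n -> R) :
  continuous f -> measurable_fun setT f.
Proof.
move=> /continuousP cf; apply: (measurability _ (RGenOpens.measurableE R)).
move=> _ [_ [a [b ->] <-]]; rewrite setTI; apply: open_measurable_rV.
exact: cf.
Qed.

End rV_measurable.

(** * Slicing along an arbitrary coordinate *)

Section coordinate_Fubini.
Context (R : realType) (n : nat) (i : 'I_n.+1).

Definition insert_coord (p : measurableTypeR R * 'rV[R]_n) : 'rV[R]_n.+1 :=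
  hyperplane_point i (p.1 : R) p.2.

Lemma hyperplane_point_eq c (y : 'rV[R]_n) : hyperplane_point i c y ord0 i = c.
Proof. by rewrite mxE unlift_none. Qed.

Lemma hyperplane_point_lift c (y : 'rV[R]_n) k :
  hyperplane_point i c y ord0 (lift i k) = y ord0 k.
Proof. by rewrite mxE liftK. Qed.

Lemma measurable_insert_coord : measurable_fun setT insert_coord.
Proof.
apply/measurable_fun_rVP => j; case: (unliftP i j) => [k|] ->.
- under eq_fun do rewrite hyperplane_point_lift.
  exact: (measurableT_comp (measurable_coord k) measurable_snd).
- by under eq_fun do rewrite hyperplane_point_eq; exact: measurable_fst.
Qed.

Lemma preimage_insert_coord_rect (Y : 'I_n.+1 -> set R) :
  insert_coord @^-1` rect Y = Y i `*` rect (fun k => Y (lift i k)).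
Proof.
apply/seteqP; split=> [[t y] h|[t y] [/= h1 h2] j]; last first.
  case: (unliftP i j) => [k|] -> /=; first by rewrite hyperplane_point_lift; exact: h2.
  by rewrite hyperplane_point_eq.
split=> /=; first by have := h i; rewrite /= hyperplane_point_eq.
by move=> k; have := h (lift i k); rewrite /= hyperplane_point_lift.
Qed.

End coordinate_Fubini.

Section lebesgue_rect.
Context (R : realType).

Lemma lebesgue_rV_rect n (Y : 'I_n -> set R) : (forall i, measurable (Y i)) ->
  lebesgue_rV n (rect Y) = (\prod_(i < n) lebesgue_measure (Y i))%E.
Proof.
elim: n Y => [|n IH] Y mY.
  rewrite big_ord0 /= diracE mem_set//.
  by case.
rewrite big_ord_recl /= /cons_measure /pushforward.
rewrite (_ : _ @^-1` _ = Y ord0 `*` rect (fun k => Y (lift ord0 k))).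
  rewrite product_measure1E; [|exact: mY|exact: measurable_rect].
  by rewrite -IH.
apply/seteqP; split=> [[t y] h|[t y] [/= h1 h2] j]; last first.
  by case: (unliftP ord0 j) => [k|] ->; rewrite ?cons_rVS ?cons_rV0//; exact: h2.
split=> [|k] /=; first by have := h ord0; rewrite cons_rV0.
by have := h (lift ord0 k); rewrite cons_rVS.
Qed.

Lemma lebesgue_rV_box n (a b : 'rV[R]_n) : (forall i, a ord0 i <= b ord0 i) ->
  lebesgue_rV n (box a b) = (\prod_(i < n) (b ord0 i - a ord0 i))%:E.
Proof.
move=> ab; rewrite box_rect lebesgue_rV_rect; last by move=> i; exact: measurable_itv.
rewrite -prodEFin; apply: eq_bigr => i _.
rewrite lebesgue_measure_itv/= lte_fin; case: ltP => [_|ba]; first by rewrite EFinB.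
by congr EFin; have := ab i; lra.
Qed.

Lemma lebesgue_rV_box_lty n (a b : 'rV[R]_n) : (lebesgue_rV n (box a b) < +oo)%E.
Proof.
have [ab|] := pselect (forall i, a ord0 i <= b ord0 i).
  by rewrite lebesgue_rV_box// ltry.
move=> /existsNP[i /negP]; rewrite -ltNge => ba.
rewrite (_ : box a b = set0) ?measure0 ?ltry//.
by apply/seteqP; split=> // x /(_ i); lra.
Qed.

Section insert.
Context (n : nat) (i : 'I_n.+1).

Definition insert_measure : {measure set 'rV[R]_n.+1 -> \bar R}.
Proof.
unshelve refine (pushforward (lebesgue_measure \x lebesgue_rV n)%E (@insert_coord R n i)).
exact: measurable_insert_coord.
Defined.

(** The recursive construction of [lebesgue_rV] singles out the first coordinate. Uniqueness of a
    measure given on rectangles, with the cubes of half-side k as exhaustion, allows any coordinate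
    to be split off instead. *)
Lemma lebesgue_rV_insert (A : set 'rV[R]_n.+1) : measurable A ->
  lebesgue_rV n.+1 A = insert_measure A.
Proof.
apply: (measure_unique (@rects R n.+1)
    (fun k : nat => rect (fun=> `]- k%:R, k%:R[%classic))).
- exact: rects_generate.
- move=> _ _ [Y mY ->] [Z mZ ->]; rewrite rectI.
  by exists (fun i => Y i `&` Z i) => // j; exact: measurableI.
- by move=> k; exists (fun=> `]- k%:R, k%:R[%classic).
- apply/seteqP; split=> // x _.
  exists (Num.bound (\sum_j `|x ord0 j|)) => // j /=.
  rewrite in_itv/= -ltr_norml; apply: le_lt_trans (archi_boundP _); last first.
    by apply: sumr_ge0 => k _.
  by rewrite (bigD1 j)//= -[leLHS]addr0 lerD ?sumr_ge0.
- move=> _ [Y mY ->]; rewrite [LHS](lebesgue_rV_rect mY).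
  rewrite /insert_measure /= /pushforward preimage_insert_coord_rect.
  rewrite product_measure1E; [|exact: mY|exact: measurable_rect].
  by rewrite (lebesgue_rV_rect (fun k => mY (lift i k))) (bigD1_ord i).
- move=> k; have := lebesgue_rV_box_lty (const_mx (- k%:R)) (const_mx k%:R : 'rV_n.+1).
  by rewrite box_rect; under eq_fun do rewrite !mxE.
Qed.

End insert.

End lebesgue_rect.

(** * The divergence theorem, one coordinate at a time *)

Section divergence.
Context (R : realType) (n : nat) (i : 'I_n.+1).
Implicit Types (F G : 'rV[R]_n.+1 -> R) (a b : 'rV[R]_n.+1) (y : 'rV[R]_n).

Lemma hyperplane_pointD h t y :
  hyperplane_point i (h + t) y = h *: delta_mx ord0 i + hyperplane_point i t y.
Proof.
apply/rowP => j; rewrite !mxE eqxx /=; case: unliftP => [k|] -> /=.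
  by rewrite eq_sym (negbTE (neq_lift _ _)) mulr0 add0r.
by rewrite eqxx mulr1.
Qed.

Lemma hyperplane_pointK (x : 'rV[R]_n.+1) :
  hyperplane_point i (x ord0 i) (\row_k x ord0 (lift i k)) = x.
Proof.
by apply/rowP => j; rewrite mxE; case: unliftP => [k|] -> //=; rewrite mxE.
Qed.

Lemma line_quotientE F t y :
  (fun h : R => h^-1 *: ((F \o shift (hyperplane_point i t y))
      (h *: delta_mx ord0 i) - F (hyperplane_point i t y))) =
  (fun h : R => h^-1 *: (((fun s => F (hyperplane_point i s y)) \o shift t)
      (h *: (1 : R)) - F (hyperplane_point i t y))).
Proof.
by apply/funext => h /=; rewrite -hyperplane_pointD [h *: 1]mulr1.
Qed.

Lemma derivable_lineE F t y :
  derivable F (hyperplane_point i t y) (delta_mx ord0 i) =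
  derivable (fun s => F (hyperplane_point i s y)) t (1 : R).
Proof. by rewrite /derivable line_quotientE. Qed.

Lemma partial_lineE F t y : partial i F (hyperplane_point i t y) =
  derive1 (fun s => F (hyperplane_point i s y)) t.
Proof. by rewrite derive1E /partial /derive line_quotientE. Qed.

Lemma continuous_hyperplane_point y : continuous (fun t => hyperplane_point i t y).
Proof.
move=> t; apply/cvg_ballP => e e0; near=> s => /=.
split=> // j k; rewrite ord1 !mxE; case: unlift => [l|] /=; first exact: ballxx.
near: s; exact: (nbhsx_ballx t e e0).
Unshelve. all: by end_near. Qed.

Lemma continuous_box_bounded m (f : 'rV[R]_m -> R) (a b : 'rV[R]_m) :
  continuous f -> exists2 C : R, 0 <= C & forall x : 'rV[R]_m,
    (forall j, a ord0 j <= x ord0 j <= b ord0 j) -> `|f x| <= C.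
Proof.
move=> cf.
have cK : compact [set x : 'rV[R]_m | forall j, `[a ord0 j, b ord0 j]%classic (x ord0 j)].
  apply: (@rV_compact _ _ (fun j => `[a ord0 j, b ord0 j]%classic)) => j.
  exact: segment_compact.
have /compact_bounded[M [Mr hM]] := continuous_compact (continuous_subspaceT cf) cK.
exists (`|M| + 1); first by rewrite addr_ge0.
move=> x xab; apply: hM; first by apply: le_lt_trans (ler_norm M) _; rewrite ltrDl.
by exists x => // j; rewrite /= in_itv/=.
Qed.

Lemma continuous_bounded_box m (f : 'rV[R]_m -> R) (a b : 'rV[R]_m) :
  continuous f -> exists2 C : R, 0 <= C & forall x, box a b x -> `|f x| <= C.
Proof.
move=> cf; have [C C0 hC] := continuous_box_bounded a b cf; exists C => // x xab.
by apply: hC => j; have /andP[h1 h2] := xab j; rewrite !ltW.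
Qed.

Lemma face_box_rect a b : face_box a b i =
  rect (fun k => `]a ord0 (lift i k), b ord0 (lift i k)[%classic).
Proof.
by apply/seteqP; split=> y h k; have := h k; rewrite /= in_itv.
Qed.

Lemma insert_coord_box a b :
  @insert_coord R n i @^-1` box a b = `]a ord0 i, b ord0 i[ `*` face_box a b i.
Proof.
by rewrite box_rect preimage_insert_coord_rect face_box_rect.
Qed.

Lemma Fubini_box G a b (C : R) : measurable_fun setT G ->
  (forall x, box a b x -> `|G x| <= C) ->
  (\int[lebesgue_rV n.+1]_(x in box a b) (G x)%:E =
   \int[lebesgue_rV n]_(y in face_box a b i)
    \int[lebesgue_measure]_(t in `]a ord0 i, b ord0 i[%classic)
      (G (hyperplane_point i t y))%:E)%E.
Proof.
move=> mG GC.
have mi := @measurable_insert_coord R n i.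
rewrite (@eq_measure_integral _ _ _ _ (insert_measure R i)); last first.
  by move=> A mA _; exact: lebesgue_rV_insert.
have mB := measurable_box a b.
have mpB : measurable (@insert_coord R n i @^-1` box a b).
  by rewrite -[X in measurable X]setTI; exact: mi.
have mGi : measurable_fun setT (G \o @insert_coord R n i).
  exact: measurableT_comp mG mi.
have int : (lebesgue_measure \x lebesgue_rV n)%E.-integrable
    (@insert_coord R n i @^-1` box a b) (EFin \o G \o @insert_coord R n i).
  apply: measurable_bounded_integrable => //.
  - apply: le_lt_trans (lebesgue_rV_box_lty a b).
    by rewrite le_eqVlt; apply/orP; left; apply/eqP/esym/(lebesgue_rV_insert i).
  - exact: measurable_funTS.
  - exists C; split; first exact: num_real.
    by move=> M CM x xB; apply: le_trans (ltW CM); exact: GC.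
rewrite [LHS](integral_pushforward mi _ int mB); last exact/measurable_EFinP.
rewrite integral_mkcond.
rewrite -integral21_prod_meas1; last by rewrite -integrable_mkcond.
rewrite [RHS]integral_mkcond; apply: eq_integral => y _.
rewrite /fubini_G patchE; case: ifPn => [|] yF.
  rewrite [RHS]integral_mkcond; apply: eq_integral => t _.
  rewrite !patchE insert_coord_box in_setX/= yF andbT.
  by rewrite [X in if X then _ else _](_ : _ = (t \in `]a ord0 i, b ord0 i[%classic)).
rewrite -[RHS](@integral0 _ _ _ lebesgue_measure setT); apply: eq_integral => t _.
by rewrite patchE insert_coord_box in_setX/= (negbTE yF) andbF.
Qed.

(** Fubini in coordinate [i], then the fundamental theorem of calculus on each line. *)
Lemma divergence_box F a b : (forall j, a ord0 j < b ord0 j) ->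
  (forall x, derivable F x (delta_mx ord0 i)) -> continuous (partial i F) ->
  \int[lebesgue_rV n.+1]_(x in box a b) partial i F x =
  \int[lebesgue_rV n]_(y in face_box a b i)
    (F (hyperplane_point i (b ord0 i) y) - F (hyperplane_point i (a ord0 i) y)).
Proof.
move=> ab dF cF; have [C C0 hC] := continuous_bounded_box a b cF.
rewrite /Rintegral (Fubini_box (continuous_measurable_rV cF) hC); congr fine.
apply: eq_integral => y _.
pose phi s := F (hyperplane_point i s y).
have dphi t : derivable phi t (1 : R) by rewrite /phi -derivable_lineE.
have cphi : continuous phi.
  by move=> t; apply/differentiable_continuous/derivable1_diffP.
have cdphi : continuous (fun t => partial i F (hyperplane_point i t y)).
  by move=> t; apply: continuous_comp; [exact: continuous_hyperplane_point|exact: cF].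
rewrite EFinB.
(* The fundamental theorem applies to the closed interval; its end points are negligible. *)
rewrite integral_itv_bndo_bndc; last first.
  by apply/measurable_EFinP; apply: measurable_funTS; exact: continuous_measurable_fun.
rewrite integral_itv_obnd_cbnd; last first.
  by apply/measurable_EFinP; apply: measurable_funTS; exact: continuous_measurable_fun.
apply: (@continuous_FTC2 R (fun t => partial i F (hyperplane_point i t y)) phi
  (a ord0 i) (b ord0 i) (ab i)).
- exact: continuous_subspaceT.
- split; first by move=> t _.
  + by apply: cvg_at_right_filter; exact: cphi.
  + by apply: cvg_at_left_filter; exact: cphi.
- by move=> t _; rewrite partial_lineE.
Qed.

End divergence.

(** * Surface integrals *)

Section surface_integral.
Context (R : realType) (n : nat) (a b : 'rV[R]_n.+1).
Local Notation sigma := (surface_measure a b).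

Lemma integral_face_measure i c (f : 'rV[R]_n.+1 -> \bar R) :
  (forall x, 0 <= f x)%E -> measurable_fun setT f ->
  (\int[face_measure a b i c]_x f x =
   \int[lebesgue_rV n]_(y in face_box a b i) f (hyperplane_point i c y))%E.
Proof.
(* [E] is the cylinder over the face. The face measure does not charge its complement, and on
   subsets of [E] it is the image of Lebesgue measure under [hyperplane_point]. *)
move=> f0 mf; pose E : set 'rV[R]_n.+1 :=
  rect (fun j => if j == i then setT else `]a ord0 j, b ord0 j[%classic).
have mE : measurable E.
  by apply: measurable_rect => j; case: ifP => // _; exact: measurable_itv.
have mh : measurable_fun setT (hyperplane_point i c : 'rV[R]_n -> _).
  exact: (@measurable_hyperplane_point R n.+1 i c).
have hE : hyperplane_point i c @^-1` E = face_box a b i.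
  apply/seteqP; split=> y h k.
    have := h (lift i k); rewrite hyperplane_point_lift/=.
    by rewrite eq_sym (negbTE (neq_lift _ _))/= in_itv.
  case: eqP => //= ki; case: (unliftP i k) ki => [l|] -> //.
  by rewrite hyperplane_point_lift in_itv/= => _; exact: h.
transitivity (\int[face_measure a b i c]_(x in E) f x)%E.
  rewrite [LHS](@ge0_negligible_integral _ _ _ _ setT (~` E))//.
  - by rewrite setTD setCK.
  - exact: measurableC.
  - rewrite -[LHS]/(lebesgue_rV n (hyperplane_point i c @^-1` (~` E) `&`
      face_box a b i)) -hE preimage_setC setIC setICr.
    exact: (measure0 (lebesgue_rV n)).
have h := ge0_integral_pushforward mh (lebesgue_rV n) mE
  (measurable_funTS mf) (fun x _ => f0 x).
rewrite -hE -[RHS]h; apply: eq_measure_integral => A mA AE.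
by rewrite /= /face_measure/= -hE -preimage_setI (setIidl AE).
Qed.

Lemma ge0_integral_surface (f : 'rV[R]_n.+1 -> \bar R) :
  (forall x, 0 <= f x)%E -> measurable_fun setT f ->
  (\int[sigma]_x f x =
   \sum_(i < n.+1) (\int[lebesgue_rV n]_(y in face_box a b i)
      f (hyperplane_point i (a ord0 i) y) +
    \int[lebesgue_rV n]_(y in face_box a b i)
      f (hyperplane_point i (b ord0 i) y)))%E.
Proof.
move=> f0 mf.
pose m (k : nat) : {measure set 'rV[R]_n.+1 -> \bar R} :=
  if insub k is Some i
  then measure_add (face_measure a b i (a ord0 i))
                   (face_measure a b i (b ord0 i))
  else mzero.
rewrite (@eq_measure_integral _ _ _ _ (msum m n.+1)); last first.
  move=> A mA _; rewrite /= /surface_measure /msum; apply: eq_bigr => i _.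
  by rewrite /m (valK i); exact/esym/measure_addE.
rewrite ge0_integral_measure_sum//; apply: eq_bigr => i _.
by rewrite /m (valK i) ge0_integral_measure_add// !integral_face_measure.
Qed.

Lemma face_box_lty i : (lebesgue_rV n (face_box a b i) < +oo)%E.
Proof.
have := lebesgue_rV_box_lty (\row_k a ord0 (lift i k)) (\row_k b ord0 (lift i k)).
by rewrite box_rect face_box_rect; under eq_fun do rewrite !mxE.
Qed.

Lemma surface_measure_lty : (sigma setT < +oo)%E.
Proof.
rewrite /surface_measure; apply: lte_sum_pinfty => i _.
by rewrite /face_measure !preimage_setT !setTI lte_add_pinfty// face_box_lty.
Qed.

Lemma continuous_face_integrable i c (f : 'rV[R]_n.+1 -> R) : continuous f ->
  (lebesgue_rV n).-integrable (face_box a b i)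
    (EFin \o (fun y => f (hyperplane_point i c y))).
Proof.
move=> cf.
have [C C0 hC] := continuous_box_bounded
  (hyperplane_point i c (\row_k a ord0 (lift i k)))
  (hyperplane_point i c (\row_k b ord0 (lift i k))) cf.
apply: measurable_bounded_integrable.
- exact: (@measurable_face_box R n.+1 a b i).
- exact: face_box_lty.
- apply: measurable_funTS.
  exact: (measurableT_comp (continuous_measurable_rV cf)
    (@measurable_hyperplane_point R n.+1 i c)).
- exists C; split; first exact: num_real.
  move=> M CM y yab; apply: le_trans (ltW CM); apply: hC => j.
  case: (unliftP i j) => [k|] ->; rewrite ?hyperplane_point_eq ?lexx//.
  by rewrite !hyperplane_point_lift !mxE; have /andP[h1 h2] := yab k; rewrite !ltW.
Qed.

Lemma ge0_Rintegral_surface (f : 'rV[R]_n.+1 -> R) : continuous f ->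
  (forall x, 0 <= f x) ->
  (\int[sigma]_x (f x)%:E =
   (\sum_(i < n.+1) (\int[lebesgue_rV n]_(y in face_box a b i)
      f (hyperplane_point i (a ord0 i) y) +
    \int[lebesgue_rV n]_(y in face_box a b i)
      f (hyperplane_point i (b ord0 i) y))%R)%:E)%E.
Proof.
move=> cf f0; rewrite ge0_integral_surface.
- rewrite -sumEFin; apply: eq_bigr => i _; rewrite EFinD.
  have mF := @measurable_face_box R n.+1 a b i.
  by rewrite /Rintegral !fineK// integrable_fin_num//; exact: continuous_face_integrable.
- by move=> x; rewrite lee_fin.
- apply/measurable_EFinP; exact: continuous_measurable_rV.
Qed.

Lemma continuous_surface_integrable (f : 'rV[R]_n.+1 -> R) : continuous f ->
  sigma.-integrable setT (EFin \o f).
Proof.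
move=> cf; apply/integrableP; split.
  by apply/measurable_EFinP; exact: continuous_measurable_rV.
rewrite (eq_integral (fun x => (`|f x|)%:E))//.
rewrite (@ge0_Rintegral_surface (fun x => `|f x|)) ?ltry//.
by move=> x; apply: continuous_comp; [exact: cf|exact: norm_continuous].
Qed.

Lemma continuous_surface_sqint (f : 'rV[R]_n.+1 -> R) : continuous f ->
  square_integrable sigma setT f.
Proof.
move=> cf; split; first exact: continuous_measurable_rV.
apply: (@continuous_surface_integrable (fun x => f x ^+ 2)) => x.
exact: (cvgM (cf x) (cf x)).
Qed.

(** Writing f = (|f| + f) - |f| keeps both parts continuous and nonnegative, so the nonnegative case
    applies to each. *)
Lemma Rintegral_surface (f : 'rV[R]_n.+1 -> R) : continuous f ->
  \int[sigma]_x f x =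
  \sum_(i < n.+1) (\int[lebesgue_rV n]_(y in face_box a b i)
      f (hyperplane_point i (a ord0 i) y) +
    \int[lebesgue_rV n]_(y in face_box a b i)
      f (hyperplane_point i (b ord0 i) y)).
Proof.
move=> cf.
have cn : continuous (fun x => `|f x|).
  by move=> x; apply: continuous_comp; [exact: cf|exact: norm_continuous].
have cp : continuous (fun x => `|f x| + f x).
  by move=> x; exact: (cvgD (cn x) (cf x)).
have -> : \int[sigma]_x f x = \int[sigma]_x (`|f x| + f x) - \int[sigma]_x `|f x|.
  rewrite -RintegralB//; [|exact: continuous_surface_integrable..].
  by apply: eq_Rintegral => x _; rewrite addrC addKr.
rewrite /Rintegral (ge0_Rintegral_surface cp); last first.
  by move=> x; have := ler_norm (- f x); rewrite normrN; lra.
rewrite (ge0_Rintegral_surface cn)//= -sumrB; apply: eq_bigr => i _.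
have mF := @measurable_face_box R n.+1 a b i.
have h c := RintegralD mF (continuous_face_integrable i c cn)
  (continuous_face_integrable i c cf).
by rewrite !h /Rintegral; ring.
Qed.

End surface_integral.

(** * Smooth functions *)

Section smooth_1d.
Context (R : realType).
Implicit Types f g : R -> R.

(** Only the existence of derivatives is recorded: in one variable, continuity of each derivative
    follows from the existence of the next. *)
Fixpoint Ck1 k f : Prop := match k with
  | 0 => True
  | k'.+1 => (forall x, derivable f x (1 : R)) /\ Ck1 k' (derive1 f)
  end.

Definition smooth1 f := forall k, Ck1 k f.

Lemma smooth1_derivable f x : smooth1 f -> derivable f x (1 : R).
Proof. by move=> /(_ 1)[]. Qed.

Lemma smooth1_derive f : smooth1 f -> smooth1 (derive1 f).
Proof. by move=> sf k; have [] := sf k.+1. Qed.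

Lemma smooth1_continuous f : smooth1 f -> continuous f.
Proof.
move=> sf x; apply/differentiable_continuous/derivable1_diffP.
exact: smooth1_derivable.
Qed.

Lemma Ck1S k f : Ck1 k.+1 f -> Ck1 k f.
Proof. by elim: k f => // k IH f [df h]; split=> //; exact: IH. Qed.

Lemma is_derive_smooth1 f x : smooth1 f -> is_derive x (1 : R) f (derive1 f x).
Proof.
by move=> sf; rewrite derive1E; apply: DeriveDef => //; exact: smooth1_derivable.
Qed.

Lemma derive1_is_derive f g : (forall x, is_derive x (1 : R) f (g x)) ->
  derive1 f = g.
Proof.
by move=> h; apply/funext => x; rewrite derive1E; case: (h x).
Qed.

Lemma Ck1_step k f g : (forall x, is_derive x (1 : R) f (g x)) -> Ck1 k g ->
  Ck1 k.+1 f.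
Proof.
by move=> h cg; split; [move=> x; case: (h x)|rewrite (derive1_is_derive h)].
Qed.

Lemma Ck1_cst k (c : R) : Ck1 k (fun=> c).
Proof.
elim: k c => // k IH c; by apply: (@Ck1_step _ _ (fun=> 0)); last exact: IH.
Qed.

Lemma Ck1_lin k (c : R) f g : Ck1 k f -> Ck1 k g -> Ck1 k (fun x => f x + c * g x).
Proof.
elim: k f g => // k IH f g [df cf] [dg cg].
apply: (@Ck1_step _ _ (fun x => derive1 f x + c * derive1 g x)); last exact: IH.
move=> x; rewrite !derive1E.
have -> : (fun x => f x + c * g x) = f + c \*: g by apply/funext.
exact: (is_deriveD (DeriveDef (df x) erefl) (is_deriveZ c (DeriveDef (dg x) erefl))).
Qed.

Lemma Ck1_mul k f g : Ck1 k f -> Ck1 k g -> Ck1 k (fun x => f x * g x).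
Proof.
elim: k f g => // k IH f g cf cg; have [df cf'] := cf; have [dg cg'] := cg.
apply: (@Ck1_step _ _ (fun x => f x * derive1 g x + 1 * (g x * derive1 f x))).
  move=> x; rewrite !derive1E mul1r.
  exact: (is_deriveM (DeriveDef (df x) erefl) (DeriveDef (dg x) erefl)).
by apply: Ck1_lin; apply: IH => //; exact: Ck1S.
Qed.

Lemma is_derive_affine (p q x : R) : is_derive x (1 : R) (fun t => p * t + q) p.
Proof.
have h1 := @is_deriveZ _ _ _ id p x 1 1 (is_derive_id _ _).
have := is_deriveD h1 (is_derive_cst q x 1).
by rewrite addr0 [p *: 1]mulr1.
Qed.

Lemma Ck1_affine k (p q : R) f : Ck1 k f -> Ck1 k (fun t => f (p * t + q)).
Proof.
elim: k f => // k IH f [df cf].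
apply: (@Ck1_step _ _ (fun t => 0 + p * derive1 f (p * t + q))).
  move=> x; rewrite add0r mulrC derive1E.
  exact: (is_derive1_comp (DeriveDef (df _) erefl) (is_derive_affine p q x)).
by apply: Ck1_lin; [exact: Ck1_cst|exact: IH].
Qed.

Lemma smooth1_cst (c : R) : smooth1 (fun=> c).
Proof. by move=> k; exact: Ck1_cst. Qed.

Lemma smooth1_mul f g : smooth1 f -> smooth1 g -> smooth1 (fun x => f x * g x).
Proof. by move=> sf sg k; exact: Ck1_mul. Qed.

Lemma smooth1_affine (p q : R) f : smooth1 f -> smooth1 (fun t => f (p * t + q)).
Proof. by move=> sf k; exact: Ck1_affine. Qed.

Lemma Ck1_trigo k : Ck1 k (@cos R) /\ Ck1 k (@sin R).
Proof.
elim: k => // k [ck sk]; split.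
  apply: (@Ck1_step _ _ (fun x => 0 + -1 * sin x)).
    by move=> x; rewrite add0r mulN1r; exact: is_derive_cos.
  by apply: Ck1_lin => //; exact: Ck1_cst.
by apply: (@Ck1_step _ _ cos) => // x; exact: is_derive_sin.
Qed.

Lemma smooth1_cos : smooth1 (@cos R).
Proof. by move=> k; have [] := Ck1_trigo k. Qed.

Lemma smooth1_sin : smooth1 (@sin R).
Proof. by move=> k; have [] := Ck1_trigo k. Qed.

Lemma derive1_affine (p q : R) f t : derivable f (p * t + q) (1 : R) ->
  derive1 (fun t => f (p * t + q)) t = p * derive1 f (p * t + q).
Proof.
move=> df; rewrite mulrC derive1E [in RHS]derive1E.
by have [_] := @is_derive1_comp _ f (fun t => p * t + q) t _ _
  (DeriveDef df erefl) (is_derive_affine p q t).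
Qed.

Lemma derive1_mul f g t : smooth1 f -> smooth1 g ->
  derive1 (fun x => f x * g x) t = f t * derive1 g t + g t * derive1 f t.
Proof.
move=> sf sg; rewrite derive1E.
by have [_] := is_deriveM (is_derive_smooth1 t sf) (is_derive_smooth1 t sg).
Qed.

Lemma derive1_scale (c : R) f t : smooth1 f ->
  derive1 (fun x => c * f x) t = c * derive1 f t.
Proof.
move=> sf; rewrite derive1_mul//; last exact: smooth1_cst.
by rewrite derive1_cst mulr0 addr0.
Qed.

Lemma derive1_cosE : derive1 (@cos R) = fun t => - sin t.
Proof. by apply: derive1_is_derive => x; exact: is_derive_cos. Qed.

Lemma derive1_sinE : derive1 (@sin R) = cos.
Proof. by apply: derive1_is_derive => x; exact: is_derive_sin. Qed.

(** The classical flat function exp (-1/t), times powers of 1/t that make the family stable, up to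
    linear combinations, under differentiation. *)
Definition flat k (t : R) : R :=
  if 0 < t then t^-1 ^+ k * expR (- t^-1) else 0.

Lemma flat_ge0 k t : 0 <= flat k t.
Proof.
rewrite /flat; case: ifPn => // t0.
by rewrite mulr_ge0 ?exprn_ge0 ?invr_ge0 ?expR_ge0 ?ltW.
Qed.

(** The factorial comes from the k-th term of the exponential series. *)
Lemma pow_expRN_le k (y : R) : 0 <= y -> y ^+ k * expR (- y) <= k`!%:R.
Proof.
move=> y0; rewrite expRN ler_pdivrMr ?expR_gt0//.
case: k => [|k]; first by rewrite expr0 fact0 mul1r; have := expR_ge1Dx y; lra.
have := expR_ge1Dxn k y0; have f0 : 0 < (k.+1)`!%:R :> R by rewrite ltr0n fact_gt0.
have := mulrV (unitf_gt0 f0); set F := _%:R => FF h.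
have -> : y ^+ k.+1 = F * (y ^+ k.+1 / F) by rewrite mulrCA FF mulr1.
by rewrite ler_pM2l//; lra.
Qed.

Lemma flat_le k t : flat k t <= k`!%:R.
Proof.
rewrite /flat; case: ifPn => // t0; apply: pow_expRN_le.
by rewrite invr_ge0 ltW.
Qed.

(** One more power of 1/t is paid for by the factor [t]; hence the bound of [flat_le] at [k.+1]. *)
Lemma flat_small k t : `|flat k t| <= (k.+1)`!%:R * `|t|.
Proof.
rewrite ger0_norm ?flat_ge0//; have := flat_le k.+1 t; rewrite /flat.
case: ifPn => t0; last by move=> _; rewrite mulr_ge0.
rewrite (gtr0_norm t0) exprS -mulrA => h.
by move: h; rewrite -(ler_pM2l t0) mulVKf ?gt_eqF// [t * _]mulrC.
Qed.

Lemma is_derive_flat k t :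
  is_derive t (1 : R) (flat k) (flat k.+2 t + - k%:R * flat k.+1 t).
Proof.
have [t0|t0|->] := ltgtP t 0.
- have e : \forall x \near t, 0 = flat k x.
    near=> x; rewrite /flat ifN// -leNgt; near: x.
    by apply: filterS (lt_nbhsl t0) => z /ltW.
  rewrite /flat !ifN ?ltNge ?(ltW t0)// mulr0 addr0.
  have h := is_derive_cst (0 : R) t 1; apply: DeriveDef.
    exact: near_eq_derivable e ex_derive.
  by rewrite -(near_eq_derive _ e) derive_val.
- have e : \forall x \near t, (((fun y => y^-1) ^+ k) * (expR \o (fun y => - y^-1))) x
      = flat k x.
    near=> x; rewrite /flat ifT; last by near: x; exact: lt_nbhsr.
    by rewrite fctE/= exprfctE.
  have h1 : is_derive t (1 : R) (fun y => y^-1) (- t ^- 2 *: 1).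
    by apply: is_deriveV; rewrite gt_eqF.
  have h := is_deriveM (is_deriveX k h1)
    (is_derive1_comp (is_derive_expR _) (is_deriveN h1)).
  apply: DeriveDef; first exact: near_eq_derivable e ex_derive.
  rewrite -(near_eq_derive _ e) derive_val /flat t0 /= exprfctE.
  rewrite -[LHS]/(t^-1 ^+ k * (expR (- t^-1) * - (- t ^- 2 * 1)) +
    expR (- t^-1) * (k%:R * t^-1 ^+ k.-1 * (- t ^- 2 * 1))) -exprVn.
  move: (t^-1) => y; move: (expR (- y)) => E; case: k {e h} => [|k] /=; rewrite ?exprS; ring.
- have fl0 j : flat j 0 = 0 by rewrite /flat ltxx.
  rewrite !fl0 mulr0 addr0.
  (* At 0 the difference quotient of [flat k] is [flat k.+1 h], which is O(h). *)
  have q0 : h^-1 *: ((flat k \o shift 0) (h *: (1 : R)) - flat k 0) @[h --> 0^'] --> (0 : R).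
    apply/cvgrPdist_le => e e0; near=> h.
    have h0 : h != 0 by near: h; exact: nbhs_dnbhs_neq.
    rewrite sub0r normrN /= addr0 [h *: 1]mulr1 fl0 subr0.
    have -> : h^-1 *: flat k h = flat k.+1 h.
      by rewrite /flat; case: ifP => _; rewrite ?scaler0// exprS -mulrA.
    apply: le_trans (flat_small _ _) _.
    have f0 : 0 < (k.+2)`!%:R :> R by rewrite ltr0n fact_gt0.
    rewrite -ler_pdivlMl//; near: h; apply: dnbhs0_le.
    by rewrite mulr_gt0 ?invr_gt0.
  by apply: DeriveDef; [apply/cvg_ex; exists 0|exact: cvg_lim q0].
Unshelve. all: by end_near. Qed.

Lemma smooth1_flat k : smooth1 (flat k).
Proof.
move=> m; elim: m k => // m IH k.
by apply: Ck1_step (is_derive_flat k) _; apply: Ck1_lin.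
Qed.

End smooth_1d.

Arguments smooth1_derivable {R f} x _.

(** * Smooth functions of several variables, as products of one-variable factors *)

Section smooth_products.
Context (R : realType) (n : nat).
Implicit Types (x : 'rV[R]_n.+1) (y : 'rV[R]_n) (f g : 'rV[R]_n.+1 -> R)
  (s : 'I_n.+1 -> R -> R) (i j : 'I_n.+1).

Definition prod_fun s : 'rV[R]_n.+1 -> R := fun x => \prod_j s j (x ord0 j).

Definition update s i (h : R -> R) : 'I_n.+1 -> R -> R :=
  fun j => if j == i then h else s j.

Lemma update_eq s i h : update s i h i = h.
Proof. by rewrite /update eqxx. Qed.

Lemma update_lift s i h k : update s i h (lift i k) = s (lift i k).
Proof. by rewrite /update eq_sym (negbTE (neq_lift _ _)). Qed.

Lemma prod_fun_line s i t y : prod_fun s (hyperplane_point i t y) =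
  (\prod_k s (lift i k) (y ord0 k)) * s i t.
Proof.
rewrite /prod_fun (bigD1_ord i)//= hyperplane_point_eq mulrC; congr (_ * _).
by apply: eq_bigr => k _; rewrite hyperplane_point_lift.
Qed.

Lemma prod_fun_update s i h x : prod_fun (update s i h) x =
  (\prod_k s (lift i k) (x ord0 (lift i k))) * h (x ord0 i).
Proof.
rewrite -{1}[x](hyperplane_pointK i) prod_fun_line update_eq; congr (_ * _).
by apply: eq_bigr => k _; rewrite update_lift mxE.
Qed.

Lemma is_derive_prod_fun s i x : derivable (s i) (x ord0 i) (1 : R) ->
  derivable (prod_fun s) x (delta_mx ord0 i) /\
  partial i (prod_fun s) x = prod_fun (update s i (derive1 (s i))) x.
Proof.
move=> ds; set y := \row_k x ord0 (lift i k).
have -> : partial i (prod_fun s) x =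
    partial i (prod_fun s) (hyperplane_point i (x ord0 i) y).
  by rewrite hyperplane_pointK.
rewrite -[X in derivable _ X](hyperplane_pointK i) derivable_lineE partial_lineE.
under eq_fun do rewrite prod_fun_line.
have h := @is_deriveZ _ _ _ (s i) (\prod_k s (lift i k) (y ord0 k)) _ _ _
  (DeriveDef ds erefl).
split; first by case: h.
rewrite derive1E; case: h => _ ->; rewrite prod_fun_update derive1E.
by congr (_ * _); apply: eq_bigr => k _; rewrite mxE.
Qed.

Lemma continuous_prod_fun s : (forall j, continuous (s j)) ->
  continuous (prod_fun s).
Proof.
move=> cs; rewrite /prod_fun; elim: (index_enum _) => [|j r IH].
  by under eq_fun do rewrite big_nil; exact: cst_continuous.
under eq_fun do rewrite big_cons; move=> x.
apply: (@cvgM _ _ (nbhs x) _ (fun x : 'rV[R]_n.+1 => s j (x ord0 j))); last exact: IH.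
by apply: continuous_comp; [exact: coord_continuous|exact: cs].
Qed.

Lemma partial_prod_fun s i : smooth1 (s i) ->
  partial i (prod_fun s) = prod_fun (update s i (derive1 (s i))).
Proof.
move=> ss; apply/funext => x.
by have [] := @is_derive_prod_fun s i x (smooth1_derivable _ ss).
Qed.

Lemma smooth_prod_fun s : (forall j, smooth1 (s j)) -> smooth (prod_fun s).
Proof.
move=> ss k; elim: k s ss => [|k IH] s ss /=.
  by apply: continuous_prod_fun => j; exact: smooth1_continuous.
split; first by apply: continuous_prod_fun => j; exact: smooth1_continuous.
move=> i; split=> [x|].
  by have [] := @is_derive_prod_fun s i x (smooth1_derivable _ (ss i)).
rewrite partial_prod_fun//; apply: IH => j; rewrite /update; case: ifP => // _.
exact: smooth1_derive.
Qed.

Lemma partial_lin (c : R) f g i x : derivable f x (delta_mx ord0 i) ->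
  derivable g x (delta_mx ord0 i) ->
  derivable (fun x => f x + c * g x) x (delta_mx ord0 i) /\
  partial i (fun x => f x + c * g x) x = partial i f x + c * partial i g x.
Proof.
move=> df dg; have -> : (fun x => f x + c * g x) = f + c \*: g by apply/funext.
by have [] := is_deriveD (DeriveDef df erefl) (is_deriveZ c (DeriveDef dg erefl)).
Qed.

Lemma smooth_lin (c : R) f g : smooth f -> smooth g ->
  smooth (fun x => f x + c * g x).
Proof.
move=> sf sg k; elim: k f g {sf sg}(sf k) (sg k) => [|k IH] f g /=.
  by move=> cf cg x; exact: (cvgD (cf x) (cvgMr (cg x))).
move=> [cf df] [cg dg]; split.
  by move=> x; exact: (cvgD (cf x) (cvgMr (cg x))).
move=> i; split=> [x|].
  by have [] := @partial_lin c f g i x ((df i).1 x) ((dg i).1 x).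
rewrite (_ : partial i _ = fun x => partial i f x + c * partial i g x).
  by apply: IH; [exact: (df i).2|exact: (dg i).2].
apply/funext => x.
by have [] := @partial_lin c f g i x ((df i).1 x) ((dg i).1 x).
Qed.

Lemma partial_mul f g i x : derivable f x (delta_mx ord0 i) ->
  derivable g x (delta_mx ord0 i) ->
  derivable (fun x => f x * g x) x (delta_mx ord0 i) /\
  partial i (fun x => f x * g x) x = f x * partial i g x + g x * partial i f x.
Proof.
by move=> df dg; have [] := is_deriveM (DeriveDef df erefl) (DeriveDef dg erefl).
Qed.

Lemma smooth_continuous f : smooth f -> continuous f.
Proof. by move=> /(_ 0). Qed.

Lemma smooth_derivable f i x : smooth f -> derivable f x (delta_mx ord0 i).
Proof. by move=> /(_ 1)[_ /(_ i)[]]. Qed.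

Lemma smooth_partial f i : smooth f -> smooth (partial i f).
Proof. by move=> sf k; have [_ /(_ i)[]] := sf k.+1. Qed.

Lemma smooth_partial_continuous f i : smooth f -> continuous (partial i f).
Proof. by move=> /(smooth_partial i)/smooth_continuous. Qed.

Lemma smooth_cst (c : R) : smooth ((fun=> c) : 'rV[R]_n.+1 -> R).
Proof.
have := @smooth_prod_fun (fun j => if j == ord0 then (fun=> c) else (fun=> 1)).
rewrite (_ : prod_fun _ = (fun=> c)); last first.
  apply/funext => x; rewrite /prod_fun big_ord_recl eqxx big1 ?mulr1//.
by apply => j; case: ifP => _; exact: smooth1_cst.
Qed.

Lemma partial_cst (c : R) i : partial i ((fun=> c) : 'rV[R]_n.+1 -> R) = (fun=> 0).
Proof. by apply/funext => x; rewrite /partial derive_cst. Qed.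

End smooth_products.

Arguments smooth_derivable {R n f} i x _.
Arguments smooth_partial_continuous {R n f} i _.

(** * Sobolev functions on a box *)

Section H1_constructions.
Context (R : realType) (n : nat) (a b : 'rV[R]_n.+1).
Hypothesis ab : forall i, a ord0 i < b ord0 i.
Local Notation Omega := (box a b).
Local Notation lambda := (@lebesgue_rV R n.+1).
Implicit Types (f g phi : 'rV[R]_n.+1 -> R) (u v w : H1 Omega) (i : 'I_n.+1).

Let mO : measurable Omega := measurable_box a b.
Let fO : (lambda Omega < +oo)%E := lebesgue_rV_box_lty a b.

Lemma continuous_rVM f g : continuous f -> continuous g ->
  continuous (fun x => f x * g x).
Proof. by move=> cf cg x; exact: (cvgM (cf x) (cg x)). Qed.

Lemma continuous_rVD f g : continuous f -> continuous g ->
  continuous (fun x => f x + g x).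
Proof. by move=> cf cg x; exact: (cvgD (cf x) (cg x)). Qed.

Lemma continuous_box_sqint f : continuous f -> square_integrable lambda Omega f.
Proof.
move=> cf; have [C _ hC] := continuous_bounded_box a b cf.
apply: (sqint_bounded mO fO _ hC).
by apply: measurable_funTS; exact: continuous_measurable_rV.
Qed.

Lemma hyperplane_point_notin_box i (y : 'rV[R]_n) c :
  c = a ord0 i \/ c = b ord0 i -> ~ Omega (hyperplane_point i c y).
Proof. by move=> hc /(_ i); rewrite hyperplane_point_eq; case: hc => ->; lra. Qed.

(** The divergence theorem for [f * phi]: the faces lie outside the open box, hence outside the
    support of [phi], and contribute nothing. *)
Lemma smooth_weak_derivative f i phi : smooth f -> test_function Omega phi ->
  \int[lambda]_(x in Omega) (f x * partial i phi x) =
  - \int[lambda]_(x in Omega) (partial i f x * phi x).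
Proof.
move=> sf [sphi [K [cK KO phi0]]].
pose F x := f x * phi x.
have dF x := @partial_mul R n f phi i x (smooth_derivable i x sf) (smooth_derivable i x sphi).
have pF : partial i F = fun x => f x * partial i phi x + phi x * partial i f x.
  by apply/funext => x; have [] := dF x.
have cF1 : continuous (fun x => f x * partial i phi x).
  by apply: continuous_rVM; [exact: smooth_continuous|exact: smooth_partial_continuous].
have cF2 : continuous (fun x => phi x * partial i f x).
  by apply: continuous_rVM; [exact: smooth_continuous|exact: smooth_partial_continuous].
have cF : continuous (partial i F) by rewrite pF; exact: continuous_rVD.
have := divergence_box ab (fun x => (dF x).1) cF.
have -> : (fun y => F (hyperplane_point i (b ord0 i) y) -
    F (hyperplane_point i (a ord0 i) y)) = fun=> 0.
  apply/funext => y; rewrite /F !phi0 ?mulr0 ?subrr//.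
  - by move/KO; apply: hyperplane_point_notin_box; left.
  - by move/KO; apply: hyperplane_point_notin_box; right.
rewrite Rintegral_cst ?mul0r; last exact: (@measurable_face_box R n.+1 a b i).
rewrite pF RintegralD//.
- move=> /eqP; rewrite addr_eq0 => /eqP ->; congr (- _).
  by apply: eq_Rintegral => x _; rewrite mulrC.
- by apply: sqint_integrable => //; exact: continuous_box_sqint.
- by apply: sqint_integrable => //; exact: continuous_box_sqint.
Qed.

Definition H1_smooth f (sf : smooth f) : H1 Omega :=
  @MkH1 R n.+1 Omega f (fun i => partial i f)
    (continuous_box_sqint (smooth_continuous sf))
    (fun i => continuous_box_sqint (smooth_partial_continuous i sf))
    (fun i phi => @smooth_weak_derivative f i phi sf).

Lemma test_function_sqint phi : test_function Omega phi ->
  square_integrable lambda Omega phi.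
Proof. by move=> [/smooth_continuous cp _]; exact: continuous_box_sqint. Qed.

Lemma test_function_partial_sqint phi i : test_function Omega phi ->
  square_integrable lambda Omega (partial i phi).
Proof.
by move=> [/(smooth_partial_continuous i) cp _]; exact: continuous_box_sqint.
Qed.

Lemma H1_lin_subproof c u v i phi : test_function Omega phi ->
  \int[lambda]_(x in Omega) ((u x + c * v x) * partial i phi x) =
  - \int[lambda]_(x in Omega) ((grad u i x + c * grad v i x) * phi x).
Proof.
move=> tp; have sp := test_function_sqint tp.
have sdp := test_function_partial_sqint i tp.
have su := H1_funL2 u; have sv := H1_funL2 v.
have sgu := gradL2 u i; have sgv := gradL2 v i.
rewrite !RintegralDM//; do ?by apply: sqintZ.
rewrite !RintegralZM// !grad_weak//; ring.
Qed.

Definition H1_lin c u v : H1 Omega :=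
  @MkH1 R n.+1 Omega (fun x => u x + c * v x)
    (fun i x => grad u i x + c * grad v i x)
    (sqintD mO (H1_funL2 u) (sqintZ mO c (H1_funL2 v)))
    (fun i => sqintD mO (gradL2 u i) (sqintZ mO c (gradL2 v i)))
    (fun i phi => @H1_lin_subproof c u v i phi).

Lemma dotC u v : dot u v = dot v u.
Proof. exact: RintegralC. Qed.

Lemma dirichletC u v : dirichlet u v = dirichlet v u.
Proof. by apply: eq_bigr => i _; exact: RintegralC. Qed.

Lemma dot_linl c u v w : dot (H1_lin c u v) w = dot u w + c * dot v w.
Proof.
rewrite /dot RintegralDM ?RintegralZM//;
  by [exact: H1_funL2|apply: sqintZ => //; exact: H1_funL2].
Qed.

Lemma dirichlet_linl c u v w :
  dirichlet (H1_lin c u v) w = dirichlet u w + c * dirichlet v w.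
Proof.
rewrite /dirichlet mulr_sumr -big_split/=; apply: eq_bigr => i _.
rewrite RintegralDM ?RintegralZM//;
  by [exact: gradL2|apply: sqintZ => //; exact: gradL2].
Qed.

Lemma dot_linr c u v w : dot w (H1_lin c u v) = dot w u + c * dot w v.
Proof. by rewrite dotC dot_linl !(dotC _ w). Qed.

Lemma dirichlet_linr c u v w :
  dirichlet w (H1_lin c u v) = dirichlet w u + c * dirichlet w v.
Proof. by rewrite dirichletC dirichlet_linl !(dirichletC _ w). Qed.

Lemma dot_ge0 u : 0 <= dot u u.
Proof. by apply: Rintegral_ge0 => x _; exact: sqr_ge0. Qed.

Lemma dirichlet_ge0 u : 0 <= dirichlet u u.
Proof.
by apply: sumr_ge0 => i _; apply: Rintegral_ge0 => x _; exact: sqr_ge0.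
Qed.

Lemma dot_eq0_ae_zero u : dot u u = 0 -> ae_zero Omega u.
Proof. by move=> /(Rintegral_sqr_eq0 mO (H1_funL2 u)). Qed.

Lemma ae_zero_dot u v : ae_zero Omega u -> dot u v = 0.
Proof.
move=> u0; apply: Rintegral_ae_eq0 => //.
  by apply: filterS u0 => x h Ox; rewrite h// mul0r.
exact: measurable_funM (H1_funL2 u).1 (H1_funL2 v).1.
Qed.

Definition H1_one : H1 Omega := H1_smooth (@smooth_cst R n 1).

Lemma dot_one u : dot u H1_one = \int[lambda]_(x in Omega) u x.
Proof. by apply: eq_Rintegral => x _; rewrite mulr1. Qed.

Lemma dirichlet_one u : dirichlet u H1_one = 0.
Proof.
rewrite /dirichlet big1// => i _ /=; under eq_Rintegral do rewrite partial_cst mulr0.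
by rewrite Rintegral_cst// mul0r.
Qed.

Lemma dot_one_one_gt0 : 0 < dot H1_one H1_one.
Proof.
rewrite dot_one Rintegral_cst// mul1r.
have /= e := lebesgue_rV_box (fun i => ltW (ab i)).
rewrite -[ltRHS]/(fine (cons_measure (lebesgue_rV n) Omega)) e.
by apply: prodr_gt0 => i _; rewrite subr_gt0.
Qed.

End H1_constructions.

(** * Smooth cut-offs near the end points of an interval *)

Section cutoff.
Context (R : realType).

Lemma flat0_le1 (t : R) : `|flat 0 t| <= 1.
Proof. by rewrite ger0_norm ?flat_ge0//; exact: flat_le. Qed.

Lemma flat0_near1 (t : R) : 0 < t -> `|1 - flat 0 t| <= 1 / t.
Proof.
move=> t0; rewrite ger0_norm; last by rewrite subr_ge0; exact: flat_le.
by rewrite /flat t0 expr0 mul1r div1r; have := expR_ge1Dx (- t^-1); lra.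
Qed.

Lemma derive1_flat0 : derive1 (@flat R 0) = flat 2.
Proof.
apply: derive1_is_derive => t; have := is_derive_flat 0 t.
by rewrite oppr0 mul0r addr0.
Qed.

(** For t = N s - 1, with s the distance to an end point, this is s times the s-derivative of
    [flat 0] at N s - 1: the distance s absorbs the factor N. *)
Definition flat_slope (t : R) := (t + 1) * flat 2 t.

Lemma flat_slopeE t : flat_slope t = flat 1 t + flat 2 t.
Proof.
rewrite /flat_slope /flat; case: ifPn => [t0|_]; last by rewrite mulr0 addr0.
by rewrite expr2 expr1 mulrDl mul1r !mulrA divff ?gt_eqF// mul1r.
Qed.

Lemma flat_slope_le t : `|flat_slope t| <= 3.
Proof.
rewrite flat_slopeE ger0_norm ?addr_ge0 ?flat_ge0//.
by have := flat_le 1 t; have := flat_le 2 t; rewrite !factS fact0 !muln1; lra.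
Qed.

Lemma flat_slope_small t : 0 < t -> `|0 - flat_slope t| <= 2 / t.
Proof.
move=> t0; rewrite sub0r normrN flat_slopeE ger0_norm ?addr_ge0 ?flat_ge0//.
have h k : flat k.+1 t = flat k t / t by rewrite /flat t0 exprS mulrAC mulrC mulrA mulrAC.
rewrite (h 1) {1}(h 0) -mulrDl ler_pM2r ?invr_gt0//.
by have := flat_le 0 t; have := flat_le 1 t; rewrite !factS fact0 !muln1; lra.
Qed.

(** Dilation sends every fixed positive distance [s] to infinity, where [g] approaches [l]. *)
Lemma cvg_dilate (g : R -> R) (l c s : R) : 0 < s -> 0 <= c ->
  (forall t, 0 < t -> `|l - g t| <= c / t) ->
  g (N.+1%:R * s - 1) @[N --> \oo] --> l.
Proof.
move=> s0 c0 h; apply/cvgrPdist_le => e e0; near=> N.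
have hN : (c / e + 2) / s <= N%:R by near: N; exact: nbhs_infty_ger.
have hN1 : c / e + 1 <= N.+1%:R * s - 1.
  move: hN; rewrite ler_pdivrMr// -[N.+1]addn1 natrD mulrDl mul1r; lra.
have ce : 0 <= c / e by rewrite divr_ge0// ltW.
have t0 : 0 < N.+1%:R * s - 1 by lra.
apply: le_trans (h _ t0) _; rewrite ler_pdivrMr// mulrC -ler_pdivrMr//; lra.
Unshelve. all: by end_near. Qed.

End cutoff.

Section cutoff_1d.
Context (R : realType) (a b : R).

(* A smooth function supported in [a + 1/(N+1), b - 1/(N+1)], tending to 1. Its
   derivative is unbounded, but [(t - a)(b - t)] times it stays bounded and
   tends to 0, see [flat_slope]. *)
Definition cutoff (N : nat) (t : R) : R :=
  flat 0 (N.+1%:R * t + (- N.+1%:R * a - 1)) *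
  flat 0 (- N.+1%:R * t + (N.+1%:R * b - 1)).

Let cutoffL N t : N.+1%:R * t + (- N.+1%:R * a - 1) = N.+1%:R * (t - a) - 1 :> R.
Proof. by ring. Qed.

Let cutoffR N t : - N.+1%:R * t + (N.+1%:R * b - 1) = N.+1%:R * (b - t) - 1 :> R.
Proof. by ring. Qed.

Lemma smooth1_cutoff N : smooth1 (cutoff N).
Proof.
by apply: smooth1_mul; apply: smooth1_affine; exact: smooth1_flat.
Qed.

Lemma cutoff_le1 N t : `|cutoff N t| <= 1.
Proof. by rewrite normrM -[leRHS]mulr1 ler_pM// flat0_le1. Qed.

Lemma cutoff_cvg t : a < t < b -> cutoff N t @[N --> \oo] --> (1 : R).
Proof.
move=> /andP[at_ tb]; rewrite /cutoff -[X in _ --> X]mulr1.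
under eq_fun do rewrite cutoffL cutoffR.
apply: cvgM; apply: (@cvg_dilate _ _ _ 1); rewrite ?subr_gt0 ?ler01//; exact: flat0_near1.
Qed.

Lemma cutoff_out N t : ~ (a + N.+1%:R^-1 <= t <= b - N.+1%:R^-1) -> cutoff N t = 0.
Proof.
move=> h; rewrite /cutoff cutoffL cutoffR /flat.
have N0 : 0 < N.+1%:R :> R by rewrite ltr0n.
case: ifPn => [h1|_]; last by rewrite mul0r.
case: ifPn => [h2|_]; last by rewrite mulr0.
exfalso; apply: h; apply/andP; split.
  rewrite -lerBrDl -[leLHS]mul1r ler_pdivrMr// mulrC; lra.
rewrite lerBrDr addrC -lerBrDr -[leLHS]mul1r ler_pdivrMr// mulrC; lra.
Qed.

Lemma derive1_cutoff N t : derive1 (cutoff N) t =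
  N.+1%:R * (flat 0 (N.+1%:R * (b - t) - 1) * flat 2 (N.+1%:R * (t - a) - 1)
   - flat 0 (N.+1%:R * (t - a) - 1) * flat 2 (N.+1%:R * (b - t) - 1)).
Proof.
have sf := smooth1_flat R 0.
rewrite derive1_mul; [|exact: smooth1_affine..].
rewrite !derive1_affine; [|exact: smooth1_derivable..].
by rewrite derive1_flat0 !cutoffL !cutoffR; ring.
Qed.

Section product.
Variables (s : R -> R) (C : R).
Hypothesis ss : smooth1 s.
Hypothesis sa : forall t, a < t < b -> `|s t| <= C * (t - a).
Hypothesis sb : forall t, a < t < b -> `|s t| <= C * (b - t).

Lemma derive1_cutoff_mul_le N t : a < t < b ->
  `|s t * derive1 (cutoff N) t| <= C * `|flat_slope (N.+1%:R * (t - a) - 1)| +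
    C * `|flat_slope (N.+1%:R * (b - t) - 1)|.
Proof.
move=> tab; have N0 : 0 < N.+1%:R :> R by rewrite ltr0n.
(* Here [x] is the distance to the end where the differentiated factor cuts off. The linear
   vanishing of [s] there supplies an [x] to set against [N.+1]. *)
have key (x p q : R) : 0 < x -> `|s t| <= C * x -> `|p| <= 1 ->
    `|s t * (N.+1%:R * (p * flat 2 q))| <= C * (N.+1%:R * x * flat 2 q).
  move=> x0 sx p1; rewrite !normrM (gtr0_norm N0) (ger0_norm (flat_ge0 _ _)).
  have -> : C * (N.+1%:R * x * flat 2 q) = C * x * (N.+1%:R * (1 * flat 2 q)) by ring.
  apply: ler_pM => //; first by rewrite !mulr_ge0 ?flat_ge0.
  by rewrite ler_pM2l// ler_wpM2r ?flat_ge0.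
have k1 := key (t - a) (flat 0 (N.+1%:R * (b - t) - 1)) (N.+1%:R * (t - a) - 1)
  ltac:(lra) (sa tab) (flat0_le1 _).
have k2 := key (b - t) (flat 0 (N.+1%:R * (t - a) - 1)) (N.+1%:R * (b - t) - 1)
  ltac:(lra) (sb tab) (flat0_le1 _).
have e (x : R) : 0 < x -> `|flat_slope (N.+1%:R * x - 1)| =
    N.+1%:R * x * flat 2 (N.+1%:R * x - 1).
  move=> x0; rewrite /flat_slope subrK ger0_norm// !mulr_ge0 ?flat_ge0//.
  exact: ltW.
rewrite derive1_cutoff mulrBr mulrBr; apply: le_trans (ler_normB _ _) _.
by rewrite !e ?lerD//; lra.
Qed.

Lemma derive1_cutoff_mul_cvg t : a < t < b ->
  derive1 (fun t => cutoff N t * s t) t @[N --> \oo] --> derive1 s t.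
Proof.
move=> tab; have /andP[at_ tb] := tab.
have -> : (fun N => derive1 (fun t => cutoff N t * s t) t) =
    (fun N => cutoff N t * derive1 s t + s t * derive1 (cutoff N) t).
  by apply/funext => N; rewrite (derive1_mul _ (smooth1_cutoff _) ss).
rewrite -[X in _ --> X]addr0; apply: cvgD.
  rewrite -[X in _ --> X]mul1r; apply: cvgM; [exact: cutoff_cvg|exact: cvg_cst].
have z x : 0 < x -> C * `|flat_slope (N.+1%:R * x - 1)| @[N --> \oo] --> (0 : R).
  move=> x0; rewrite -(mulr0 C); apply: cvgMr; rewrite -(normr0 R).
  apply: cvg_norm; apply: (@cvg_dilate _ _ _ 2) => //; exact: flat_slope_small.
apply: norm_cvg0; apply: (@squeeze_cvgr _ _ _ _ (fun=> 0) (fun N =>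
  C * `|flat_slope (N.+1%:R * (t - a) - 1)| +
    C * `|flat_slope (N.+1%:R * (b - t) - 1)|)).
- by near=> N; rewrite normr_ge0/=; exact: derive1_cutoff_mul_le.
- exact: cvg_cst.
- by rewrite -(addr0 0); apply: cvgD; apply: z; lra.
Unshelve. all: by end_near. Qed.

Lemma derive1_cutoff_mul_bound N t : a < t < b ->
  `|derive1 (fun t => cutoff N t * s t) t| <= `|derive1 s t| + 6 * C.
Proof.
move=> tab; have C0 : 0 <= C.
  have /andP[at_ tb] := tab; have := le_trans (normr_ge0 _) (sa tab).
  by rewrite pmulr_lge0 ?subr_gt0.
rewrite derive1_mul//; last exact: smooth1_cutoff.
apply: le_trans (ler_normD _ _) _; apply: lerD.
  by rewrite normrM -[leRHS]mul1r ler_wpM2r// cutoff_le1.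
apply: le_trans (derive1_cutoff_mul_le N tab) _.
(* Both slopes are at most 3, which accounts for the constant 6. *)
have := flat_slope_le (N.+1%:R * (t - a) - 1).
have := flat_slope_le (N.+1%:R * (b - t) - 1).
move: `|_| `|_| => x y x3 y3; nra.
Qed.

End product.
End cutoff_1d.

(** * Integration by parts up to the boundary for Sobolev functions *)

Section H1_integration_by_parts.
Context (R : realType) (n : nat) (a b : 'rV[R]_n.+1).
Local Notation Omega := (box a b).
Local Notation lambda := (@lebesgue_rV R n.+1).
Implicit Types (s : 'I_n.+1 -> R -> R) (x : 'rV[R]_n.+1).

Let mO : measurable Omega := measurable_box a b.
Let fO : (lambda Omega < +oo)%E := lebesgue_rV_box_lty a b.

Lemma prod_fun_le s (B : 'I_n.+1 -> R) x :
  (forall j, `|s j (x ord0 j)| <= B j) -> `|prod_fun s x| <= \prod_j B j.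
Proof.
by move=> h; rewrite /prod_fun normr_prod; apply: ler_prod => j _; rewrite normr_ge0/=.
Qed.

Lemma prod_fun_cvg (S : nat -> 'I_n.+1 -> R -> R) s x :
  (forall j, S N j (x ord0 j) @[N --> \oo] --> s j (x ord0 j)) ->
  prod_fun (S N) x @[N --> \oo] --> prod_fun s x.
Proof.
move=> h; rewrite /prod_fun; elim: (index_enum _) => [|j r IH].
  rewrite big_nil (_ : (fun N => _) = fun=> 1); first exact: cvg_cst.
  by apply/funext => N; rewrite big_nil.
rewrite big_cons (_ : (fun N => _) = fun N => S N j (x ord0 j) *
    \prod_(j <- r) S N j (x ord0 j)); first exact: cvgM.
by apply/funext => N; rewrite big_cons.
Qed.

Lemma continuous_itv_bounded (f : R -> R) (p q : R) : continuous f ->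
  exists C : R, forall t, p < t < q -> `|f t| <= C.
Proof.
move=> cf; have := continuous_compact (continuous_subspaceT cf) (@segment_compact R p q).
move=> /compact_bounded[M [Mr hM]]; exists (`|M| + 1) => t tpq; apply: hM.
  by apply: le_lt_trans (ler_norm M) _; rewrite ltrDl.
exists t => //; rewrite /= in_itv/=; lra.
Qed.

Lemma box_cutoff_test s (N : nat) : (forall j, smooth1 (s j)) ->
  test_function Omega (prod_fun (fun j t => cutoff (a ord0 j) (b ord0 j) N t * s j t)).
Proof.
move=> ss; split.
  by apply: smooth_prod_fun => j; apply: smooth1_mul => //; exact: smooth1_cutoff.
exists [set x : 'rV[R]_n.+1 | forall j,
  `[a ord0 j + N.+1%:R^-1, b ord0 j - N.+1%:R^-1]%classic (x ord0 j)]; split.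
- apply: (@rV_compact _ _ (fun j => `[a ord0 j + N.+1%:R^-1, b ord0 j - N.+1%:R^-1]%classic)).
  by move=> j; exact: segment_compact.
- move=> x Kx j; have := Kx j; rewrite /= in_itv/=.
  have : 0 < N.+1%:R^-1 :> R by rewrite invr_gt0 ltr0n.
  by move: (_^-1) => e; lra.
- move=> x /existsNP[j hj]; rewrite /prod_fun (bigD1 j)//= cutoff_out ?mul0r//.
Qed.

(** The product of the [s j] is not compactly supported, so every factor is multiplied by a cut-off
    before the weak gradient is tested. The derivative falls on the i-th factor alone, which is why
    only [s i] has to vanish at the ends; the other factors just need to be bounded. *)
Lemma H1_ibp (u : H1 Omega) i s (C : R) : (forall j, smooth1 (s j)) ->
  (forall t, a ord0 i < t < b ord0 i -> `|s i t| <= C * (t - a ord0 i)) ->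
  (forall t, a ord0 i < t < b ord0 i -> `|s i t| <= C * (b ord0 i - t)) ->
  \int[lambda]_(x in Omega) (u x * prod_fun (update s i (derive1 (s i))) x) =
  - \int[lambda]_(x in Omega) (grad u i x * prod_fun s x).
Proof.
move=> ss sa sb.
pose S N j t := cutoff (a ord0 j) (b ord0 j) N t * s j t.
have sS N j : smooth1 (S N j) by apply: smooth1_mul => //; exact: smooth1_cutoff.
have /choice[B hB] : forall j, exists C : R, forall t, a ord0 j < t < b ord0 j ->
    `|s j t| <= C.
  by move=> j; apply: continuous_itv_bounded; exact: smooth1_continuous.
have [B' hB'] := continuous_itv_bounded (a ord0 i) (b ord0 i)
  (smooth1_continuous (smooth1_derive (ss i))).
have mp p : (forall j, smooth1 (p j)) -> measurable_fun Omega (prod_fun p).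
  move=> sp; apply: measurable_funTS; apply: continuous_measurable_rV.
  by apply: continuous_prod_fun => j; exact: smooth1_continuous.
have sup p q : (forall j, smooth1 (p j)) -> smooth1 q -> forall j, smooth1 (update p i q j).
  by move=> sp sq j; rewrite /update; case: ifP.
have SB N j t : a ord0 j < t < b ord0 j -> `|S N j t| <= B j.
  move=> tab; rewrite normrM; apply: le_trans (hB j t tab).
  by rewrite -[leRHS]mul1r ler_wpM2r// cutoff_le1.
have Scvg j t : a ord0 j < t < b ord0 j -> S N j t @[N --> \oo] --> s j t.
  move=> tab; rewrite -[s j t]mul1r; apply: cvgM; last exact: cvg_cst.
  exact: cutoff_cvg.
have l1 : \int[lambda]_(x in Omega) (grad u i x * prod_fun (S N) x) @[N --> \oo] -->
    \int[lambda]_(x in Omega) (grad u i x * prod_fun s x).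
  apply: (sqint_dominated mO fO (C := \prod_j B j)).
  - exact: gradL2.
  - by move=> N; exact: mp.
  - exact: mp.
  - by move=> N x Ox; apply: prod_fun_le => j; apply: SB; exact: Ox.
  - by move=> x Ox; apply: prod_fun_cvg => j; apply: Scvg; exact: Ox.
have l2 : \int[lambda]_(x in Omega) (u x * prod_fun (update (S N) i (derive1 (S N i))) x)
    @[N --> \oo] -->
    \int[lambda]_(x in Omega) (u x * prod_fun (update s i (derive1 (s i))) x).
  apply: (sqint_dominated mO fO (C := \prod_j (if j == i then B' + 6 * C else B j))).
  - exact: H1_funL2.
  - by move=> N; apply: mp => j; apply: sup => //; exact: smooth1_derive.
  - by apply: mp => j; apply: sup => //; exact: smooth1_derive.
  - move=> N x Ox; apply: prod_fun_le => j; rewrite /update; case: eqP => [->|_].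
      apply: le_trans (derive1_cutoff_mul_bound (ss i) sa sb N (Ox i)) _.
      by rewrite lerD2r; apply: hB'; exact: Ox.
    by apply: SB; exact: Ox.
  - move=> x Ox; apply: prod_fun_cvg => j; rewrite /update; case: eqP => [->|_].
      by apply: (derive1_cutoff_mul_cvg (ss i) sa sb); exact: Ox.
    by apply: Scvg; exact: Ox.
have e N : \int[lambda]_(x in Omega)
      (u x * prod_fun (update (S N) i (derive1 (S N i))) x) =
    - \int[lambda]_(x in Omega) (grad u i x * prod_fun (S N) x).
  rewrite -grad_weak; last exact: box_cutoff_test.
  by rewrite partial_prod_fun.
move: l2; rewrite (funext e) => l2.
by apply: cvg_unique l2 _ => //; exact: cvgN.
Qed.

End H1_integration_by_parts.

(** * Cosine modes *)

Section cosine_wave.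
Context (R : realType).

Lemma norm_sin_le (x : R) : `|sin x| <= `|x|.
Proof.
have pos (y : R) : 0 <= y -> `|sin y| <= y.
  move=> y0; have [c _] := @MVT_segment R sin cos 0 y y0
    (fun x _ => is_derive_sin x) (continuous_subspaceT (@continuous_sin R)).
  rewrite sin0 !subr0 => ->; rewrite normrM (ger0_norm y0) -[leRHS]mul1r.
  by rewrite ler_wpM2r// cos_max.
have [x0|x0] := leP 0 x; first by rewrite (ger0_norm x0); exact: pos.
by rewrite -normrN -sinN (ltr0_norm x0); apply: pos; lra.
Qed.

Lemma norm_sin_natpiB k (x : R) : `|sin (pi * k%:R - x)| = `|sin x|.
Proof.
elim: k => [|k IH]; first by rewrite mulr0 sub0r sinN normrN.
have -> : pi * k.+1%:R - x = pi * k%:R - x + pi :> R by rewrite -natr1; ring.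
by rewrite sinDpi normrN.
Qed.

(** The argument has the shape [p * t + q] expected by the lemmas on affine substitution; [waveE]
    gives the readable form. *)
Definition wave (w c : R) (t : R) := cos (w * t + - (w * c)).

Lemma waveE w c t : wave w c t = cos (w * (t - c)).
Proof. by rewrite /wave mulrBr. Qed.

Lemma smooth1_wave w c : smooth1 (wave w c).
Proof. by apply: smooth1_affine; exact: smooth1_cos. Qed.

Lemma derive1_wave w c t : derive1 (wave w c) t = - w * sin (w * (t - c)).
Proof.
rewrite derive1_affine; last exact: (smooth1_derivable _ (@smooth1_cos R)).
by rewrite derive1_cosE mulrN mulNr mulrBr.
Qed.

Lemma derive1_derive1_wave w c t :
  derive1 (derive1 (wave w c)) t = - w ^+ 2 * wave w c t.
Proof.
have -> : derive1 (wave w c) = fun t => - w * sin (w * t + - (w * c)).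
  by apply/funext => x; rewrite derive1_wave mulrBr.
rewrite derive1_scale; last by apply: smooth1_affine; exact: smooth1_sin.
rewrite derive1_affine; last exact: (smooth1_derivable _ (@smooth1_sin R)).
by rewrite derive1_sinE /wave; ring.
Qed.

End cosine_wave.

Section cosines.
Context (R : realType) (n : nat) (a b : 'rV[R]_n.+1).
Hypothesis ab : forall i, a ord0 i < b ord0 i.
Local Notation Omega := (box a b).
Local Notation lambda := (@lebesgue_rV R n.+1).
Implicit Types (k l : {ffun 'I_n.+1 -> nat}) (i j : 'I_n.+1) (u : H1 Omega).

Let mO : measurable Omega := measurable_box a b.

Definition side i : R := b ord0 i - a ord0 i.

Lemma side_gt0 i : 0 < side i. Proof. by rewrite subr_gt0. Qed.

Definition freq k i : R := pi * (k i)%:R / side i.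

Lemma freq_ge0 k i : 0 <= freq k i.
Proof. by rewrite divr_ge0 ?mulr_ge0 ?pi_ge0// ltW// side_gt0. Qed.

Definition cos_mode k : 'rV[R]_n.+1 -> R :=
  prod_fun (fun j => wave (freq k j) (a ord0 j)).

Definition cos_eigenvalue k : R := \sum_i freq k i ^+ 2.

Lemma smooth_cos_mode k : smooth (cos_mode k).
Proof. by apply: smooth_prod_fun => j; exact: smooth1_wave. Qed.

Definition cosH k : H1 Omega := H1_smooth ab (smooth_cos_mode k).

(** Integration by parts against the mode whose i-th factor is replaced by its derivative, a sine.
    It vanishes linearly at both ends, since the frequency times the side is a multiple of pi, and
    differentiating it once more returns the mode times minus the squared frequency. *)
Lemma cos_mode_ibp u k i :
  \int[lambda]_(x in Omega) (grad u i x * grad (cosH k) i x) =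
  freq k i ^+ 2 * dot u (cosH k).
Proof.
set c := fun j => wave (freq k j) (a ord0 j).
pose s := update c i (derive1 (c i)).
have ss j : smooth1 (s j).
  rewrite /s /update; case: ifP => _; last exact: smooth1_wave.
  by apply: smooth1_derive; exact: smooth1_wave.
have L0 := side_gt0 i.
have f0 := freq_ge0 k i.
have si t : s i t = - freq k i * sin (freq k i * (t - a ord0 i)).
  by rewrite /s update_eq derive1_wave.
have sa t : a ord0 i < t < b ord0 i -> `|s i t| <= freq k i ^+ 2 * (t - a ord0 i).
  move=> tab; rewrite si normrM normrN (ger0_norm f0) expr2 -mulrA ler_wpM2l//.
  by apply: le_trans (norm_sin_le _) _; rewrite ger0_norm// mulr_ge0//; lra.
have sb t : a ord0 i < t < b ord0 i -> `|s i t| <= freq k i ^+ 2 * (b ord0 i - t).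
  move=> tab; rewrite si normrM normrN (ger0_norm f0) expr2 -mulrA ler_wpM2l//.
  have -> : freq k i * (t - a ord0 i) = pi * (k i)%:R - freq k i * (b ord0 i - t).
    have -> : pi * (k i)%:R = freq k i * side i by rewrite /freq mulfVK// gt_eqF.
    by rewrite /side; ring.
  rewrite norm_sin_natpiB.
  by apply: le_trans (norm_sin_le _) _; rewrite ger0_norm// mulr_ge0//; lra.
have := H1_ibp u ss sa sb.
have -> : prod_fun s = grad (cosH k) i.
  by rewrite /= partial_prod_fun//; exact: smooth1_wave.
have -> : prod_fun (update s i (derive1 (s i))) =
    fun x => - freq k i ^+ 2 * cosH k x.
  apply/funext => x; rewrite prod_fun_update /s update_eq derive1_derive1_wave.
  rewrite /= /cos_mode -[x in prod_fun _ x](hyperplane_pointK i) prod_fun_line.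
  rewrite mulrCA; congr (_ * (_ * _)); apply: eq_bigr => j _.
  by rewrite update_lift mxE.
move=> /eqP; rewrite -eqr_oppLR => /eqP <-.
rewrite (@eq_Rintegral _ _ _ _ _ (fun x => - freq k i ^+ 2 * (u x * cosH k x))).
  by rewrite RintegralZl ?mulNr ?opprK//; apply: sqint_integrableM => //; exact: H1_funL2.
by move=> x _; ring.
Qed.

Lemma dirichlet_cosH u k : dirichlet u (cosH k) = cos_eigenvalue k * dot u (cosH k).
Proof.
by rewrite /dirichlet mulr_suml; apply: eq_bigr => i _; rewrite cos_mode_ibp.
Qed.

(** Distinct modes may share their eigenvalue, so the symmetry argument is made in a single
    coordinate in which the frequencies differ. *)
Lemma cosH_orthogonal k l : k != l -> dot (cosH k) (cosH l) = 0.
Proof.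
move=> kl; have [i /eqP ki] : exists i, k i <> l i.
  by apply/existsNP => h; move/eqP : kl; apply; apply/ffunP.
have := cos_mode_ibp (cosH k) l i; rewrite RintegralC cos_mode_ibp dotC => /eqP.
rewrite -subr_eq0 -mulrBl mulf_eq0 subr_eq0 => /orP[|/eqP//].
have L0 := side_gt0 i.
rewrite eqrXn2 ?freq_ge0// /freq => /eqP/(mulIf _)/(mulfI _) h.
exfalso; move/negP : ki; apply; rewrite -(eqr_nat R); apply/eqP; apply: h.
- by rewrite gt_eqF// pi_gt0.
- by rewrite invr_neq0// gt_eqF.
Qed.

Definition cos_sum (r : seq {ffun 'I_n.+1 -> nat}) (c : {ffun 'I_n.+1 -> nat} -> R) :
    H1 Omega :=
  foldr (fun k u => H1_lin (c k) u (cosH k)) (H1_smooth ab (@smooth_cst R n 0)) r.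

Lemma cos_sumE r c x : cos_sum r c x = \sum_(k <- r) c k * cos_mode k x.
Proof. by elim: r => [|k r IH]; rewrite ?big_nil//= big_cons /= IH addrC. Qed.

Lemma dot_zero u : dot u (H1_smooth ab (@smooth_cst R n 0)) = 0.
Proof.
by rewrite /dot; under eq_Rintegral do rewrite mulr0; rewrite Rintegral_cst// mul0r.
Qed.

Lemma dirichlet_zero u : dirichlet u (H1_smooth ab (@smooth_cst R n 0)) = 0.
Proof.
rewrite /dirichlet big1// => i _ /=; under eq_Rintegral do rewrite partial_cst mulr0.
by rewrite Rintegral_cst// mul0r.
Qed.

Lemma dot_cos_sum u r c : dot u (cos_sum r c) = \sum_(k <- r) c k * dot u (cosH k).
Proof.
elim: r => [|k r IH]; rewrite ?big_nil ?dot_zero//= big_cons dot_linr IH addrC//.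
Qed.

Lemma dirichlet_cos_sum u r c : dirichlet u (cos_sum r c) =
  \sum_(k <- r) c k * (cos_eigenvalue k * dot u (cosH k)).
Proof.
elim: r => [|k r IH]; rewrite ?big_nil ?dirichlet_zero//= big_cons.
by rewrite dirichlet_linr IH addrC dirichlet_cosH.
Qed.

Lemma dot_cosH_cos_sum r c k : uniq r -> k \in r ->
  dot (cos_sum r c) (cosH k) = c k * dot (cosH k) (cosH k).
Proof.
move=> ur kr; rewrite dotC dot_cos_sum (bigD1_seq k)//= big1 ?addr0// => l lk.
by rewrite cosH_orthogonal ?mulr0// eq_sym.
Qed.

Lemma dot_cos_sum_diag r c d : uniq r -> dot (cos_sum r c) (cos_sum r d) =
  \sum_(k <- r) c k * d k * dot (cosH k) (cosH k).
Proof.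
move=> ur; rewrite dot_cos_sum big_seq [RHS]big_seq; apply: eq_bigr => k kr.
by rewrite dot_cosH_cos_sum//; ring.
Qed.

Lemma dirichlet_cos_sum_diag r c d : uniq r -> dirichlet (cos_sum r c) (cos_sum r d) =
  \sum_(k <- r) cos_eigenvalue k * (c k * d k) * dot (cosH k) (cosH k).
Proof.
move=> ur; rewrite dirichlet_cos_sum big_seq [RHS]big_seq; apply: eq_bigr => k kr.
by rewrite dot_cosH_cos_sum//; ring.
Qed.

End cosines.

(** * Polynomials converging to a step *)

Section threshold.
Context (R : realType).

Lemma mul_exprn_cvg0 (q : R) : 0 <= q < 1 -> N%:R * q ^+ N @[N --> \oo] --> (0 : R).
Proof.
move=> /andP[q0 q1]; have [->|qn0] := eqVneq q 0.
  apply: cvg_near_cst; exists 1 => // N /= N0.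
  by rewrite expr0n gtn_eqF// mulr0.
have qp : 0 < q by rewrite lt_def qn0.
pose d := - ln q; have d0 : 0 < d by rewrite /d oppr_gt0 ln_lt0// qp.
have qE : q = expR (- d) by rewrite /d opprK lnK// posrE.
apply/cvgrPdist_le => e e0; near=> N.
have N0 : 0 < N%:R :> R by rewrite ltr0n; near: N; exact: nbhs_infty_gt.
rewrite sub0r normrN ger0_norm ?mulr_ge0 ?exprn_ge0//.
rewrite qE -expRM_natl mulrN.
(* With q = exp (- d), the bound x^2 exp (- x) <= 2 at x = N d gives N q^N <= 2 / (N d^2). *)
have := @pow_expRN_le R 2 (N%:R * d) (ltW (mulr_gt0 N0 d0)).
rewrite !factS fact0 !muln1 exprMn => h.
have hN : 2 / (d ^+ 2 * e) <= N%:R by near: N; exact: nbhs_infty_ger.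
have h2 : 2 <= N%:R * (d ^+ 2 * e).
  by move: hN; rewrite ler_pdivrMr// mulr_gt0// exprn_gt0.
have d2 : 0 < d ^+ 2 by rewrite exprn_gt0.
rewrite -(ler_pM2l (mulr_gt0 N0 d2)); apply: le_trans (_ : 2 <= _); last by lra.
by apply: le_trans _ h; rewrite le_eqVlt; apply/orP; left; apply/eqP; ring.
Unshelve. all: by end_near. Qed.

Lemma onem_expr_ge (x : R) m : 0 <= x <= 1 -> 1 - m%:R * x <= (1 - x) ^+ m.
Proof.
move=> /andP[x0 x1]; elim: m => [|m IH]; first by rewrite mul0r subr0 expr0.
rewrite exprS; apply: le_trans (_ : (1 - x) * (1 - m%:R * x) <= _); last first.
  by rewrite ler_wpM2l// subr_ge0.
rewrite -natr1; have : 0 <= m%:R * x ^+ 2 by rewrite mulr_ge0 ?sqr_ge0.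
by move: m%:R => y; nra.
Qed.

Lemma onem_expr_le (x : R) m : 0 <= x <= 1 -> (1 - x) ^+ m <= expR (- (m%:R * x)).
Proof.
move=> /andP[x0 x1]; rewrite -mulrN expRM_natl lerXn2r ?nnegrE ?expR_ge0 ?subr_ge0//.
exact: expR_ge1Dx.
Qed.

(* With exponent [K ^ N] instead of [N * K ^ N] the limit at the threshold
   [K p = 1] would be [1 / e]. *)
Definition threshold (K N : nat) (p : R) := (1 - p ^+ N) ^+ (N * K ^ N).

Lemma threshold_le1 K N p : 0 <= p <= 1 -> `|threshold K N p| <= 1.
Proof.
move=> /andP[p0 p1]; have h : 0 <= p ^+ N <= 1 by rewrite exprn_ge0// exprn_ile1.
rewrite ger0_norm; last by rewrite exprn_ge0//; lra.
by rewrite /threshold exprn_ile1//; lra.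
Qed.

(** A variant of the polynomials in the proof of the Stone-Weierstrass theorem by Brosowski and
    Deutsch. For K p < 1, Bernoulli's inequality bounds it below by 1 - N (K p)^N; otherwise it is
    at most exp (- N (K p)^N), hence at most 1 / (N + 1), also at K p = 1. *)
Lemma threshold_cvg K p : 0 <= p <= 1 ->
  threshold K N p @[N --> \oo] --> ((K%:R * p < 1)%R%:R : R).
Proof.
move=> p01; have /andP[p0 p1] := p01.
have h N : 0 <= p ^+ N <= 1 by rewrite exprn_ge0// exprn_ile1.
have e N : (N * K ^ N)%:R * p ^+ N = N%:R * (K%:R * p) ^+ N.
  by rewrite natrM natrX exprMn mulrA.
have [Kp|Kp] := ltP (K%:R * p) 1.
- apply: (@squeeze_cvgr _ _ _ _ (fun N => 1 - N%:R * (K%:R * p) ^+ N) (fun=> 1)).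
  + near=> N; rewrite -e onem_expr_ge//=.
    by apply: le_trans (ler_norm _) _; exact: threshold_le1.
  + rewrite -[X in _ --> X]subr0; apply: cvgB; first exact: cvg_cst.
    by apply: mul_exprn_cvg0; rewrite mulr_ge0.
  + exact: cvg_cst.
- apply: (@squeeze_cvgr _ _ _ _ (fun=> 0) (fun N => N.+1%:R^-1)).
  + near=> N; apply/andP; split; first by rewrite exprn_ge0//; have := h N; lra.
    apply: le_trans (onem_expr_le _ (h N)) _; rewrite e expRN.
    rewrite lef_pV2 ?posrE ?expR_gt0 ?ltr0n//.
    apply: le_trans (expR_ge1Dx _); rewrite -natr1 addrC lerD2l.
    by rewrite ler_peMr// exprn_ege1.
  + exact: cvg_cst.
  + exact: cvg_harmonic.
Unshelve. all: by end_near. Qed.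

End threshold.

(** * Density of the cosine modes in L^2 *)

Section cosine_density.
Context (R : realType) (n : nat) (a b : 'rV[R]_n.+1).
Hypothesis ab : forall i, a ord0 i < b ord0 i.
Local Notation Omega := (box a b).
Local Notation lambda := (@lebesgue_rV R n.+1).
Local Notation side := (side a b).
Local Notation freq := (freq a b).
Local Notation cos_mode := (cos_mode a b).
Implicit Types (k l : {ffun 'I_n.+1 -> nat}) (i j : 'I_n.+1) (p q : 'rV[R]_n.+1 -> R).

Let mO : measurable Omega := measurable_box a b.
Let fO : (lambda Omega < +oo)%E := lebesgue_rV_box_lty a b.

(** Requiring [uniq r] makes the coefficients diagonalize [dot] and [dirichlet]; in exchange, sums
    have to merge their lists of modes. *)
Definition cos_span : set ('rV[R]_n.+1 -> R) :=
  [set p | exists r c, uniq r /\ p = fun x => \sum_(k <- r) c k * cos_mode k x].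

Lemma big_subseq_if (r r' : seq {ffun 'I_n.+1 -> nat}) (F : _ -> R) :
  uniq r -> uniq r' -> {subset r <= r'} ->
  \sum_(k <- r) F k = \sum_(k <- r') if k \in r then F k else 0.
Proof.
move=> ur ur' sub; rewrite -big_mkcond -[RHS]big_filter; apply: perm_big.
apply: uniq_perm => //; first exact: filter_uniq.
by move=> k; rewrite mem_filter; case kr : (k \in r) => //=; rewrite sub.
Qed.

Lemma cos_span_lin d p q : cos_span p -> cos_span q ->
  cos_span (fun x => p x + d * q x).
Proof.
move=> [r1 [c1 [u1 ->]]] [r2 [c2 [u2 ->]]].
pose r := undup (r1 ++ r2); exists r, (fun k => (if k \in r1 then c1 k else 0) +
  d * (if k \in r2 then c2 k else 0)); split; first exact: undup_uniq.
have ur : uniq r by exact: undup_uniq.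
apply/funext => x.
rewrite (big_subseq_if _ u1 ur); last by move=> k kr; rewrite mem_undup mem_cat kr.
rewrite (big_subseq_if _ u2 ur); last by move=> k kr; rewrite mem_undup mem_cat kr orbT.
rewrite mulr_sumr -big_split; apply: eq_bigr => k _ /=.
by case: ifP => _; case: ifP => _; ring.
Qed.

Lemma cos_mode_span k : cos_span (cos_mode k).
Proof.
by exists [:: k], (fun=> 1); split=> //; apply/funext => x; rewrite big_seq1 mul1r.
Qed.

Lemma cos_mode0 x : cos_mode [ffun=> 0%N] x = 1.
Proof.
by rewrite /cos_mode /prod_fun big1// => j _; rewrite waveE /freq ffunE mulr0 !mul0r cos0.
Qed.

Lemma cos_span1 : cos_span (fun=> 1).
Proof.
rewrite (_ : (fun=> 1) = cos_mode [ffun=> 0%N]); first exact: cos_mode_span.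
by apply/funext => x; rewrite cos_mode0.
Qed.

Lemma cos_span0 : cos_span (fun=> 0).
Proof.
have := cos_span_lin (-1) cos_span1 cos_span1; congr cos_span.
by apply/funext => x; rewrite mulN1r subrr.
Qed.

Lemma cos_span_ind (P : set ('rV[R]_n.+1 -> R)) : P (fun=> 0) ->
  (forall d p k, P p -> P (fun x => p x + d * cos_mode k x)) ->
  forall p, cos_span p -> P p.
Proof.
move=> P0 Pl p [r [c [_ ->]]]; elim: r => [|k r IH].
  by under eq_fun do rewrite big_nil.
by under eq_fun do rewrite big_cons addrC; exact: Pl.
Qed.

(** Replaces an algebra structure on the span: polynomials in the cosines are built by multiplying
    in one variable at a time. *)
Definition multiplier i (h : R -> R) :=
  forall p, cos_span p -> cos_span (fun x => h (x ord0 i) * p x).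

Definition set_mode k i m : {ffun 'I_n.+1 -> nat} :=
  [ffun j => if j == i then m else k j].

Lemma cos_mode_set k i m x : cos_mode (set_mode k i m) x =
  (\prod_j wave (freq k (lift i j)) (a ord0 (lift i j)) (x ord0 (lift i j))) *
  wave (pi * m%:R / side i) (a ord0 i) (x ord0 i).
Proof.
rewrite /cos_mode -[x in prod_fun _ x](hyperplane_pointK i) prod_fun_line.
congr (_ * _); last by rewrite /freq ffunE eqxx.
apply: eq_bigr => j _; rewrite mxE /freq ffunE eq_sym.
by rewrite (negbTE (neq_lift _ _)).
Qed.

Lemma set_mode_id k i : set_mode k i (k i) = k.
Proof. by apply/ffunP => j; rewrite ffunE; case: eqP => // ->. Qed.

(** The product-to-sum formula: cos y cos (m y) is the mean of the cosines of (m + 1) y and (m - 1)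
    y. *)
Lemma multiplier_cos i : multiplier i (wave (pi / side i) (a ord0 i)).
Proof.
apply: cos_span_ind; first by under eq_fun do rewrite mulr0; exact: cos_span0.
move=> d p k hp.
under eq_fun do rewrite mulrDr mulrCA.
apply: cos_span_lin => //.
rewrite -[k in cos_mode k](set_mode_id k i).
(* At frequency 0 there is no lower neighbour: the product is the mode of frequency 1. *)
case: (k i) => [|m].
  rewrite (_ : (fun x => _) = cos_mode (set_mode k i 1)); first exact: cos_mode_span.
  apply/funext => x; rewrite !cos_mode_set mulr1 mulr0 mul0r.
  by rewrite [X in _ * (_ * X)]waveE mul0r cos0 mulr1 mulrC.
have h := cos_span_lin (2^-1) cos_span0 (cos_span_lin 1
  (cos_mode_span (set_mode k i m.+2)) (cos_mode_span (set_mode k i m))).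
rewrite (_ : (fun x => _) = fun x => 0 + 2^-1 * (cos_mode (set_mode k i m.+2) x +
  1 * cos_mode (set_mode k i m) x))//; apply/funext => x.
rewrite !cos_mode_set !waveE.
set t := x ord0 i - _; set P := \prod_j _; set y := pi / side i * t.
have -> : pi * m.+1%:R / side i * t = m.+1%:R * y by rewrite /y; ring.
have -> : pi * m.+2%:R / side i * t = m.+1%:R * y + y by rewrite /y -natr1; ring.
have -> : pi * m%:R / side i * t = m.+1%:R * y - y by rewrite /y -natr1; ring.
by rewrite cosD cosB; lra.
Qed.

Lemma multiplier_cst i d : multiplier i (fun=> d).
Proof.
move=> p hp; have := cos_span_lin d cos_span0 hp.
by under eq_fun do rewrite add0r.
Qed.

Lemma multiplier_lin i d h1 h2 : multiplier i h1 -> multiplier i h2 ->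
  multiplier i (fun t => h1 t + d * h2 t).
Proof.
move=> m1 m2 p hp; have := cos_span_lin d (m1 _ hp) (m2 _ hp).
by congr cos_span; apply/funext => x; rewrite mulrDl mulrA.
Qed.

Lemma multiplier_exp i h m : multiplier i h -> multiplier i (fun t => h t ^+ m).
Proof.
move=> mh p hp; elim: m => [|m IH].
  by under eq_fun do rewrite expr0 mul1r.
by under eq_fun do rewrite exprS -mulrA; exact: mh.
Qed.

Lemma multiplier_prod_fun s : (forall j, multiplier j (s j)) -> cos_span (prod_fun s).
Proof.
move=> hs; rewrite /prod_fun; elim: (index_enum _) => [|j r IH].
  by under eq_fun do rewrite big_nil; exact: cos_span1.
by under eq_fun do rewrite big_cons; exact: hs.
Qed.

(** The cosine of half a period per side is strictly decreasing along the side, so a threshold on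
    its value is a threshold on [t]. *)
Lemma step_multiplier i (c : R) : exists S : nat -> R -> R,
  [/\ forall N, multiplier i (S N),
      forall N t, a ord0 i < t < b ord0 i -> `|S N t| <= 1 &
      forall t, a ord0 i < t < b ord0 i -> S N t @[N --> \oo] --> ((c < t)%R%:R : R)].
Proof.
have [ca|ac] := leP c (a ord0 i).
  exists (fun _ _ => 1); split; first by move=> _; exact: multiplier_cst.
    by move=> _ t _; rewrite normr1.
  move=> t /andP[at_ _]; rewrite (le_lt_trans ca at_); exact: cvg_cst.
have [bc|cb] := leP (b ord0 i) c.
  exists (fun _ _ => 0); split; first by move=> _; exact: multiplier_cst.
    by move=> _ t _; rewrite normr0.
  move=> t /andP[_ tb]; rewrite ltNge (ltW (lt_le_trans tb bc)); exact: cvg_cst.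
have L0 := side_gt0 ab i.
pose w := pi / side i.
have w0 : 0 < w by rewrite divr_gt0// pi_gt0.
have wL : w * side i = pi by rewrite mulfVK// gt_eqF.
have rng t : a ord0 i <= t <= b ord0 i -> w * (t - a ord0 i) \in `[0, pi].
  move=> tab; rewrite in_itv/= mulr_ge0 ?(ltW w0)//=; last lra.
  by rewrite -wL ler_pM2l// /side; lra.
have mono s t : a ord0 i <= s <= b ord0 i -> a ord0 i <= t <= b ord0 i ->
    (wave w (a ord0 i) t < wave w (a ord0 i) s) = (s < t).
  by move=> hs ht; rewrite !waveE ltr_cos ?rng// ltr_pM2l// ltrD2r.
pose y0 := wave w (a ord0 i) c.
have y0N1 : 0 < 1 + y0.
  have : wave w (a ord0 i) (b ord0 i) < y0 by rewrite mono//; lra.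
  by rewrite waveE -/(side i) wL cospi; lra.
(* The function [p] is [sg] times 1 plus the cosine. The scale [sg] makes [K * p] equal to 1 exactly
   at [c], and [K] is large enough for [p] to stay below 1. Both need [1 + y0 > 0], that is, [c]
   strictly left of the right end. *)
pose K := (Num.bound (2 / (1 + y0))).+1.
have K0 : 0 < K%:R :> R by rewrite ltr0n.
have hK : 2 <= K%:R * (1 + y0).
  rewrite -ler_pdivrMr//; apply: ltW; apply: lt_trans (archi_boundP _) _.
    by rewrite divr_ge0// ltW.
  by rewrite ltr_nat.
pose sg := (K%:R * (1 + y0))^-1.
have sg0 : 0 < sg by rewrite invr_gt0 mulr_gt0.
have sgK : sg * (K%:R * (1 + y0)) = 1 by rewrite mulVf// gt_eqF// mulr_gt0.
pose p t := sg + sg * wave w (a ord0 i) t.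
have p01 t : 0 <= p t <= 1.
  have c1 := cos_le1 (w * t + - (w * a ord0 i)).
  have c2 := cos_geN1 (w * t + - (w * a ord0 i)).
  have s2 : sg * 2 <= 1 by rewrite -[X in _ <= X]sgK ler_pM2l.
  rewrite /p /wave; apply/andP; split; nra.
exists (fun N t => threshold K N (p t)); split.
- move=> N; rewrite /threshold.
  have := @multiplier_lin i (-1) _ _ (@multiplier_cst i 1)
    (multiplier_exp N (multiplier_lin sg (@multiplier_cst i sg) (@multiplier_cos i))).
  move=> /(multiplier_exp (N * K ^ N)%N); congr (multiplier i).
  by apply/funext => t; rewrite mulN1r.
- by move=> N t _; exact: threshold_le1.
- move=> t tab; rewrite (_ : (c < t) = (K%:R * p t < 1)); first exact: threshold_cvg.
  rewrite -(mono c t) -/y0; [|lra..].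
  have -> : K%:R * p t = sg * (K%:R * (1 + wave w (a ord0 i) t)) by rewrite /p; ring.
  by rewrite -[X in _ = (_ < X)]sgK ltr_pM2l// ltr_pM2l// ltrD2l.
Qed.

Lemma cos_span_continuous p : cos_span p -> continuous p.
Proof.
move: p; apply: cos_span_ind; first exact: cst_continuous.
move=> d p k cp; apply: continuous_rVD => //; apply: continuous_rVM.
  exact: cst_continuous.
by apply: smooth_continuous; exact: smooth_cos_mode.
Qed.

Lemma cos_span_dense f : square_integrable lambda Omega f ->
  L2_closure lambda Omega cos_span f.
Proof.
apply: (L2_closure_dense mO fO _ cos_span1 _ (@orthants_generate R n.+1)
  (@orthants_setI R n.+1)).
- by move=> p /cos_span_continuous; exact: continuous_box_sqint.
- by move=> *; exact: cos_span_lin.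
- move=> _ [c ->].
  have /choice[S hS] := fun i => step_multiplier i (c i).
  have spS N : cos_span (prod_fun (fun j => S j N)).
    by apply: multiplier_prod_fun => j; have [h _ _] := hS j; exact: h.
  have mS N : measurable_fun Omega (prod_fun (fun j => S j N)).
    apply: measurable_funTS; apply: continuous_measurable_rV.
    exact: cos_span_continuous.
  have mA : measurable (orthant c).
    by rewrite orthants_generate; apply: sub_sigma_algebra; exists c.
  have h := bounded_cvg_sqr mO fO (C := 1) mS
    (measurable_indic mA : measurable_fun Omega (\1_(orthant c) : _ -> R)).
  move=> e e0.
  have {}h : \int[lambda]_(x in Omega) (\1_(orthant c) x - prod_fun (fun j => S j N) x) ^+ 2
      @[N --> \oo] --> (0 : R).
    apply: h.
    + move=> N x Ox; have := @prod_fun_le R n (fun j => S j N) (fun=> 1) x.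
      rewrite prodr_const expr1n; apply => j.
      by have [_ h _] := hS j; apply: h; exact: Ox.
    + move=> x Ox.
      have := @prod_fun_cvg R n (fun N j => S j N) (fun j t => (c j < t)%R%:R) x.
      rewrite (_ : prod_fun (fun j t => (c j < t)%R%:R) x = \1_(orthant c) x).
        by apply => j; have [_ _ h] := hS j; apply: h; exact: Ox.
      rewrite /prod_fun indicE; have [xc|nxc] := pselect (orthant c x).
        by rewrite mem_set// big1// => j _; rewrite xc.
      rewrite memNset//; move/existsNP : nxc => [j /negP/negbTE cj].
      by rewrite (bigD1 j)//= cj mul0r.
  have /cvgrPdist_lt/(_ e e0)[N _ /(_ N (leqnn _))/=] := h.
  rewrite sub0r normrN => hN; exists (prod_fun (fun j => S j N)) => //.
  exact: le_lt_trans (ler_norm _) hN.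
Qed.

End cosine_density.

(** * The Poincare inequality and Green's formula *)

Section poincare.
Context (R : realType) (n : nat) (a b : 'rV[R]_n.+1).
Hypothesis ab : forall i, a ord0 i < b ord0 i.
Local Notation Omega := (box a b).
Local Notation lambda := (@lebesgue_rV R n.+1).
Local Notation one := (H1_one ab).
Local Notation cosH := (cosH ab).
Local Notation cos_sum := (cos_sum ab).
Local Notation cos_eigenvalue := (cos_eigenvalue a b).
Implicit Types (k : {ffun 'I_n.+1 -> nat}) (i j : 'I_n.+1) (u v w z : H1 Omega).

Lemma dot_cosH0 u : dot u (cosH [ffun=> 0%N]) = dot u one.
Proof. by apply: eq_Rintegral => x _; rewrite /= cos_mode0. Qed.

Lemma cos_sum_approx u e : 0 < e ->
  exists r c, uniq r /\ dot (H1_lin (-1) u (cos_sum r c)) (H1_lin (-1) u (cos_sum r c)) < e.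
Proof.
move=> e0; have [p [r [c [ur ->]]] h] := cos_span_dense ab (H1_funL2 u) e0.
exists r, c; split=> //; apply: le_lt_trans h; rewrite le_eqVlt; apply/orP; left; apply/eqP.
by apply: eq_Rintegral => x _; rewrite /= cos_sumE; ring.
Qed.

Lemma smooth_cos_sum r c : smooth (cos_sum r c) /\
  forall i, grad (cos_sum r c) i = partial i (cos_sum r c).
Proof.
elim: r => [|k r [sp gp]]; first by split; [exact: smooth_cst|].
have sk := smooth_cos_mode a b k.
split; first exact: smooth_lin sp sk.
move=> i; apply/funext => x /=; rewrite gp.
by have [_ ->] := partial_lin (c k) (smooth_derivable i x sp) (smooth_derivable i x sk).
Qed.

Lemma dot_quad t u v : dot (H1_lin t u v) (H1_lin t u v) =
  dot u u + 2 * t * dot u v + t ^+ 2 * dot v v.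
Proof. by rewrite dot_linl !dot_linr (dotC v u); ring. Qed.

Lemma dirichlet_quad t u v : dirichlet (H1_lin t u v) (H1_lin t u v) =
  dirichlet u u + 2 * t * dirichlet u v + t ^+ 2 * dirichlet v v.
Proof. by rewrite dirichlet_linl !dirichlet_linr (dirichletC v u); ring. Qed.

Lemma dot_sub u v : dot (H1_lin (-1) u v) (H1_lin (-1) u v) =
  dot u u - 2 * dot u v + dot v v.
Proof. by rewrite dot_quad; ring. Qed.

Lemma dirichlet_sub u v : dirichlet (H1_lin (-1) u v) (H1_lin (-1) u v) =
  dirichlet u u - 2 * dirichlet u v + dirichlet v v.
Proof. by rewrite dirichlet_quad; ring. Qed.

Lemma cosH_complete u : (forall k, dot u (cosH k) = 0) -> dot u u = 0.
Proof.
move=> h; apply/eqP; rewrite eq_le dot_ge0 andbT; apply/ler_addgt0Pl => e e0.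
have [r [c [_]]] := cos_sum_approx u e0.
rewrite dot_sub dot_cos_sum big1 ?mulr0 ?subr0; last by move=> k _; rewrite h mulr0.
by have := dot_ge0 (cos_sum r c); lra.
Qed.

(** An expansion of D(z) in modes would require convergence of gradients. Instead, for a cosine sum
    p close to z in L^2, let q be the sum with coefficients [d]. Then D(z, q) = mu <z, p> and D(q)
    <= mu |p|^2, so D(z - q) >= 0 yields D(z) >= 2 mu <z, p> - mu |p|^2 = mu |z|^2 - mu |z -
    p|^2. *)
Lemma poincare (mu : R) z : 0 < mu ->
  (forall k, k != [ffun=> 0%N] -> mu <= cos_eigenvalue k) -> dot z one = 0 ->
  mu * dot z z <= dirichlet z z.
Proof.
move=> mu0 hmu z1; apply/ler_addgt0Pl => e e0.
have [r [c [ur]]] := cos_sum_approx z (divr_gt0 e0 mu0).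
rewrite dot_sub ltr_pdivlMr// => hp.
(* [d] inverts the Laplacian, scaled by [mu], on the span; at [k = 0], where
   the eigenvalue is [0], division by zero gives [0]. *)
pose d k := mu * c k / cos_eigenvalue k.
have := dirichlet_ge0 (H1_lin (-1) z (cos_sum r d)).
rewrite dirichlet_sub.
have -> : dirichlet z (cos_sum r d) = mu * dot z (cos_sum r c).
  rewrite dirichlet_cos_sum dot_cos_sum mulr_sumr; apply: eq_bigr => k _.
  have [->|k0] := eqVneq k [ffun=> 0%N]; first by rewrite dot_cosH0 z1 !mulr0.
  have l0 : cos_eigenvalue k != 0 by rewrite gt_eqF// (lt_le_trans mu0)// hmu.
  by rewrite /d; field.
have : dirichlet (cos_sum r d) (cos_sum r d) <= mu * dot (cos_sum r c) (cos_sum r c).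
  rewrite dirichlet_cos_sum_diag// dot_cos_sum_diag// mulr_sumr.
  apply: ler_sum => k _; rewrite [leRHS]mulrA; apply: ler_wpM2r; first exact: dot_ge0.
  have c2 := sqr_ge0 (c k).
  have [->|k0] := eqVneq k [ffun=> 0%N].
    have -> : cos_eigenvalue [ffun=> 0%N] = 0.
      by rewrite /cos_eigenvalue big1// => i _; rewrite /freq ffunE mulr0 mul0r expr0n.
    by rewrite mul0r mulr_ge0 ?(ltW mu0)// -expr2 sqr_ge0.
  have hk := hmu k k0.
  have l0 : 0 < cos_eigenvalue k by rewrite (lt_le_trans mu0).
  have -> : cos_eigenvalue k * (d k * d k) = mu * (c k * c k) * (mu / cos_eigenvalue k).
    by rewrite /d; field; rewrite gt_eqF.
  rewrite -[leRHS]mulr1 ler_wpM2l//; first by rewrite mulr_ge0 ?(ltW mu0)// -expr2 sqr_ge0.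
  by rewrite ler_pdivrMr// mul1r.
by nra.
Qed.

End poincare.

(** * Green's formula for psi *)

Section boundary_green.
Context (R : realType) (n : nat) (a b : 'rV[R]_n.+1).
Hypothesis ab : forall i, a ord0 i < b ord0 i.
Local Notation Omega := (box a b).
Local Notation lambda := (@lebesgue_rV R n.+1).
Local Notation sigma := (surface_measure a b).
Local Notation side := (side a b).
Implicit Types (i j : 'I_n.+1) (u v w : H1 Omega).

Let mO : measurable Omega := measurable_box a b.

Variable om : R.
Hypothesis om_gt0 : 0 < om.
Hypothesis om_side : forall i, om * side i <= pi.

(* [psi] solves [- Delta psi = om^2 psi] with normal derivative 1 on every
   face of the box. *)
Definition psi_coef i := - (om * sin (om * side i / 2))^-1.

Definition psi_term i : 'rV[R]_n.+1 -> R :=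
  prod_fun (fun j => if j == i then wave om ((a ord0 i + b ord0 i) / 2) else fun=> 1).

Lemma psi_termE i x : psi_term i x = wave om ((a ord0 i + b ord0 i) / 2) (x ord0 i).
Proof.
rewrite /psi_term /prod_fun (bigD1 i)//= eqxx big1 ?mulr1// => j /negbTE ->.
by [].
Qed.

Definition psi x := \sum_i psi_coef i * psi_term i x.

Lemma smooth_sum (f : 'I_n.+1 -> 'rV[R]_n.+1 -> R) (c : 'I_n.+1 -> R) :
  (forall i, smooth (f i)) -> smooth (fun x => \sum_i c i * f i x).
Proof.
move=> sf; elim: (index_enum _) => [|i r IH].
  by under eq_fun do rewrite big_nil; exact: smooth_cst.
by under eq_fun do rewrite big_cons addrC; exact: smooth_lin.
Qed.

Lemma smooth_psi : smooth psi.
Proof.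
apply: smooth_sum => i; apply: smooth_prod_fun => j; case: ifP => _.
  exact: smooth1_wave.
exact: smooth1_cst.
Qed.

Lemma psi_line i t (y : 'rV[R]_n) : psi (hyperplane_point i t y) =
  \sum_k psi_coef (lift i k) * wave om ((a ord0 (lift i k) + b ord0 (lift i k)) / 2) (y ord0 k)
  + psi_coef i * wave om ((a ord0 i + b ord0 i) / 2) t.
Proof.
rewrite /psi (bigD1_ord i)//= addrC; congr (_ + _); last first.
  by rewrite psi_termE hyperplane_point_eq.
by apply: eq_bigr => k _; rewrite psi_termE hyperplane_point_lift.
Qed.

Lemma partial_psi i : partial i psi = fun x =>
  psi_coef i * derive1 (wave om ((a ord0 i + b ord0 i) / 2)) (x ord0 i).
Proof.
apply/funext => x; rewrite -[x in LHS](hyperplane_pointK i) partial_lineE.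
set y := \row_k _; set A := \sum_k psi_coef (lift i k) *
  wave om ((a ord0 (lift i k) + b ord0 (lift i k)) / 2) (y ord0 k).
under eq_fun do rewrite psi_line -/A.
have sw := smooth1_wave om ((a ord0 i + b ord0 i) / 2).
have h := is_derive_smooth1 (x ord0 i) sw.
have := is_deriveD (is_derive_cst A (x ord0 i) 1) (is_deriveZ (psi_coef i) h).
by rewrite add0r => -[_ e]; rewrite [LHS]derive1E; exact: e.
Qed.

Lemma partial_partial_psi i : partial i (partial i psi) = fun x =>
  - om ^+ 2 * (psi_coef i * psi_term i x).
Proof.
apply/funext => x; rewrite partial_psi -[x in LHS](hyperplane_pointK i) partial_lineE.
under eq_fun do rewrite hyperplane_point_eq.
have sw := smooth1_wave om ((a ord0 i + b ord0 i) / 2).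
rewrite derive1_scale; last exact: smooth1_derive.
by rewrite derive1_derive1_wave psi_termE; ring.
Qed.

Lemma sin_half_gt0 i : 0 < sin (om * side i / 2).
Proof.
have L0 := side_gt0 ab i; have := om_side i.
have : 0 < om * side i by rewrite mulr_gt0.
by have := @pi_gt0 R; move=> h1 h2 h3; apply: sin_gt0_pi; lra.
Qed.

Lemma normal_derivative_psi i (y : 'rV[R]_n) :
  partial i psi (hyperplane_point i (b ord0 i) y) = 1 /\
  partial i psi (hyperplane_point i (a ord0 i) y) = -1.
Proof.
have s0 := sin_half_gt0 i.
rewrite partial_psi !hyperplane_point_eq !derive1_wave /psi_coef; split.
  have -> : om * (b ord0 i - (a ord0 i + b ord0 i) / 2) = om * side i / 2.
    by rewrite /side; lra.
  by field; rewrite !gt_eqF.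
have -> : om * (a ord0 i - (a ord0 i + b ord0 i) / 2) = - (om * side i / 2).
  by rewrite /side; lra.
by rewrite sinN; field; rewrite !gt_eqF.
Qed.

Definition psiH : H1 Omega := H1_smooth ab smooth_psi.

(** The divergence theorem for [f * partial i psi], summed over [i]. Opposite faces enter with
    opposite signs, as does the i-th partial derivative of [psi] on them, so both contribute plus
    the integral of [f]. *)
Lemma green_smooth f : smooth f ->
  \sum_i \int[lambda]_(x in Omega) (partial i f x * partial i psi x) =
  om ^+ 2 * \int[lambda]_(x in Omega) (f x * psi x) + \int[sigma]_x f x.
Proof.
move=> sf; rewrite Rintegral_surface; last exact: smooth_continuous.
have cps := smooth_continuous smooth_psi.
have ct i : continuous (psi_term i).
  apply: continuous_prod_fun => j; apply: smooth1_continuous; case: ifP => _.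
    exact: smooth1_wave.
  exact: smooth1_cst.
have cf := smooth_continuous sf.
have intM (p q : 'rV[R]_n.+1 -> R) : continuous p -> continuous q ->
    lambda.-integrable Omega (EFin \o (fun x => p x * q x)).
  by move=> cp cq; apply: sqint_integrableM => //; exact: continuous_box_sqint.
have -> : \int[lambda]_(x in Omega) (f x * psi x) =
    \sum_i psi_coef i * \int[lambda]_(x in Omega) (f x * psi_term i x).
  rewrite /psi; elim: (index_enum _) => [|j r IH].
    under eq_Rintegral do rewrite big_nil mulr0.
    by rewrite big_nil Rintegral_cst// mul0r.
  rewrite big_cons -IH -RintegralZl//; last exact: intM.
  rewrite -RintegralD//.
  - by apply: eq_Rintegral => x _; rewrite big_cons; ring.
  - rewrite (_ : (fun x => _) = fun x => (psi_coef j * f x) * psi_term j x).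
      by apply: intM => //; apply: continuous_rVM => //; exact: cst_continuous.
    by apply/funext => x; rewrite mulrA.
  - apply: intM => //; elim: r {IH} => [|k r IH].
      by under eq_fun do rewrite big_nil; exact: cst_continuous.
    under eq_fun do rewrite big_cons; apply: continuous_rVD => //.
    by apply: continuous_rVM => //; exact: cst_continuous.
rewrite mulr_sumr -big_split; apply: eq_bigr => i _ /=.
have dF x := @partial_mul R n f (partial i psi) i x (smooth_derivable i x sf)
  (smooth_derivable i x (smooth_partial i smooth_psi)).
pose F x := f x * partial i psi x.
have cdf := smooth_partial_continuous i sf.
have cdps := smooth_partial_continuous i smooth_psi.
have cddps := smooth_partial_continuous i (smooth_partial i smooth_psi).
have pF : partial i F = fun x => f x * partial i (partial i psi) x +
    partial i psi x * partial i f x.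
  by apply/funext => x; have [] := dF x.
have cF : continuous (partial i F).
  by rewrite pF; apply: continuous_rVD; exact: continuous_rVM.
have := divergence_box ab (fun x => (dF x).1) cF.
have -> : (fun y => F (hyperplane_point i (b ord0 i) y) -
    F (hyperplane_point i (a ord0 i) y)) =
    fun y => f (hyperplane_point i (a ord0 i) y) + f (hyperplane_point i (b ord0 i) y).
  by apply/funext => y; rewrite /F; have [-> ->] := normal_derivative_psi i y; ring.
have mF := @measurable_face_box R n.+1 a b i.
rewrite RintegralD//; [|exact: continuous_face_integrable..].
move=> <-; rewrite pF RintegralD; [|exact: mO|exact: intM|exact: intM].
rewrite (RintegralC _ _ (partial i f)) partial_partial_psi.
have -> : \int[lambda]_(x in Omega) (f x * (- om ^+ 2 * (psi_coef i * psi_term i x))) =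
    - om ^+ 2 * psi_coef i * \int[lambda]_(x in Omega) (f x * psi_term i x).
  rewrite -RintegralZl//; last exact: intM.
  by apply: eq_Rintegral => x _; ring.
by ring.
Qed.

End boundary_green.

Section square_integrable_limits.
Context d (T : measurableType d) (R : realType).
Context (mu : {measure set T -> \bar R}) (D : set T).
Hypothesis mD : measurable D.
Local Notation sqint := (square_integrable mu D).
Local Notation RI f := (\int[mu]_(x in D) f x).

Lemma L2_cvg_dot (f_ : nat -> T -> R) (f g : T -> R) :
  (forall k, sqint (f_ k)) -> sqint f -> sqint g ->
  RI (fun x => (f_ k x - f x) ^+ 2) @[k --> \oo] --> (0 : R) ->
  RI (fun x => f_ k x * g x) @[k --> \oo] --> RI (fun x => f x * g x).
Proof.
move=> sf_ sf sg h.
pose G := RI (fun x => g x ^+ 2).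
have G0 : 0 <= G by apply: Rintegral_ge0 => x _; exact: sqr_ge0.
apply/cvgrPdist_lt => e e0.
(* The [+ 1] keeps the denominator positive when [g] is zero almost everywhere. *)
have d0 : 0 < e ^+ 2 / (G + 1) by rewrite divr_gt0 ?exprn_gt0//; lra.
have /cvgrPdist_lt/(_ _ d0)[N _ hN] := h.
exists N => // k /= Nk; have {hN} := hN k Nk; rewrite sub0r normrN => hk.
have := Rintegral_cauchy_schwarz mD (sqintB mD (sf_ k) sf) sg.
rewrite RintegralBM// -/G; set z := RI (fun x => (f_ k x - f x) ^+ 2) in hk * => cs.
have z0 : 0 <= z by apply: Rintegral_ge0 => t _; exact: sqr_ge0.
rewrite (ger0_norm z0) ltr_pdivlMr in hk; last by lra.
rewrite distrC -(@ltr_pXn2r _ 2) ?nnegrE ?(ltW e0)//.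
rewrite real_normK ?num_real//; apply: le_lt_trans cs _.
by apply: le_lt_trans hk; rewrite ler_wpM2l//; lra.
Qed.

Lemma Rintegral_gt0 (g : T -> R) : mu.-integrable D (EFin \o g) ->
  (forall x, D x -> 0 < g x) -> (0 < mu D)%E -> 0 < RI g.
Proof.
move=> ig g0 muD; rewrite lt_def Rintegral_ge0 ?andbT; last by move=> x /g0/ltW.
apply/negP => /eqP RI0; have /integrableP[mg _] := ig.
have : (\int[mu]_(x in D) `|(g x)%:E| = 0)%E.
  transitivity (\int[mu]_(x in D) (g x)%:E)%E.
    by apply: eq_integral => x /[!inE] Dx; rewrite gee0_abs// lee_fin ltW// g0.
  by rewrite -[LHS]fineK ?integrable_fin_num// -[X in X%:E]/(RI g) RI0.
move=> /(ae_eq_integral_abs mu mD mg).1 => -[N [mN N0 subN]].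
have : (mu D <= mu N)%E.
  apply: le_measure; rewrite ?inE//; apply: subset_trans subN => x Dx /= h.
  by have [/eqP] := h Dx; rewrite gt_eqF// g0.
by rewrite N0 leNgt muD.
Qed.

End square_integrable_limits.

(** * Green's formula for traces, and the sign of psi *)

Section traces.
Context (R : realType) (n : nat) (a b : 'rV[R]_n.+1).
Hypothesis ab : forall i, a ord0 i < b ord0 i.
Local Notation Omega := (box a b).
Local Notation lambda := (@lebesgue_rV R n.+1).
Local Notation sigma := (surface_measure a b).
Local Notation side := (side a b).
Implicit Types (i j : 'I_n.+1) (u v w : H1 Omega).

Let mO : measurable Omega := measurable_box a b.
Let fO : (lambda Omega < +oo)%E := lebesgue_rV_box_lty a b.

(** The constant sequence is an approximation. Equality is asked only in the L^2 sense, since an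
    eigenfunction is identified with a cosine sum only up to a null set. *)
Lemma is_trace_ae_eq u f : smooth f ->
  \int[lambda]_(x in Omega) (f x - u x) ^+ 2 = 0 ->
  (forall i, \int[lambda]_(x in Omega) (partial i f x - grad u i x) ^+ 2 = 0) ->
  is_trace u f.
Proof.
move=> sf h0 h1; split.
  by apply: continuous_surface_sqint; exact: smooth_continuous.
exists (fun=> f); split=> // [|i|]; rewrite ?h0 ?h1; do ?exact: cvg_cst.
rewrite (_ : (fun=> _) = fun=> (0 : R)); first exact: cvg_cst.
apply/funext => _; under eq_Rintegral do rewrite subrr expr0n.
by rewrite Rintegral_cst// mul0r.
Qed.

Lemma is_trace_smooth f (sf : smooth f) : is_trace (H1_smooth ab sf) f.
Proof.
by apply: is_trace_ae_eq => // [|i]; under eq_Rintegral do rewrite subrr expr0n;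
  rewrite Rintegral_cst// mul0r.
Qed.

Variable om : R.
Hypothesis om_gt0 : 0 < om.
Hypothesis om_side : forall i, om * side i <= pi.
Local Notation psi := (psi a b om).
Local Notation psiH := (psiH ab om).

(** The approximating functions that define a trace converge in H^1 and in L^2 of the boundary, so
    every term of [green_smooth] passes to the limit. *)
Lemma green_trace u T : is_trace u T ->
  dirichlet u psiH = om ^+ 2 * dot u psiH + \int[sigma]_x T x.
Proof.
move=> [sT [f [sf fu dfu fT]]].
have csf k := continuous_box_sqint a b (smooth_continuous (sf k)).
have csdf k i := continuous_box_sqint a b (smooth_partial_continuous i (sf k)).
have sps := smooth_psi a b om.
have l1 := L2_cvg_dot mO csf (H1_funL2 u)
  (continuous_box_sqint a b (smooth_continuous sps)) fu.
have l2 i := L2_cvg_dot mO (fun k => csdf k i) (gradL2 u i)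
  (continuous_box_sqint a b (smooth_partial_continuous i sps)) (dfu i).
have l3 : \int[sigma]_x f k x @[k --> \oo] --> \int[sigma]_x T x.
  have := L2_cvg_dot measurableT
    (fun k => continuous_surface_sqint a b (smooth_continuous (sf k))) sT
    (sqint_cst measurableT (surface_measure_lty a b) 1) fT.
  rewrite (@eq_Rintegral _ _ _ _ _ T); last by move=> x _; rewrite mulr1.
  rewrite (_ : (fun k => \int[sigma]_x (f k x * 1)) = fun k => \int[sigma]_x f k x)//.
  by apply/funext => k; apply: eq_Rintegral => x _; rewrite mulr1.
have l4 : \sum_i \int[lambda]_(x in Omega) (partial i (f k) x * partial i psi x)
    @[k --> \oo] --> dirichlet u psiH.
  rewrite /dirichlet; elim: (index_enum _) => [|i r IH].
    rewrite big_nil (_ : (fun k => _) = fun=> 0); first exact: cvg_cst.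
    by apply/funext => k; rewrite big_nil.
  rewrite big_cons (_ : (fun k => _) = fun k =>
      \int[lambda]_(x in Omega) (partial i (f k) x * partial i psi x) +
      \sum_(j <- r) \int[lambda]_(x in Omega) (partial j (f k) x * partial j psi x)).
    by apply: cvgD IH; exact: l2.
  by apply/funext => k; rewrite big_cons.
have l5 : om ^+ 2 * \int[lambda]_(x in Omega) (f k x * psi x) + \int[sigma]_x f k x
    @[k --> \oo] --> om ^+ 2 * dot u psiH + \int[sigma]_x T x.
  by apply: cvgD => //; apply: cvgMr.
move: l4; have -> : (fun k => \sum_i \int[lambda]_(x in Omega)
    (partial i (f k) x * partial i psi x)) =
    (fun k => om ^+ 2 * \int[lambda]_(x in Omega) (f k x * psi x) + \int[sigma]_x f k x).
  by apply/funext => k; rewrite (green_smooth ab om_gt0 om_side (sf k)).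
by move=> l4; exact: cvg_unique l4 l5.
Qed.

Lemma psi_term_half i t : a ord0 i <= t <= b ord0 i ->
  0 <= wave om ((a ord0 i + b ord0 i) / 2) t.
Proof.
move=> tab; rewrite waveE; apply: cos_ge0_pihalf.
have h1 : 0 <= om * (b ord0 i - t) by rewrite mulr_ge0 ?(ltW om_gt0)//; lra.
have h2 : 0 <= om * (t - a ord0 i) by rewrite mulr_ge0 ?(ltW om_gt0)//; lra.
by have := om_side i; rewrite /side; lra.
Qed.

Lemma psi_term_half_gt0 i t : a ord0 i < t < b ord0 i ->
  0 < wave om ((a ord0 i + b ord0 i) / 2) t.
Proof.
move=> tab; rewrite waveE; apply: cos_gt0_pihalf.
have h1 : 0 < om * (b ord0 i - t) by rewrite mulr_gt0//; lra.
have h2 : 0 < om * (t - a ord0 i) by rewrite mulr_gt0//; lra.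
by have := om_side i; rewrite /side; lra.
Qed.

Lemma psi_coef_lt0 i : psi_coef a b om i < 0.
Proof.
rewrite /psi_coef oppr_lt0 invr_gt0 mulr_gt0//.
exact: sin_half_gt0.
Qed.

(** All terms are nonpositive, but one may vanish at the ends of a side with [om * side i = pi]; one
    coordinate interior to its side makes the sum strictly negative. *)
Lemma psi_lt0 (x : 'rV[R]_n.+1) : (forall j, a ord0 j <= x ord0 j <= b ord0 j) ->
  (exists j, a ord0 j < x ord0 j < b ord0 j) -> psi x < 0.
Proof.
move=> hx [j hj]; rewrite /psi (bigD1 j)//=.
have h1 : psi_coef a b om j * psi_term a b om j x < 0.
  by rewrite psi_termE nmulr_rlt0 ?psi_coef_lt0 ?psi_term_half_gt0.
apply: (@lt_le_trans _ _ (0 + \sum_(i | i != j) psi_coef a b om i * psi_term a b om i x)).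
  by rewrite ltrD2r.
rewrite add0r; apply: sumr_le0 => i _.
by rewrite psi_termE mulr_le0_ge0 ?psi_term_half// ltW// psi_coef_lt0.
Qed.

Lemma integral_psi_lt0 : dot psiH (H1_one ab) < 0.
Proof.
rewrite dot_one -oppr_gt0.
have cps := smooth_continuous (smooth_psi a b om).
have ips := sqint_integrable mO fO (continuous_box_sqint a b cps).
have -> : - (\int[lambda]_(x in Omega) psiH x) =
    \int[lambda]_(x in Omega) (-1 * psi x).
  by rewrite RintegralZl// mulN1r.
apply: Rintegral_gt0 => //.
- apply: sqint_integrable => //; apply: sqintZ => //.
  exact: continuous_box_sqint.
- move=> x Ox; rewrite mulN1r oppr_gt0 psi_lt0//; last by exists ord0; exact: Ox.
  by move=> j; have /andP[h1 h2] := Ox j; rewrite !ltW.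
- have /= e := lebesgue_rV_box (fun i => ltW (ab i)).
  rewrite -[ltRHS]/(cons_measure (lebesgue_rV n) Omega) e lte_fin.
  by apply: prodr_gt0 => i _; rewrite subr_gt0.
Qed.

Hypothesis n_gt0 : (0 < n)%N.

(** A face of a box of dimension at least 2 has a free coordinate, interior to its side, to which
    [psi_lt0] applies. *)
Lemma surface_psi_lt0 : \int[sigma]_x psi x < 0.
Proof.
have cps := smooth_continuous (smooth_psi a b om).
rewrite Rintegral_surface// -oppr_gt0 -sumrN.
have mF i := @measurable_face_box R n.+1 a b i.
have h i c : a ord0 i <= c <= b ord0 i ->
    \int[lebesgue_rV n]_(y in face_box a b i) psi (hyperplane_point i c y) < 0.
  move=> cab; rewrite -oppr_gt0 -mulN1r -RintegralZl//; last exact: continuous_face_integrable.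
  apply: Rintegral_gt0 => //.
  - have ck : continuous (fun x => -1 * psi x).
      by apply: continuous_rVM => //; exact: cst_continuous.
    exact: (continuous_face_integrable a b i c ck).
  - move=> y yF; rewrite mulN1r oppr_gt0 psi_lt0//.
      move=> j; case: (unliftP i j) => [k|] ->; rewrite ?hyperplane_point_eq//.
      by rewrite hyperplane_point_lift; have /andP[h1 h2] := yF k; rewrite !ltW.
    exists (lift i (Ordinal n_gt0)); rewrite hyperplane_point_lift; exact: yF.
  - have -> : face_box a b i =
        box (\row_k a ord0 (lift i k)) (\row_k b ord0 (lift i k)).
      by apply/seteqP; split=> y hy k; have := hy k; rewrite !mxE.
    rewrite [ltRHS]lebesgue_rV_box; last by move=> k; rewrite !mxE ltW.
    by rewrite lte_fin; apply: prodr_gt0 => k _; rewrite !mxE subr_gt0.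
rewrite big_ord_recl; apply: ltr_wpDr.
  apply: sumr_ge0 => i _; rewrite oppr_ge0 ltW// -[ltRHS]addr0 ltrD// h// ?lexx ?ltW// ab.
by rewrite oppr_gt0 -[ltRHS]addr0 ltrD// h// ?lexx ?ltW// ab.
Qed.

End traces.

(** * The two spectral problems on a box *)

Section box_spectrum.
Context (R : realType) (n : nat) (a b : 'rV[R]_n.+1).
Hypothesis ab : forall i, a ord0 i < b ord0 i.
Hypothesis n_gt0 : (0 < n)%N.
Local Notation Omega := (box a b).
Local Notation lambda := (@lebesgue_rV R n.+1).
Local Notation sigma := (surface_measure a b).
Local Notation side := (side a b).
Local Notation freq := (freq a b).
Local Notation one := (H1_one ab).
Local Notation cosH := (cosH ab).
Local Notation cos_sum := (cos_sum ab).
Local Notation cos_eigenvalue := (cos_eigenvalue a b).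
Implicit Types (k : {ffun 'I_n.+1 -> nat}) (i j : 'I_n.+1) (u v w z phi : H1 Omega).

Let mO : measurable Omega := measurable_box a b.

Definition longest : 'I_n.+1 := [arg max_(i > ord0) side i]%O.

Lemma side_longest i : side i <= side longest.
Proof. by rewrite /longest; case: arg_maxP => // j _; apply. Qed.

Let om := pi / side longest.
Let mu := om ^+ 2.

Lemma om_gt0 : 0 < om.
Proof. by rewrite divr_gt0 ?pi_gt0// side_gt0. Qed.

Lemma om_side i : om * side i <= pi.
Proof.
have L0 := side_gt0 ab longest.
by rewrite mulrAC ler_pdivrMr// ler_wpM2l ?pi_ge0 ?side_longest.
Qed.

Lemma mu_gt0 : 0 < mu. Proof. by rewrite exprn_gt0// om_gt0. Qed.

Local Notation psiH := (psiH ab om).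

(** A bound linear in the total degree, from m^2 >= m on integers. It gives the spectral gap, and
    eigenvalue [mu] forces total degree 1. *)
Lemma cos_eigenvalue_ge k : mu * (\sum_i k i)%:R <= cos_eigenvalue k.
Proof.
rewrite natr_sum mulr_sumr; apply: ler_sum => i _.
have L0 := side_gt0 ab i; have o0 := ltW om_gt0.
have h : om * (k i)%:R <= freq k i.
  rewrite /freq ler_pdivlMr// mulrAC; apply: ler_wpM2r => //; exact: om_side.
apply: le_trans (_ : (om * (k i)%:R) ^+ 2 <= _); last first.
  by rewrite lerXn2r// nnegrE; [exact: mulr_ge0|exact: freq_ge0].
rewrite exprMn ler_wpM2l ?sqr_ge0//.
by case: (k i) => [|m]; rewrite ?expr0n// expr2 ler_peMr// ler1n.
Qed.

Lemma mu_le_cos_eigenvalue k : k != [ffun=> 0%N] -> mu <= cos_eigenvalue k.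
Proof.
move=> k0; apply: le_trans (cos_eigenvalue_ge k).
rewrite ler_peMr ?(ltW mu_gt0)// ler1n lt0n; apply: contra k0.
rewrite sum_nat_eq0 => /forallP h; apply/eqP/ffunP => i.
by rewrite ffunE; apply/eqP; have := h i.
Qed.

Definition axis_mode i : {ffun 'I_n.+1 -> nat} := [ffun j => (j == i) : nat].

Lemma cos_eigenvalue_mu_axis k : cos_eigenvalue k = mu -> exists i, k = axis_mode i.
Proof.
move=> hk; have := cos_eigenvalue_ge k; rewrite hk ger_pMr ?mu_gt0//.
rewrite -[leRHS]/(1%:R) ler_nat leq_eqVlt ltnS leqn0 => /orP[/sum_nat_eq1[i [_ ki kj]]|].
  exists i; apply/ffunP => j; rewrite ffunE; case: eqP => [->//|/eqP ji]; exact: kj.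
rewrite sum_nat_eq0 => /forallP h; exfalso; have := mu_gt0.
rewrite -hk /cos_eigenvalue big1 ?ltxx// => i _.
by rewrite /freq (eqP (h i)) mulr0 mul0r expr0n.
Qed.

Definition ground := cosH (axis_mode longest).

Lemma cos_eigenvalue_ground : cos_eigenvalue (axis_mode longest) = mu.
Proof.
rewrite /cos_eigenvalue (bigD1 longest)//= big1 ?addr0 => [|j /negbTE jl].
  by rewrite /freq ffunE eqxx mulr1.
by rewrite /freq ffunE jl mulr0 mul0r expr0n.
Qed.

Lemma dirichlet_ground u : dirichlet u ground = mu * dot u ground.
Proof. by rewrite dirichlet_cosH cos_eigenvalue_ground. Qed.

Lemma axis_mode_wave i j : j != i ->
  wave (freq (axis_mode i) j) (a ord0 j) = fun=> 1.
Proof.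
move=> /negbTE ji; apply/funext => t.
by rewrite waveE /freq ffunE ji mulr0 !mul0r cos0.
Qed.

Lemma prod_fun_axis i (h : R -> R) x :
  prod_fun (update (fun j => wave (freq (axis_mode i) j) (a ord0 j)) i h) x
  = h (x ord0 i).
Proof.
rewrite prod_fun_update big1 ?mul1r// => j _.
by rewrite axis_mode_wave// eq_sym neq_lift.
Qed.

(* Integrating [cos^2 + sin^2 = 1] gives [2 mu |ground|^2 = mu |Omega|]. *)
Lemma dot_ground_gt0 : 0 < dot ground ground.
Proof.
set i := longest; set w := fun j => wave (freq (axis_mode i) j) (a ord0 j).
have fi : freq (axis_mode i) i = om by rewrite /freq ffunE eqxx mulr1.
have e1 x : ground x = cos (om * (x ord0 i - a ord0 i)).
  rewrite -waveE -fi -(prod_fun_axis i); congr (prod_fun _ x).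
  by apply/funext => j; rewrite /update; case: eqP => // ->.
have e2 x : grad ground i x = - om * sin (om * (x ord0 i - a ord0 i)).
  rewrite /= /cos_mode partial_prod_fun; last exact: smooth1_wave.
  by rewrite prod_fun_axis derive1_wave fi.
have := cos_mode_ibp ab ground (axis_mode i) i; rewrite -/ground fi => e3.
have e4 : mu * dot one one = \int[lambda]_(x in Omega)
    (grad ground i x * grad ground i x) + mu * dot ground ground.
  rewrite /dot -!RintegralZl//; try (apply: sqint_integrableM => //; exact: H1_funL2).
  rewrite -RintegralD//.
  - apply: eq_Rintegral => x _; rewrite e1 e2 /= mulr1 mulr1.
    by rewrite -[LHS]mulr1 -(cos2Dsin2 (om * (x ord0 i - a ord0 i))) /mu; ring.
  - by apply: sqint_integrableM => //; exact: gradL2.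
  - have := sqint_integrableM mO (sqintZ mO mu (H1_funL2 ground)) (H1_funL2 ground).
    by apply: eq_integrable => // x _ /=; rewrite mulrA.
have h := mulr_gt0 mu_gt0 (dot_one_one_gt0 ab).
by move: h; rewrite e4 e3 -mulrDl pmulr_rgt0// addr_gt0// mu_gt0.
Qed.

Lemma ground_not_ae_zero : ~ ae_zero Omega ground.
Proof. by move=> h; have := dot_ground_gt0; rewrite (ae_zero_dot _ h) ltxx. Qed.

Lemma dot_ground_one : dot ground one = 0.
Proof.
rewrite -(dot_cosH0 ab) cosH_orthogonal//; apply/eqP => /ffunP /(_ longest).
by rewrite !ffunE eqxx.
Qed.

Lemma box_poincare z : dot z one = 0 -> mu * dot z z <= dirichlet z z.
Proof. by apply: poincare; [exact: mu_gt0|exact: mu_le_cos_eigenvalue]. Qed.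

Definition mean u := dot u one / dot one one.

Definition centered u := H1_lin (- mean u) u one.

Lemma dot_centered_one u : dot (centered u) one = 0.
Proof.
by rewrite dot_linl /mean mulNr divfK ?subrr// gt_eqF// dot_one_one_gt0.
Qed.

Lemma dirichlet_centered u v : dirichlet u (centered v) = dirichlet u v.
Proof. by rewrite dirichlet_linr dirichlet_one mulr0 addr0. Qed.

Lemma neumann_mean_zero w : neumann_eigenspace Omega mu w -> dot w one = 0.
Proof.
move=> /(_ one); rewrite dirichlet_one => /esym/eqP.
by rewrite mulf_eq0 gt_eqF ?mu_gt0//= => /eqP.
Qed.

Lemma neumann_boundary_mean w T : neumann_eigenspace Omega mu w -> is_trace w T ->
  \int[sigma]_x T x = 0.
Proof.
move=> hw tw; have := green_trace ab om_gt0 om_side tw.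
by rewrite hw -/mu; lra.
Qed.

Lemma ground_neumann : neumann_eigenspace Omega mu ground.
Proof. by move=> phi; rewrite dirichletC dirichlet_ground dotC. Qed.

Lemma ground_boundary_mean_zero : boundary_mean_zero ground.
Proof.
have t := is_trace_smooth ab (smooth_cos_mode a b (axis_mode longest)).
by eexists; [exact: t|exact: neumann_boundary_mean ground_neumann t].
Qed.

Lemma boundary_poincare u : boundary_mean_zero u ->
  mu * dot u u <= dirichlet u u /\ (dirichlet u u = mu * dot u u -> dot u one = 0).
Proof.
move=> [T tu T0].
(* The quadratic form [D(u) - mu |u|^2] is orthogonal to [psi] on functions of
   boundary mean zero, and its value at [psi] is the boundary integral of
   [psi]. *)
have p0 := integral_psi_lt0 ab om_gt0 om_side.
have s0 := surface_psi_lt0 ab om_gt0 om_side n_gt0.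
pose t := - dot u one / dot psiH one.
pose z := H1_lin t u psiH.
have z1 : dot z one = 0 by rewrite dot_linl divfK ?subrr// lt_eqF.
have := box_poincare z1.
rewrite dot_quad dirichlet_quad.
have e1 := green_trace ab om_gt0 om_side tu.
have e2 := green_trace ab om_gt0 om_side (is_trace_smooth ab (smooth_psi a b om)).
rewrite e1 T0 addr0 -/mu.
rewrite [dirichlet psiH psiH]e2 -/mu => h.
have {}h : mu * dot u u <= dirichlet u u + t ^+ 2 * \int[sigma]_x (psi a b om) x.
  by move: h; lra.
have ts : t ^+ 2 * \int[sigma]_x (psi a b om) x <= 0.
  by rewrite mulr_ge0_le0 ?sqr_ge0 ?ltW.
split; first lra.
move=> e; have : t ^+ 2 * \int[sigma]_x (psi a b om) x = 0 by lra.
move=> /eqP; rewrite mulf_eq0 (lt_eqF s0) orbF sqrf_eq0 /t mulf_eq0 invr_eq0.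
by rewrite (lt_eqF p0) orbF oppr_eq0 => /eqP.
Qed.

Lemma kappa1_box : kappa1 a b = mu.
Proof.
have lb : lbound [set q | exists u : H1 Omega,
    [/\ ~ ae_zero Omega u, boundary_mean_zero u & q = dirichlet u u / dot u u]] mu.
  move=> _ [u [nu bu ->]]; have [h _] := boundary_poincare bu.
  have d0 : 0 < dot u u.
    by rewrite lt_def dot_ge0 andbT; apply/eqP => /dot_eq0_ae_zero.
  by rewrite ler_pdivlMr.
have ing : [set q | exists u : H1 Omega,
    [/\ ~ ae_zero Omega u, boundary_mean_zero u & q = dirichlet u u / dot u u]] mu.
  exists ground; split; [exact: ground_not_ae_zero|exact: ground_boundary_mean_zero|].
  by rewrite dirichlet_ground mulfK// gt_eqF// dot_ground_gt0.
apply/eqP; rewrite eq_le; apply/andP; split.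
  by apply: ge_inf ing; exists mu.
by apply: lb_le_inf lb; exists mu.
Qed.

(** The centred part z of [v] has D(z) = t |z|^2, while the Poincare inequality gives D(z) >= mu
    |z|^2. *)
Lemma low_eigenfunction_constant v (t : R) : t < mu -> neumann_eigenspace Omega t v ->
  ae_zero Omega (centered v).
Proof.
move=> tmu hv; apply: dot_eq0_ae_zero; apply/eqP; rewrite eq_le dot_ge0 andbT.
have := box_poincare (dot_centered_one v).
rewrite dirichlet_centered dirichletC dirichlet_centered.
rewrite -dirichlet_centered hv.
have -> : dot v (centered v) = dot (centered v) (centered v).
  by rewrite [RHS]dot_linl (dotC one) dot_centered_one mulr0 addr0.
by have := dot_ge0 (centered v); nra.
Qed.

(** Below [mu] every eigenfunction is constant almost everywhere, so no two are independent; at [mu]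
    the constant 1 and [ground] form an independent pair. *)
Lemma neumann_eigenvalue2_box : neumann_eigenvalue Omega 2 = mu.
Proof.
rewrite /neumann_eigenvalue; set S := (X in inf X).
have lb : lbound S mu.
  move=> t [m [v [iv hv]]]; rewrite leNgt; apply/negP => tmu.
  have cst (j : 'I_2) : ae_zero Omega (centered (v j)).
    have [mt hj] := hv j.
    exact: low_eigenfunction_constant (le_lt_trans mt tmu) hj.
  have [m0|m1] := eqVneq (mean (v 0)) 0.
    pose c (j : 'I_2) : R := if j == 0 then 1 else 0.
    have h : ae_zero Omega (fun x => \sum_(j < 2) c j * v j x).
      apply: filterS (cst 0) => x h' Ox; have := h' Ox.
      rewrite /= m0 oppr0 mul0r addr0 big_ord_recl big_ord1 /c /= => ->.
      by rewrite mulr0 mul0r addr0.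
    by have /eqP := iv c h 0; rewrite oner_eq0.
  (* Both functions equal their means almost everywhere, and these coefficients cancel them; the
     second is nonzero in the present case. *)
  pose c (j : 'I_2) : R := if j == 0 then mean (v 1) else - mean (v 0).
  have h : ae_zero Omega (fun x => \sum_(j < 2) c j * v j x).
    apply: filterS2 (cst 0) (cst 1) => x h0 h1 Ox.
    move: (h0 Ox) (h1 Ox); rewrite /= !mulr1 big_ord_recl big_ord1 /c /=.
    rewrite (_ : lift ord0 ord0 = 1); last exact: val_inj.
    rewrite (_ : ord0 = 0) //; nra.
  by have /eqP := iv c h 1; rewrite /c/= oppr_eq0 (negbTE m1).
have inS : S mu.
  exists (fun j : 'I_2 => if j == 0 then 0 else mu),
    (fun j : 'I_2 => if j == 0 then one else ground).
  split.
    move=> c; rewrite /ae_zero => h.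
    (* [H1_lin] scales only its last argument, so [c 0] is written as 1 + (c 0 - 1). *)
    have {}h : ae_zero Omega (H1_lin (c 1) (H1_lin (c 0 - 1) one one) ground).
      apply: filterS h => x h Ox; have := h Ox; rewrite big_ord_recl big_ord1 /=.
      rewrite (_ : lift ord0 ord0 = 1); last exact: val_inj.
      by rewrite (_ : ord0 = 0) // => <-; ring.
    have := ae_zero_dot ground h; have := ae_zero_dot one h.
    rewrite !dot_linl (dotC one ground) dot_ground_one.
    have := dot_one_one_gt0 ab; have := dot_ground_gt0 => g1 g2 e1 e2.
    have c0 : c 0 = 0.
      have : c 0 * dot one one = 0 by lra.
      by move=> /eqP; rewrite mulf_eq0 (gt_eqF g2) orbF => /eqP.
    have c1 : c 1 = 0.
      have : c 1 * dot ground ground = 0 by lra.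
      by move=> /eqP; rewrite mulf_eq0 (gt_eqF g1) orbF => /eqP.
    move=> j; case: (unliftP ord0 j) => [k|] ->.
      by rewrite ord1 -[RHS]c1; congr c; exact: val_inj.
    by rewrite -[RHS]c0; congr c; exact: val_inj.
  move=> j; case: eqP => _; split; rewrite ?(ltW mu_gt0)//.
    by move=> phi; rewrite dirichletC dirichlet_one mul0r.
  exact: ground_neumann.
apply/eqP; rewrite eq_le; apply/andP; split.
  by apply: ge_inf inS; exists mu.
by apply: lb_le_inf lb; exists mu.
Qed.

(** The boundary equation speaks only of test functions that have a trace, whereas the Neumann
    equation concerns all of H^1. The former is therefore used at [w] itself, to see that [w] is a
    minimizer of D - mu |.|^2 among functions of mean zero, and the latter is its Euler-Lagrange
    equation. *)
Lemma boundary_eigenspace_neumann w : boundary_mean_zero_eigenspace a b mu w ->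
  neumann_eigenspace Omega mu w.
Proof.
move=> [bw hw]; have [T tw T0] := bw.
have Qw : dirichlet w w = mu * dot w w by rewrite (hw w T tw) T0 mulr0 addr0.
have w1 := (boundary_poincare bw).2 Qw.
move=> phi.
have h t : 0 <= 0 + 2 * t * (dirichlet w phi - mu * dot w (centered phi)) +
    t ^+ 2 * (dirichlet phi phi - mu * dot (centered phi) (centered phi)).
  have z1 : dot (H1_lin t w (centered phi)) one = 0.
    by rewrite dot_linl w1 dot_centered_one mulr0 addr0.
  have := box_poincare z1.
  rewrite dot_quad dirichlet_quad !dirichlet_centered dirichletC.
  by rewrite (dirichletC _ phi) dirichlet_centered Qw; lra.
(* A nonnegative quadratic polynomial in [t] with zero constant term has zero linear term. *)
have := quadratic_discriminant h; rewrite mul0r => B0.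
have /eqP : (dirichlet w phi - mu * dot w (centered phi)) ^+ 2 = 0.
  by apply/eqP; rewrite eq_le B0 sqr_ge0.
rewrite sqrf_eq0 subr_eq0 => /eqP ->.
by rewrite dot_linr w1 mulr0 addr0.
Qed.

(** Removing from [w] its projection onto finitely many modes leaves [w'] orthogonal to all modes,
    hence zero in L^2. The eigenvalue equation then makes D(w', w') vanish too, so [w] agrees in H^1
    with a smooth cosine sum, whose restriction is a trace. *)
Lemma neumann_trace w : neumann_eigenspace Omega mu w -> exists T, is_trace w T.
Proof.
move=> hw.
(* Modes of shorter sides may be included: their eigenvalue differs from [mu], so [w] is orthogonal
   to them. *)
pose r := map axis_mode (enum 'I_n.+1).
pose c k := dot w (cosH k) / dot (cosH k) (cosH k).
have ur : uniq r.
  rewrite map_inj_uniq ?enum_uniq// => i j /ffunP /(_ i).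
  by rewrite !ffunE eqxx; case: eqP.
pose p := cos_sum r c; pose w' := H1_lin (-1) w p.
have ort k : dot w' (cosH k) = 0.
  rewrite dot_linl mulN1r; have [kr|kr] := boolP (k \in r).
    rewrite dot_cosH_cos_sum// /c; have [N0|N0] := eqVneq (dot (cosH k) (cosH k)) 0.
      rewrite N0 mulr0 subr0 dotC; apply: ae_zero_dot; exact: dot_eq0_ae_zero.
    by rewrite divfK// subrr.
  have -> : dot p (cosH k) = 0.
    rewrite dotC dot_cos_sum big_seq big1// => l lr.
    rewrite cosH_orthogonal ?mulr0//; apply/eqP => kl.
    by move: kr; rewrite kl lr.
  rewrite subr0; have := dirichlet_cosH ab w k; rewrite hw => /eqP.
  rewrite -subr_eq0 -mulrBl mulf_eq0 => /orP[|/eqP//]; rewrite subr_eq0 eq_sym => /eqP.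
  move=> /cos_eigenvalue_mu_axis[i ki]; exfalso; move/negP : kr; apply.
  by rewrite ki; apply/map_f; rewrite mem_enum.
have w'0 := cosH_complete ort.
have dp : dirichlet w' p = 0.
  by rewrite dirichlet_cos_sum big1// => k _; rewrite ort !mulr0.
have dw' : dirichlet w' w' = 0.
  rewrite dirichlet_linr dp mulr0 addr0 dirichletC hw dotC.
  by rewrite (ae_zero_dot _ (dot_eq0_ae_zero w'0)) mulr0.
have [sp gp] := smooth_cos_sum ab r c.
exists (p : _ -> R); apply: is_trace_ae_eq => //.
  by rewrite -w'0; apply: eq_Rintegral => x _; rewrite /w' /=; ring.
move=> i.
have : \int[lambda]_(x in Omega) (grad w' i x * grad w' i x) = 0.
  apply/eqP; rewrite eq_le; apply/andP; split; last first.
    by apply: Rintegral_ge0 => x _; rewrite -expr2 sqr_ge0.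
  rewrite -dw' /dirichlet (bigD1 i)//= lerDl; apply: sumr_ge0 => j _.
  by apply: Rintegral_ge0 => x _; rewrite -expr2 sqr_ge0.
by move=> <-; apply: eq_Rintegral => x _; rewrite /w' /= -/p gp; ring.
Qed.

(** Testing with 1 shows that [w] has mean zero, so the constant Neumann datum of the boundary
    problem is 0 and the two weak equations agree. *)
Lemma neumann_boundary_eigenspace w : neumann_eigenspace Omega mu w ->
  boundary_mean_zero_eigenspace a b mu w.
Proof.
move=> hw; have [T tw] := neumann_trace hw; split.
  by exists T => //; exact: neumann_boundary_mean hw tw.
move=> phi S _; have := neumann_mean_zero hw; rewrite dot_one => ->.
by rewrite mulr0 mul0r addr0 hw.
Qed.

End box_spectrum.

Theorem corollary5p2 (R : realType) (n : nat) (hn : (1 < n)%N)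
    (a b : 'rV[R]_n) (hab : forall i, a ord0 i < b ord0 i) :
  kappa1 a b = neumann_eigenvalue (box a b) 2 /\
  boundary_mean_zero_eigenspace a b (kappa1 a b) =
    neumann_eigenspace (box a b) (neumann_eigenvalue (box a b) 2).
Proof.
case: n hn a b hab => [//|n]; rewrite ltnS => n_gt0 a b ab.
rewrite (kappa1_box ab n_gt0) (neumann_eigenvalue2_box ab); split=> //.
apply/seteqP; split=> w.
- exact: boundary_eigenspace_neumann.
- exact: neumann_boundary_eigenspace.
Qed.
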